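(* Consider the Cramér–Lundberg model with loan and dividend barrier and its smoothed version described in the context, with value functions $V:E\to\mathbb{R}$ and $V^\varepsilon:E\to\mathbb{R}$, and suppose that the jump size distribution function $F_Y$ admits a density $f_Y=F_Y'$ with $f_Y\in C_0^2$. Then there exists a constant $C>0$ such that $\|V^\varepsilon-V\|_\infty\le C\,\varepsilon$ for all $\varepsilon>0$ for which the smoothed model is defined (i.e. $0<\varepsilon<\min(b/2,\,c/\rho)$).
   Context: **Parameters.** $c>0$ (premium rate), $\rho>0$ (loan interest rate), $b>0$ (dividend barrier), $\lambda_N>0$ (claim intensity), $\delta>0$ (discount rate). $Y$ is a positive random variable (claim size) with distribution function $F_Y$. $f_Y\in C^2_0$ means that the density $f_Y$ is twice continuously differentiable on $[0,\infty)$ with $f_Y,f_Y',f_Y''$ bounded and vanishing at infinity. **State space.** $E=\bigcup_{k=1}^4\{k\}\times E_k$ with $E_1=(-\frac c\rho,b)$, $E_2=(-\infty,-\frac c\rho)$, $E_3=\{-\frac c\rho\}$, $E_4=\{b\}$. The cemetery is $E^c=(\{2\}\times E_2)\cup(\{3\}\times E_3)$. **Original process $X$** (a piecewise deterministic Markov process). In component $1$ it moves along the flow $\phi_1$ of the ODE $\frac{\partial}{\partial t}\phi_1(y,t)=g_1(\phi_1(y,t))$, $\phi_1(y,0)=y$, where $g_1(y)=c$ for $y>0$, $g_1(y)=c+\rho y$ for $y\in(-\frac c\rho,0]$, $g_1(y)=0$ for $y\le-\frac c\rho$. In components $2,3,4$ it does not move between jumps. On reaching $b$ from component $1$ it passes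 immediately to $(4,b)$. Random jumps occur with constant intensity $\lambda_N$ in components $1$ and $4$ and never in components $2,3$; at a random jump from $(1,y)$ or from $(4,b)$ (in which case $y=b$) the new position is $y-Y$, with $Y\sim F_Y$ independent of the past, placed in that one of the components $1,2,3$ with $y-Y\in E_k$. **Original value function.** The running reward $\ell$ is $\ell_4\equiv c$ on $E_4$ and $0$ on the other components; there is no terminal cost. With $\tau=\inf\{t\ge0:X_t\in E^c\}$, $$V(x)=\mathbb{E}_x\left(\int_0^\tau e^{-\delta s}\ell(X_s)\,ds\right),\quad x\in E.$$ **Smoothed process $X^\varepsilon$.** All specifications are as for $X$, except that the flow in component $1$ is the flow $\phi_1^\varepsilon$ of the ODE with right-hand side $$g_1^\varepsilon(y)=\begin{cases} c, & y\in(\varepsilon,b-\varepsilon],\\ \dfrac{c(b-y)^3\left(15\varepsilon(y-b)+6(b-y)^2+10\varepsilon^2\right)}{\varepsilon^5}, & y\in(b-\varepsilon,b),\\ c+\rho y, & y\in(-\frac c\rho,-\varepsilon),\\ c+\dfrac{\rho(y+3\varepsilon)(y-\varepsilon)^3}{16\varepsilon^3}, & y\in[-\varepsilon,\varepsilon],\\ 0,& y\in(-\infty,-\frac c\rho]\cup[b,\infty),\end{cases}$$ (so that $b$ is never reached from component $1$). **Smoothed value function.** The running reward $\ell^\varepsilon$ equals $\ell$ except that on component $1$ it is $\ell_1^\varepsilon(y)=c\,h\!\left(\frac{y-b+\varepsilon}{\varepsilon}\right)$, where $h(y)=0$ for $y<-1$, $h(y)=\frac12+\frac{15y}{16}-\frac{5y^3}{8}+\frac{3y^5}{16}$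 for $y\in[-1,1]$, and $h(y)=1$ for $y>1$. With $\tau^\varepsilon=\inf\{t\ge0:X^\varepsilon_t\in E^c\}$, $$V^\varepsilon(x)=\mathbb{E}_x\left(\int_0^{\tau^\varepsilon}e^{-\delta s}\ell^\varepsilon(X^\varepsilon_s)\,ds\right),\quad x\in E.$$ $\|\cdot\|_\infty$ denotes the supremum norm over $E$. *)

(* Defs.v *)
From HB Require Import structures.
From mathcomp Require Import all_boot all_order all_algebra.
From mathcomp Require Import all_classical all_reals all_analysis.

Set Implicit Arguments.
Unset Strict Implicit.
Unset Printing Implicit Defensive.

Import Order.TTheory GRing.Theory Num.Theory.
Import numFieldNormedType.Exports.

Local Open Scope classical_set_scope.
Local Open Scope ring_scope.

(* A state is a pair (component label, position). *)
Definition component {R : realType} (c rho b : R) (k : nat) : set R :=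
  match k with
  | 1%N => `] - (c / rho), b[
  | 2%N => `]-oo, - (c / rho)[
  | 3%N => [set - (c / rho)]
  | 4%N => [set b]
  | _ => set0
  end.

Definition state_space {R : realType} (c rho b : R) : set (nat * R) :=
  \bigcup_(k in [set k | (1 <= k <= 4)%N]) ([set k] `*` component c rho b k).

Definition cemetery {R : realType} (c rho b : R) : set (nat * R) :=
  ([set 2%N] `*` component c rho b 2) `|` ([set 3%N] `*` component c rho b 3).

Definition g1 {R : realType} (c rho y : R) : R :=
  if 0 < y then c
  else if - (c / rho) < y then c + rho * y
  else 0.

Definition g1_eps {R : realType} (c rho b eps y : R) : R :=
  if y <= - (c / rho) then 0
  else if y < - eps then c + rho * y
  else if y <= eps then
    c + rho * (y + 3 * eps) * (y - eps) ^+ 3 / (16 * eps ^+ 3)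
  else if y <= b - eps then c
  else if y < b then
    c * (b - y) ^+ 3
      * (15 * eps * (y - b) + 6 * (b - y) ^+ 2 + 10 * eps ^+ 2) / eps ^+ 5
  else 0.

Definition is_flow {R : realType} (g : R -> R) (phi : R -> R -> R) : Prop :=
  forall y, phi y 0 = y /\
    forall t : R, is_derive t (1 : R) (phi y) (g (phi y t)).

Definition ell {R : realType} (c : R) (x : nat * R) : R :=
  if x.1 == 4%N then c else 0.

Definition h {R : realType} (y : R) : R :=
  if y < -1 then 0
  else if y <= 1 then
    1 / 2 + 15 * y / 16 - 5 * y ^+ 3 / 8 + 3 * y ^+ 5 / 16
  else 1.

Definition ell_eps {R : realType} (c b eps : R) (x : nat * R) : R :=
  if x.1 == 1%N then c * h ((x.2 - b + eps) / eps) else ell c x.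

(* Deterministic motion for a duration t. Component 1 is left for (4, b) at the
   first time its flow reaches b; the same rule serves the smoothed process,
   whose flow never reaches b. *)
Definition motion {R : realType} (b : R) (phi : R -> R -> R)
    (x : nat * R) (t : R) : nat * R :=
  if x.1 == 1%N then
    if `[< exists2 s, 0 <= s <= t & phi x.2 s = b >] then (4%N, b)
    else (1%N, phi x.2 t)
  else x.

(* Component of the position after a claim, which is almost surely below b. *)
Definition place {R : realType} (c rho z : R) : nat * R :=
  if - (c / rho) < z then (1%N, z)
  else if z < - (c / rho) then (2%N, z)
  else (3%N, z).

(* No jump occurs in components 2 and 3. *)
Definition jump {R : realType} (c rho : R) (x : nat * R) (y : R) : nat * R :=
  if (x.1 == 1%N) || (x.1 == 4%N) then place c rho (x.2 - y) else x.

(* The path of the process from x is a function of the successive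
   inter-arrival times T 0, T 1, etc. and claim sizes Y 0, Y 1, etc. *)
Definition jump_time {R : realType} (T : nat -> R) (n : nat) : R :=
  \sum_(i < n) T i.

Fixpoint post_jump {R : realType} (c rho b : R) (phi : R -> R -> R)
    (T Y : nat -> R) (x : nat * R) (n : nat) : nat * R :=
  if n is m.+1 then
    jump c rho (motion b phi (post_jump c rho b phi T Y x m) (T m)) (Y m)
  else x.

(* The least n such that s < jump_time T n.+1; the default 0 only matters on
   the null event that infinitely many claims arrive in finite time. *)
Definition njumps {R : realType} (T : nat -> R) (s : R) : nat :=
  xget 0%N [set n | s < jump_time T n.+1 /\
                    forall m, (m < n)%N -> jump_time T m.+1 <= s].

Definition process {R : realType} (c rho b : R) (phi : R -> R -> R)
    (T Y : nat -> R) (x : nat * R) (s : R) : nat * R :=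
  let n := njumps T s in
  motion b phi (post_jump c rho b phi T Y x n) (s - jump_time T n).

Definition ruin_time {R : realType} (c rho b : R) (phi : R -> R -> R)
    (T Y : nat -> R) (x : nat * R) : \bar R :=
  ereal_inf [set s%:E | s in
    [set s | 0 <= s /\ cemetery c rho b (process c rho b phi T Y x s)]].

(* The integrand is at most c * expR (- delta * s) for both running rewards l
   used here, so that this integral is finite. *)
Definition discounted_reward {R : realType} (c rho b delta : R)
    (phi : R -> R -> R) (l : nat * R -> R) (T Y : nat -> R) (x : nat * R) : R :=
  \int[lebesgue_measure]_(s in
      [set s | 0 <= s /\ (s%:E <= ruin_time c rho b phi T Y x)%E])
    (expR (- (delta * s)) * l (process c rho b phi T Y x s)).

Definition value {R : realType} {d} {Omega : measurableType d}
    (P : probability Omega R) (T Y : nat -> {RV P >-> R})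
    (c rho b delta : R) (phi : R -> R -> R) (l : nat * R -> R)
    (x : nat * R) : \bar R :=
  'E_P[fun w => discounted_reward c rho b delta phi l
                  (fun n => T n w) (fun n => Y n w) x]%E.

Definition mutually_independent {R : realType} {d} {Omega : measurableType d}
    (P : probability Omega R) (I : eqType) (X : I -> {RV P >-> R}) : Prop :=
  forall (J : seq I) (A : I -> set R), uniq J ->
    (forall i, measurable (A i)) ->
    (P (\bigcap_(i in [set` J]) (X i @^-1` A i))
     = \prod_(i <- J) P (X i @^-1` A i))%E.

Definition has_derivative_Rplus {R : realType} (f f' : R -> R) : Prop :=
  forall x, 0 <= x ->
    (f y - f x) / (y - x)
      @[y --> within [set y | 0 <= y /\ y != x] (nbhs x)] --> f' x.

Definition bounded_vanishing {R : realType} (f : R -> R) : Prop :=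
  (exists M, forall x, 0 <= x -> `|f x| <= M) /\ f x @[x --> +oo] --> 0.

Definition C20 {R : realType} (f : R -> R) : Prop :=
  exists f1 f2 : R -> R,
    [/\ has_derivative_Rplus f f1, has_derivative_Rplus f1 f2,
        {within `[0, +oo[, continuous f2} &
        [/\ bounded_vanishing f, bounded_vanishing f1 & bounded_vanishing f2]].

(* f is a density on [0, +oo[, where the positive claims live; its values at
   negative points are irrelevant. *)
Definition has_density {R : realType} (F f : R -> R) : Prop :=
  [/\ forall x, 0 <= x -> 0 <= f x,
      forall y, ((F y)%:E = \int[lebesgue_measure]_(x in `[0%R, y]) (f x)%:E)%E &
      has_derivative_Rplus F f].

Definition driving_noise {R : realType} {d} {Omega : measurableType d}
    (P : probability Omega R) (lambdaN : R) (FY : R -> R)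
    (T Y : nat -> {RV P >-> R}) : Prop :=
  [/\ mutually_independent
        (fun i : nat + nat => match i with inl n => T n | inr n => Y n end),
      forall n A, measurable A ->
        distribution P (T n) A = exponential_prob lambdaN A,
      forall n y, cdf (Y n) y = (FY y)%:E &
      forall n, P [set w | 0 < Y n w] = 1%E].

Definition sup_norm {R : realType} {S : Type} (D : set S) (f : S -> \bar R) :
    \bar R :=
  ereal_sup [set `|f x|%E | x in D].

(* Main.v *)
Require Import Defs.
From HB Require Import structures.
From mathcomp Require Import all_boot all_order all_algebra.
From mathcomp Require Import ring lra.
From mathcomp Require Import all_classical all_reals all_analysis.
From mathcomp Require Import measurable_realfun.

Set Implicit Arguments.
Unset Strict Implicit.
Unset Printing Implicit Defensive.

Import Order.TTheory GRing.Theory Num.Theory.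
Import numFieldNormedType.Exports.

Local Open Scope classical_set_scope.
Local Open Scope ring_scope.

(** A state is determined by its position z: positions z <= a := - (c / rho) are
    ruined, and z = b is component 4. Between claims the position follows a flow
    capped at b ([stopped_flow]), and each path earns at a rate l depending on the
    position only. Both values therefore satisfy a renewal equation V = A V, where
    [one_step] is the operator A f (z) = E [reward up to the first claim
    + exp (- delta T) f (position after the claim)], T being exponential and the
    claim size having the density f_Y.

    The equation is used through its iterates. For every n, the expected reward up
    to the n-th claim is (A^n 0) (z) ([chain_expectation]), and what follows the
    n-th claim is worth at most (c / delta) r^n, with r := E [exp (- delta T)]
    = lambda / (lambda + delta) < 1 ([value_iteration_bounds]). The iterates involve
    the noise only through its two laws, so that processes living on different
    probability spaces can be compared.

    It remains to compare A^n 0 with its smoothed analogue, uniformly in n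
    ([iter_one_step_perturbation]). One more step changes the difference by three
    contributions: the difference kappa between the two rewards earned before the
    claim, the effect of the difference zeta between the two positions just before
    the claim, and r times the previous difference. Since r < 1, a geometric series
    bounds the total by a multiple of kappa + zeta. The second contribution would
    not be controlled by zeta for an arbitrary claim law, because value functions
    need not be Lipschitz; but the expectation of u (p - Y) is Lipschitz in p for
    every bounded u that vanishes at ruin, because the density f_Y is bounded and
    Lipschitz on the half-line ([claim_smoothing]).

    Both zeta and kappa are O(eps).

    - Positions ([smoothed_flow_lag]). The smoothed drift is below the original one
      and differs from it only on [-eps, eps], by at most rho eps, and on the last
      interval before b, where the original flow, capped at b, is at most eps ahead.
      Before that interval, a barrier argument shows that the lag is at most
      (2 rho eps / c) times the distance covered, which is at most b - a.

    - Rewards ([reward_gap]). The smoothed process never reaches b and earns only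
      c h(...) < c near b, possibly for ever, so the loss has to be integrated over
      an unbounded time. The decisive fact is that, above -eps, the missing reward
      c - l^eps is at most twice the speed g_1^eps ([reward_deficit_le]): the
      integral of the loss is then at most twice the distance that remains to b
      when the original process reaches b, that is, twice the lag. Before that
      moment the two rewards differ only while the original flow crosses
      [b - 2 eps, b], at speed c.

    These estimates assume 2 rho eps <= c. For larger eps the bound is immediate,
    since both values lie in [0, c / delta]. *)

(** * Derivatives and differential inequalities *)

Section scalar_calculus.
Context {R : realType}.
Implicit Types (f df : R -> R) (a b t L : R).

Lemma is_derive_continuous f df :
  (forall t, is_derive t (1 : R) f (df t)) -> continuous f.
Proof.
move=> fdf t; apply: differentiable_continuous.
by apply/derivable1_diffP; case: (fdf t).
Qed.

Lemma is_derive_increment f df a b :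
    (forall t, is_derive t (1 : R) f (df t)) -> a <= b ->
  exists2 t, a <= t <= b & f b - f a = df t * (b - a).
Proof.
move=> fdf ab.
have cf : {within `[a, b], continuous f}.
  by apply: continuous_subspaceT; exact: is_derive_continuous fdf.
have [t tab ->] := MVT_segment ab (fun t _ => fdf t) cf.
by exists t => //; move: tab; rewrite in_itv.
Qed.

Lemma is_derive_ndecr f df a b :
    (forall t, is_derive t (1 : R) f (df t)) ->
    (forall t, a <= t <= b -> 0 <= df t) -> a <= b ->
  f a <= f b.
Proof.
move=> fdf df0 ab; have [t /df0 ? fab] := is_derive_increment fdf ab.
by rewrite -subr_ge0 fab mulr_ge0// subr_ge0.
Qed.

(** Along an interval on which f is positive, t |-> f t * expR (- L * t) is
    nonincreasing, so f cannot leave the nonpositive half-line. This is the form of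
    Gronwall's inequality used for all comparisons of flows: the differential
    inequality is only required where f is positive. *)
Lemma is_derive_barrier f df L T :
    (forall t, is_derive t (1 : R) f (df t)) -> 0 <= T -> f 0 <= 0 ->
    (forall t, 0 <= t <= T -> 0 < f t -> df t <= L * f t) ->
  f T <= 0.
Proof.
move=> fdf T0 f0 dfL; rewrite leNgt; apply/negP => fT.
have cf := is_derive_continuous fdf.
pose A := [set t | 0 <= t <= T /\ f t <= 0].
have A0 : A !=set0 by exists 0; split=> //; rewrite lexx.
have ubA : ubound A T by move=> t [/andP[]].
have supA : A (sup A).
  have clA : closed A.
    rewrite (_ : A = `[0, T] `&` f @^-1` [set x | x <= 0]).
      apply: closedI; first exact: itv_closed.
      by apply: closed_comp; [move=> ? _; exact: cf|exact: closed_le].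
    by apply/seteqP; split => t /=; rewrite in_itv.
  rewrite closure_id in clA; rewrite [X in X _]clA.
  by apply: closure_sup => //; exists T.
(* s is the last time in [0, T] at which f is nonpositive *)
have [/andP[s0 sT] fs] := supA; set s := sup A in s0 sT fs.
have fpos t : s < t <= T -> 0 < f t.
  move=> /andP[st tT]; rewrite ltNge; apply/negP => ft.
  have : t <= s by apply: ub_le_sup; [exists T|split=> //; lra].
  by rewrite leNgt st.
pose g t := f t * expR (- L * t).
pose dg t := (df t - L * f t) * expR (- L * t).
have gdg t : is_derive t (1 : R) g (dg t).
  rewrite /g /dg.
  have := fdf t => ?.
  apply: is_derive_eq.
  by rewrite !scaler1 !/GRing.scale/=; ring.
have sT' : s < T by rewrite lt_neqAle sT andbT; apply/eqP => sTE; move: fs; rewrite sTE leNgt fT.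
have cg : {within `[s, T], continuous g}.
  by apply: continuous_subspaceT; exact: is_derive_continuous gdg.
have [u /[!in_itv]/= /andP[su uT] e] := MVT sT' (fun t _ => gdg t) cg.
have gT : 0 < g T by rewrite mulr_gt0 ?expR_gt0.
have gs : g s <= 0 by rewrite mulr_le0_ge0 ?expR_ge0.
have dgu : dg u <= 0.
  rewrite mulr_le0_ge0 ?expR_ge0// subr_le0 dfL ?fpos//; first by lra.
  by rewrite su ltW.
have : dg u * (T - s) <= 0 by rewrite mulr_le0_ge0// subr_ge0 ltW.
lra.
Qed.
End scalar_calculus.

(** * Flows of one-sided Lipschitz fields *)

(** The one-sided Lipschitz condition, under which forward flows depend in a
    Lipschitz way on the starting point. It puts no limit on how fast g decreases,
    so that the smoothed drift, which drops from c to 0 over a length eps, satisfies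
    it with a constant L that does not depend on eps. *)
Definition one_sided_lipschitz {R : realType} (L : R) (g : R -> R) : Prop :=
  forall x y, x <= y -> g y - g x <= L * (y - x).

Section flow.
Context {R : realType} (c L : R) (g : R -> R) (phi : R -> R -> R).
Hypothesis g_bnd : forall y, 0 <= g y <= c.
Hypothesis g_one_sided : one_sided_lipschitz L g.
Hypothesis phi_flow : is_flow g phi.

Lemma flow0 y : phi y 0 = y.
Proof. by have [] := phi_flow y. Qed.

Lemma flow_is_derive y t : is_derive t (1 : R) (phi y) (g (phi y t)).
Proof. by have [_] := phi_flow y; exact. Qed.

Lemma flow_continuous y : continuous (phi y).
Proof. exact: is_derive_continuous (flow_is_derive y). Qed.

Lemma flow_ndecr y s t : s <= t -> phi y s <= phi y t.
Proof.
apply: is_derive_ndecr (flow_is_derive y) _ => u _.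
by have /andP[] := g_bnd (phi y u).
Qed.

Lemma flow_ge y t : 0 <= t -> y <= phi y t.
Proof. by move=> t0; rewrite -{1}(flow0 y) flow_ndecr. Qed.

Lemma flow_speed y s t : s <= t -> phi y t - phi y s <= c * (t - s).
Proof.
move=> st; have [u _ ->] := is_derive_increment (flow_is_derive y) st.
by rewrite ler_wpM2r ?subr_ge0//; have /andP[] := g_bnd (phi y u).
Qed.

(** A nonpositive difference of the two flows stays nonpositive: at a point where
    it is positive, the two drifts are compared at the same position first, and the
    one-sided Lipschitz condition does the rest. *)
Lemma flow_le g' phi' y y' t : is_flow g' phi' ->
  (forall x, g' x <= g x) -> y' <= y -> 0 <= t -> phi' y' t <= phi y t.
Proof.
move=> flow' g'g y'y t0; rewrite -subr_le0.
pose f t := phi' y' t - phi y t.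
pose df t := g' (phi' y' t) - g (phi y t).
have fdf u : is_derive u (1 : R) f (df u).
  have := flow_is_derive y u; have := (flow' y').2 u => ? ?.
  exact: is_deriveB.
apply: (is_derive_barrier (L := L) fdf t0).
  by rewrite /f flow0 (flow' y').1 subr_le0.
move=> u _; rewrite subr_gt0 => /ltW/g_one_sided; apply: le_trans.
by rewrite /df lerB.
Qed.

Lemma flow_lipschitz y y' t : y <= y' -> 0 <= t ->
  phi y' t - phi y t <= expR (L * t) * (y' - y).
Proof.
move=> yy' t0; rewrite -subr_le0.
pose f t := phi y' t - phi y t - expR (L * t) * (y' - y).
pose df t := g (phi y' t) - g (phi y t) - L * expR (L * t) * (y' - y).
have fdf u : is_derive u (1 : R) f (df u).
  have := flow_is_derive y u; have := flow_is_derive y' u => ? ?.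
  rewrite /f /df; apply: is_derive_eq.
  by rewrite !scaler0 !scaler1 /GRing.scale/=; ring.
apply: (is_derive_barrier (L := L) fdf t0).
  by rewrite /f !flow0 mulr0 expR0 mul1r subrr.
move=> u /andP[u0 _] _.
have /g_one_sided := flow_le phi_flow (fun x => lexx _) yy' u0.
rewrite /df /f; lra.
Qed.

End flow.

(** A superlevel set of f is the union of the quadrants above its rational points:
    by monotonicity it contains them, and by lower semicontinuity from below each of
    its points lies in one of them. *)
Lemma measurable_ndecr2 {R : realType} (f : R -> R -> R) :
    (forall x x' y y', x <= x' -> y <= y' -> f x y <= f x' y') ->
    (forall x y r, r < f x y -> exists2 e, 0 < e &
       forall x' y', x - e < x' < x -> y - e < y' < y -> r < f x' y') ->
  measurable_fun [set: R * R] (fun p => f p.1 p.2).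
Proof.
move=> f_nd f_lc.
apply: (measurability _ (RGenOInfty.measurableE R)) => //.
move=> /= _ [_ [r ->] <-]; rewrite setTI.
pose F (q q' : rat) : set (R * R) :=
  if r < f (ratr q) (ratr q') then `[ratr q, +oo[ `*` `[ratr q', +oo[ else set0.
rewrite [X in measurable X](_ : _ = \bigcup_q \bigcup_q' F q q').
  apply: bigcupT_measurable_rat => q; apply: bigcupT_measurable_rat => q'.
  rewrite /F; case: ifPn => // _.
  by apply: measurableX; exact: measurable_itv.
apply/seteqP; split => [[x y]/=|[x y] [q _ [q' _]]]; last first.
  rewrite /F; case: ifPn => // rq [] /=; rewrite !in_itv/= !andbT => qx q'y.
  exact: lt_le_trans rq (f_nd _ _ _ _ qx q'y).
rewrite in_itv/= andbT => rf.
have [e e0 fe] := f_lc x y r rf.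
have xe (z : R) : z - e < z by lra.
have [q /[!in_itv]/= qx] := rat_in_itvoo (xe x).
have [q' /[!in_itv]/= q'y] := rat_in_itvoo (xe y).
exists q => //; exists q' => //; rewrite /F fe//=.
by rewrite !in_itv/= !andbT; split; lra.
Qed.

Section killed_flow.
Context {R : realType} (a b c L : R) (g : R -> R) (phi : R -> R -> R).
Hypothesis g_bnd : forall y, 0 <= g y <= c.
Hypothesis g_one_sided : one_sided_lipschitz L g.
Hypothesis phi_flow : is_flow g phi.

(** Position at time t of a process started at position z: ruined positions do not
    move, and the barrier b is not crossed. The maximum makes this total in t while
    keeping it monotone in both variables, whence its joint measurability. *)
Definition stopped_flow (z t : R) : R :=
  if z <= a then z else Num.min (phi z (Num.max t 0)) b.

Lemma measurable_flow :
  measurable_fun [set: R * R] (fun p => phi p.1 (Num.max p.2 0)).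
Proof.
apply: (measurable_ndecr2 (f := fun z t => phi z (Num.max t 0))).
  move=> x x' y y' xx' yy'.
  have y0 : 0 <= Num.max y 0 by rewrite le_max lexx orbT.
  have yy : Num.max y 0 <= Num.max y' 0 by rewrite ge_max !le_max lexx yy' orbT.
  apply: (le_trans (flow_ndecr g_bnd phi_flow _ yy)).
  by apply: (flow_le g_one_sided phi_flow phi_flow) => //; exact: le_trans yy.
move=> x y r rf; set p := phi x _ in rf.
pose y0 := Num.max y 0.
pose K := expR (L * y0).
have K0 : 0 < K by rewrite expR_gt0.
have c0 : 0 <= c by have /andP[] := g_bnd 0; exact: le_trans.
have d0 : 0 < c + K by lra.
exists ((p - r) / (c + K)); first by rewrite divr_gt0// subr_gt0.
set e := _ / _; have ece : e * (c + K) = p - r by rewrite /e divfK ?gt_eqF.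
have e0 : 0 < e by rewrite divr_gt0// subr_gt0.
move=> x' y' /andP[x1 x2] /andP[y1 y2].
have y00 : 0 <= y0 by rewrite le_max lexx orbT.
set s := Num.max y' 0.
have [sy ys] : s <= y0 /\ y0 - s <= e.
  rewrite /s /y0; split; first by rewrite ge_max !le_max lexx (ltW y2) orbT.
  by case: (leP y 0); case: (leP y' 0); lra.
have h1 : p - phi x' y0 <= K * (x - x').
  exact: (flow_lipschitz g_one_sided phi_flow (ltW x2) y00).
have h2 := flow_speed g_bnd phi_flow x' sy.
have h3 : K * (x - x') < K * e by rewrite ltr_pM2l//; lra.
have h4 : c * (y0 - s) <= c * e by rewrite ler_wpM2l.
rewrite -/s; nra.
Qed.

Lemma measurable_stopped_flow :
  measurable_fun [set: R * R] (fun p => stopped_flow p.1 p.2).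
Proof.
apply: measurable_fun_if => //.
- apply: measurable_fun_ler => //; exact: measurable_cst.
- exact: measurable_funS measurable_fst.
- apply: measurable_minr; last exact: measurable_cst.
  exact: measurable_funS measurable_flow.
Qed.

Lemma stopped_flow_dead z t : z <= a -> stopped_flow z t = z.
Proof. by rewrite /stopped_flow => ->. Qed.

Lemma stopped_flow_le z t : a < z -> stopped_flow z t <= b.
Proof. by move=> az; rewrite /stopped_flow (lt_geF az) ge_min lexx orbT. Qed.

End killed_flow.

(** * The two drifts *)

Section smoothing_polynomials.
Context {R : realType}.

(** The quintic interpolation from 0 to 1 with two vanishing derivatives at both
    ends. Both the smoothed drift near b and the function h are rescalings of it. *)
Definition smoothstep (v : R) : R := v ^+ 3 * (10 - 15 * v + 6 * v ^+ 2).

(** Profile of the smoothed drift on [-eps, eps], where it equals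
    c - rho * eps * kink ((eps - y) / (2 * eps)). *)
Definition kink (w : R) : R := w ^+ 3 * (2 - w).

Lemma is_derive_smoothstep v :
  is_derive v (1 : R) smoothstep (30 * (v * (1 - v)) ^+ 2).
Proof.
rewrite /smoothstep; apply: is_derive_eq.
by rewrite ?scaler0 ?scaler1 /GRing.scale/=; ring.
Qed.

Lemma is_derive_kink w : is_derive w (1 : R) kink (2 * w ^+ 2 * (3 - 2 * w)).
Proof.
rewrite /kink; apply: is_derive_eq.
by rewrite ?scaler0 ?scaler1 /GRing.scale/=; ring.
Qed.

Lemma smoothstep_ndecr : {homo smoothstep : v v' / v <= v'}.
Proof.
move=> v v'; apply: is_derive_ndecr is_derive_smoothstep _ => t _.
by rewrite mulr_ge0// sqr_ge0.
Qed.

Lemma smoothstep0 : smoothstep 0 = 0.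
Proof. by rewrite /smoothstep; ring. Qed.

Lemma smoothstep1 : smoothstep 1 = 1.
Proof. by rewrite /smoothstep; ring. Qed.

Lemma smoothstep01 v : 0 <= v <= 1 -> 0 <= smoothstep v <= 1.
Proof.
move=> /andP[v0 v1].
by have := smoothstep_ndecr v0; have := smoothstep_ndecr v1;
   rewrite smoothstep0 smoothstep1 => -> ->.
Qed.

Lemma kink_ndecr w w' : w <= w' -> w' <= 1 -> kink w <= kink w'.
Proof.
move=> ww' w'1; apply: (is_derive_ndecr is_derive_kink) ww' => t /andP[_ tw'].
by apply: mulr_ge0; [rewrite mulr_ge0// sqr_ge0|lra].
Qed.

Lemma kink0 : kink 0 = 0.
Proof. by rewrite /kink; ring. Qed.

Lemma kink1 : kink 1 = 1.
Proof. by rewrite /kink; ring. Qed.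

Lemma kink01 w : 0 <= w <= 1 -> 0 <= kink w <= 1.
Proof.
move=> /andP[w0 w1].
by have := kink_ndecr w0 w1; have := kink_ndecr w1 (lexx _);
   rewrite kink0 kink1 => -> ->.
Qed.

(** After rescaling, the slope bound 2 is the slope rho of the loan regime. *)
Lemma kink_increment w w' : 0 <= w -> w <= w' -> w' <= 1 ->
  kink w' - kink w <= 2 * (w' - w).
Proof.
move=> w0 ww' w1.
have [t /andP[wt tw] ->] := is_derive_increment is_derive_kink ww'.
rewrite ler_wpM2r ?subr_ge0// -subr_ge0.
rewrite [X in 0 <= X](_ : _ = 2 * ((1 - t) ^+ 2 * (1 + 2 * t))); last by ring.
by do 2 apply: mulr_ge0 => //; [exact: sqr_ge0|lra].
Qed.

(** The line 2 * w - 1 is the tangent at w = 1, and corresponds to c + rho * y: this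
    puts the smoothed drift below the original one on [-eps, 0]. *)
Lemma kink_ge w : w <= 1 -> -1 <= w -> 2 * w - 1 <= kink w.
Proof.
move=> w1 w2; rewrite -subr_ge0.
rewrite [X in 0 <= X](_ : _ = (1 - w) ^+ 3 * (1 + w)); last by rewrite /kink; ring.
by rewrite mulr_ge0// ?exprn_ge0//; lra.
Qed.

End smoothing_polynomials.

Section drifts.
Context {R : realType} (c rho b : R).
Hypotheses (c_gt0 : 0 < c) (rho_gt0 : 0 < rho) (b_gt0 : 0 < b).
Let a : R := - (c / rho).

Let rhoa : rho * a = - c.
Proof. by rewrite /a mulrN mulrCA divff ?mulr1// gt_eqF. Qed.

Let drift_gt0 y : a < y -> 0 < c + rho * y.
Proof. by rewrite -(ltr_pM2l rho_gt0) rhoa; lra. Qed.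

Let drift_le0 y : y <= a -> c + rho * y <= 0.
Proof. by rewrite -(ler_pM2l rho_gt0) rhoa; lra. Qed.

Lemma barrier_gt_ruin : a < b.
Proof. by rewrite (@lt_trans _ _ 0)// oppr_lt0 divr_gt0. Qed.

Lemma g1_bnd y : 0 <= g1 c rho y <= c.
Proof.
have c_ge0 := ltW c_gt0.
rewrite /g1; case: ltP => [y0|y0]; first by rewrite c_ge0 lexx.
case: ltP => [ay|ay]; last by rewrite lexx.
have := drift_gt0 ay; have : rho * y <= 0 by rewrite mulr_ge0_le0// ltW.
lra.
Qed.

Lemma g1_le y : a < y -> g1 c rho y <= c + rho * y.
Proof.
move=> ay; rewrite /g1; case: ltP => [y0|y0]; last by rewrite ay.
by rewrite lerDl mulr_ge0// ltW.
Qed.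

Lemma g1_one_sided : one_sided_lipschitz rho (g1 c rho).
Proof.
move=> x y xy; have rxy : rho * x <= rho * y by rewrite ler_wpM2l// ltW.
have ryx0 z : 0 <= z -> 0 <= rho * z by move=> z0; rewrite mulr_ge0// ltW.
rewrite mulrBr; rewrite /g1.
case: (ltP 0 y) => [y0|y0]; case: (ltP 0 x) => [x0|x0]; last first.
- case: ltP => [/drift_gt0 ay|/drift_le0 ay]; case: ltP => [/drift_gt0 ax|/drift_le0 ax]; lra.
- by lra.
- have := ryx0 _ (ltW y0).
  by case: ltP => [/drift_gt0 ax|/drift_le0 ax]; lra.
- by lra.
Qed.

Variable eps : R.
Hypotheses (eps_gt0 : 0 < eps) (eps_b : eps < b / 2) (eps_a : eps < c / rho).
Let g := g1_eps c rho b eps.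

Let eps_ruin : rho * eps < c.
Proof. by rewrite mulrC -ltr_pdivlMr. Qed.

Let a_eps : a < - eps.
Proof. by rewrite /a ltrN2. Qed.

Let eps_neq0 : eps != 0. Proof. by rewrite gt_eqF. Qed.

Local Ltac param_lra :=
  move: (c_gt0) (rho_gt0) (b_gt0) (eps_gt0) (eps_b) (a_eps) (rhoa) (eps_ruin); lra.

Lemma g1_eps_dead y : y <= a -> g y = 0.
Proof. by rewrite /g /g1_eps => ->. Qed.

Lemma g1_eps_top y : b <= y -> g y = 0.
Proof.
move=> yb; rewrite /g /g1_eps; have ay := lt_le_trans barrier_gt_ruin yb.
rewrite (lt_geF ay) !ifF//; apply/negbTE; rewrite -?ltNge -?leNgt; param_lra.
Qed.

Lemma g1_eps_kink y : - eps <= y <= eps ->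
  g y = c - rho * eps * kink ((eps - y) / (2 * eps)).
Proof.
move=> /andP[y1 y2]; rewrite /g /g1_eps (lt_geF (lt_le_trans a_eps y1)).
rewrite ltNge y1/= y2 /kink; field.
by rewrite eps_neq0.
Qed.

Lemma g1_eps_loan y : a <= y <= - eps -> g y = c + rho * y.
Proof.
rewrite le_eqVlt => /andP[/predU1P[<- _|ay]].
  by rewrite g1_eps_dead ?lexx// rhoa subrr.
rewrite le_eqVlt => /predU1P[->|ye]; last first.
  by rewrite /g /g1_eps (lt_geF ay) ye.
rewrite g1_eps_kink; last by param_lra.
rewrite (_ : _ / _ = 1) ?kink1; last by field.
by ring.
Qed.

Lemma g1_eps_premium y : eps <= y <= b - eps -> g y = c.
Proof.
rewrite le_eqVlt => /andP[/predU1P[<- _|ey yb]].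
  rewrite g1_eps_kink; last by param_lra.
  by rewrite subrr mul0r kink0 mulr0 subr0.
rewrite /g /g1_eps (lt_geF (_ : a < y)); last by param_lra.
by rewrite ltNge (_ : - eps <= y)/=; [rewrite (lt_geF ey) yb|param_lra].
Qed.

Lemma g1_eps_barrier y : b - eps <= y <= b ->
  g y = c * smoothstep ((b - y) / eps).
Proof.
move=> /andP[]; rewrite le_eqVlt => /predU1P[<- _|y1].
  rewrite g1_eps_premium; last by param_lra.
  by rewrite opprB addrC subrK divff// smoothstep1 mulr1.
rewrite le_eqVlt => /predU1P[->|yb].
  by rewrite g1_eps_top// subrr mul0r smoothstep0 mulr0.
rewrite /g /g1_eps (lt_geF (_ : a < y)); last by param_lra.
rewrite ltNge (_ : - eps <= y)/=; last by param_lra.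
rewrite (lt_geF (_ : eps < y)); last by param_lra.
by rewrite (lt_geF y1) yb /smoothstep; field.
Qed.

Let kink_arg y : - eps <= y <= eps -> 0 <= (eps - y) / (2 * eps) <= 1.
Proof.
move=> ye; rewrite divr_ge0 ?ler_pdivrMr ?mul1r; param_lra.
Qed.

Let step_arg y : b - eps <= y <= b -> 0 <= (b - y) / eps <= 1.
Proof.
move=> ye; rewrite divr_ge0 ?ler_pdivrMr ?mul1r; param_lra.
Qed.

(** The six formulas agree at the endpoints of their intervals, so each case may
    assume its closed interval. *)
Lemma g1_eps_case (P : R -> R -> Prop) :
    (forall y, y <= a -> P y 0) ->
    (forall y, a < y <= - eps -> P y (c + rho * y)) ->
    (forall y, - eps <= y <= eps ->
      P y (c - rho * eps * kink ((eps - y) / (2 * eps)))) ->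
    (forall y, eps <= y <= b - eps -> P y c) ->
    (forall y, b - eps <= y <= b -> P y (c * smoothstep ((b - y) / eps))) ->
    (forall y, b <= y -> P y 0) ->
  forall y, P y (g y).
Proof.
move=> P1 P2 P3 P4 P5 P6 y.
have [ya|ya] := leP y a; first by rewrite g1_eps_dead//; exact: P1.
have [y1|y1] := leP y (- eps).
  by rewrite g1_eps_loan ?(ltW ya)//; apply: P2; rewrite ya.
have [y2|y2] := leP y eps.
  by rewrite g1_eps_kink ?(ltW y1)//; apply: P3; rewrite (ltW y1).
have [y3|y3] := leP y (b - eps).
  by rewrite g1_eps_premium ?(ltW y2)//; apply: P4; rewrite (ltW y2).
have [y4|y4] := leP y b.
  by rewrite g1_eps_barrier ?(ltW y3)//; apply: P5; rewrite (ltW y3).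
by rewrite g1_eps_top ?(ltW y4)//; apply: P6; rewrite (ltW y4).
Qed.

Lemma g1_eps_bnd y : 0 <= g y <= c.
Proof.
apply: (g1_eps_case (P := fun y z => 0 <= z <= c)) => {}y ye.
- by param_lra.
- move: ye => /andP[/drift_gt0 y1 y2].
  have : rho * y <= 0 by rewrite mulr_ge0_le0//; param_lra.
  by param_lra.
- have := kink01 (kink_arg ye); set k := kink _ => /andP[k0 k1].
  have re : 0 <= rho * eps by rewrite mulr_ge0// ltW.
  have := mulr_ge0 re k0.
  have := ler_wpM2l re k1.
  by param_lra.
- by param_lra.
- have /andP[s0 s1] := smoothstep01 (step_arg ye).
  by rewrite mulr_ge0 ?(ltW c_gt0)//= ger_pMr.
- by param_lra.
Qed.

Lemma g1_eps_le y : g y <= g1 c rho y.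
Proof.
apply: (g1_eps_case (P := fun y z => z <= g1 c rho y)) => {}y ye.
- by have /andP[] := g1_bnd y.
- by rewrite /g1 ltNge (_ : y <= 0)/=; [case/andP: ye => ->|param_lra].
- have /andP[w0 w1] := kink_arg ye.
  have /andP[k0 k1] := kink01 (kink_arg ye).
  have re : 0 <= rho * eps by rewrite mulr_ge0// ltW.
  rewrite /g1; case: ifPn => y0; first by rewrite gerBl mulr_ge0.
  rewrite (_ : - _ < y)/=; last by rewrite (lt_le_trans a_eps)//; case/andP: ye.
  rewrite lerD2l -lerN2 opprK.
  have : 2 * ((eps - y) / (2 * eps)) - 1 <= kink ((eps - y) / (2 * eps)).
    by rewrite kink_ge//; param_lra.
  move/(ler_wpM2l re); apply: le_trans.
  by rewrite le_eqVlt; apply/orP; left; apply/eqP; field.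
- by rewrite /g1 (_ : 0 < y)//; param_lra.
- rewrite /g1 (_ : 0 < y)//; last by param_lra.
  have /andP[s0 s1] := smoothstep01 (step_arg ye).
  by rewrite ger_pMr.
- by have /andP[] := g1_bnd y.
Qed.

Lemma g1_eps_ge y : - eps <= y <= b - eps -> c - rho * eps <= g y.
Proof.
move=> /andP[y1 y2]; have [y3|y3] := leP y eps; last first.
  rewrite g1_eps_premium ?(ltW y3)//.
  by rewrite gerBl mulr_ge0// ltW.
have ye : - eps <= y <= eps by rewrite y1.
rewrite g1_eps_kink// lerD2l lerN2.
have /andP[k0 k1] := kink01 (kink_arg ye).
by rewrite ger_pMr// mulr_gt0.
Qed.

(** The bound holds on each of the six intervals, and one-sided Lipschitz bounds with
    the same constant can be chained across a common endpoint. *)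
Lemma g1_eps_one_sided : one_sided_lipschitz rho g.
Proof.
pose D u := forall x y, x <= y -> y <= u -> g y - g x <= rho * (y - x).
have D_step u v : D u ->
    (forall x y, u <= x -> x <= y -> y <= v -> g y - g x <= rho * (y - x)) -> D v.
  move=> Du uv x y xy yv.
  have [yu|uy] := leP y u; first exact: Du.
  have [ux|xu] := leP u x; first exact: uv.
  have := Du _ _ (ltW xu) (lexx u); have := uv _ _ (lexx u) (ltW uy) yv.
  param_lra.
have rmono x y : x <= y -> 0 <= rho * (y - x).
  by move=> xy; rewrite mulr_ge0 ?subr_ge0// ltW.
have re : 0 <= rho * eps by rewrite mulr_ge0// ltW.
have D1 : D a.
  move=> x y xy ya; rewrite !g1_eps_dead//; last exact: le_trans ya.
  by rewrite subrr rmono.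
have D2 : D (- eps).
  apply: D_step D1 _ => x y ax xy yv; rewrite !g1_eps_loan; param_lra.
have D3 : D eps.
  apply: D_step D2 _ => x y ux xy yv.
  have xe : - eps <= x <= eps by param_lra.
  have ye : - eps <= y <= eps by param_lra.
  have /andP[? ?] := kink_arg xe; have /andP[? ?] := kink_arg ye.
  rewrite !g1_eps_kink//.
  have := kink_increment (w := (eps - y) / (2 * eps)) (w' := (eps - x) / (2 * eps)).
  have -> : 2 * ((eps - x) / (2 * eps) - (eps - y) / (2 * eps)) = (y - x) / eps.
    by field.
  move=> H; have {}H : kink ((eps - x) / (2 * eps)) - kink ((eps - y) / (2 * eps)) <= (y - x) / eps.
    apply: H => //; rewrite ler_pM2r ?invr_gt0; param_lra.
  have := ler_wpM2l re H.
  have -> : rho * eps * ((y - x) / eps) = rho * (y - x) by field.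
  param_lra.
have D4 : D (b - eps).
  apply: D_step D3 _ => x y ux xy yv.
  by rewrite !g1_eps_premium ?subrr ?rmono//; param_lra.
have D5 : D b.
  apply: D_step D4 _ => x y ux xy yv.
  rewrite !g1_eps_barrier; [|param_lra|param_lra].
  apply: le_trans (rmono _ _ xy); rewrite subr_le0 ler_wpM2l ?(ltW c_gt0)//.
  by rewrite smoothstep_ndecr// ler_wpM2r ?invr_ge0 ?(ltW eps_gt0)//; param_lra.
move=> x y xy.
have : D (Num.max b y).
  apply: D_step D5 _ => u v bu uv _.
  by rewrite !g1_eps_top ?subrr ?rmono//; exact: le_trans uv.
by apply => //; rewrite le_max lexx orbT.
Qed.

End drifts.

(** The mean value theorem is applied to F minus the primitive of f, so that nothing
    has to be known about the integrability of dF. *)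
Lemma integral_le_increment {R : realType} (f F dF : R -> R) (s t : R) :
    continuous f -> (forall u, is_derive u (1 : R) F (dF u)) ->
    (forall u, s <= u <= t -> 0 <= f u <= dF u) -> s <= t ->
  (\int[lebesgue_measure]_(u in `[s, t]) (f u)%:E <= (F t - F s)%:E)%E.
Proof.
move=> cf FdF fdF; rewrite le_eqVlt => /predU1P[<-|st].
  by rewrite set_itv1 integral_set1 subrr.
have cF := is_derive_continuous FdF.
have intf : lebesgue_measure.-integrable `[s, t] (EFin \o f).
  apply: continuous_compact_integrable; first exact: segment_compact.
  exact: continuous_subspaceT.
pose I x := parameterized_integral lebesgue_measure s x f.
have dI u : u \in `]s, t[%R -> is_derive u (1 : R) I (f u).
  rewrite in_itv/= => /andP[su ut].
  have [dI I'] := continuous_FTC1_closed ut intf su (cf u).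
  by apply: DeriveDef; [exact: dI|rewrite -derive1E; exact: I'].
have cI : {within `[s, t], continuous I}.
  exact: parameterized_integral_continuous (ltW st) intf.
pose G x := F x - I x.
have dG u : u \in `]s, t[%R -> is_derive u (1 : R) G (dF u - f u).
  by move=> ust; have := FdF u; have := dI u ust => ? ?; exact: is_deriveB.
have cG : {within `[s, t], continuous G}.
  by move=> u; apply: continuousB; [exact: (continuous_subspaceT cF)|exact: cI].
have [u /[!in_itv]/= /andP[su ut] Gst] := MVT st dG cG.
have Is : I s = 0.
  by rewrite /I /parameterized_integral set_itv1 Rintegral_set1.
have ust : s <= u <= t by rewrite !ltW.
have /andP[f0 fF] := fdF u ust.
have intE : (\int[lebesgue_measure]_(u in `[s, t]) (f u)%:E = (I t)%:E)%E.
  by rewrite /I /parameterized_integral /Rintegral fineK//; exact: integrable_fin_num.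
rewrite intE lee_fin.
have : 0 <= G t - G s by rewrite Gst mulr_ge0//; lra.
rewrite /G Is; lra.
Qed.

(** * The two reward rates *)

Section running_rewards.
Context {R : realType} (c b : R).
Hypothesis c_gt0 : 0 < c.

Definition clamp01 (v : R) : R := Num.max 0 (Num.min v 1).

Lemma clamp01_bnd v : 0 <= clamp01 v <= 1.
Proof.
by rewrite /clamp01 /Order.max /Order.min; case: (ltP v 1) => ?; case: ltP => ?; lra.
Qed.

Lemma clamp01_id v : 0 <= v <= 1 -> clamp01 v = v.
Proof.
by rewrite /clamp01 /Order.max /Order.min; case: (ltP v 1) => ?; case: ltP => ?; lra.
Qed.

Lemma clamp01_le0 v : v <= 0 -> clamp01 v = 0.
Proof.
by rewrite /clamp01 /Order.max /Order.min; case: (ltP v 1) => ?; case: ltP => ?; lra.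
Qed.

Lemma clamp01_ge1 v : 1 <= v -> clamp01 v = 1.
Proof.
by rewrite /clamp01 /Order.max /Order.min; case: (ltP v 1) => ?; case: ltP => ?; lra.
Qed.

Lemma clamp01_ndecr : {homo clamp01 : v w / v <= w}.
Proof.
move=> v w; rewrite /clamp01 /Order.max /Order.min.
by case: (ltP v 1) => ?; case: (ltP w 1) => ?; do 2?[case: ltP => ?]; lra.
Qed.

Lemma clamp01_onem v : clamp01 (1 - v) = 1 - clamp01 v.
Proof.
rewrite /clamp01 /Order.max /Order.min.
by case: (ltP v 1) => ?; case: (ltP (1 - v) 1) => ?; do 2?[case: ltP => ?]; lra.
Qed.

Lemma clamp01_continuous : continuous clamp01.
Proof.
move=> v.
have min_cont : {for v, continuous (fun v : R => Num.min v 1)}.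
  by apply: (@continuous_min R R id (cst 1)); [exact: cvg_id|exact: cst_continuous].
by apply: (@continuous_max R R (cst 0) (fun v : R => Num.min v 1));
  [exact: cst_continuous|exact: min_cont].
Qed.

Lemma smoothstep_onem (v : R) : smoothstep (1 - v) = 1 - smoothstep v.
Proof. by rewrite /smoothstep; ring. Qed.

Lemma h_smoothstep y : h y = smoothstep (clamp01 ((1 + y) / 2)) :> R.
Proof.
rewrite /h; case: ltP => y1.
  by rewrite clamp01_le0 ?smoothstep0//; lra.
case: leP => y2; last by rewrite clamp01_ge1 ?smoothstep1//; lra.
by rewrite clamp01_id ?/smoothstep; [field|lra].
Qed.

(** The two rewards as functions of the position alone, b standing for component 4. *)
Definition barrier_reward (z : R) : R := if z < b then 0 else c.

Definition smooth_reward (eps z : R) : R := c * h ((z - b + eps) / eps).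

(** An upper bound for the reward c - smooth_reward eps z that is missing below b. It
    is stretched so as to coincide with the smoothed drift on [b - eps, b]; the
    missing reward itself has (b - z) / (2 * eps) in place of (b - z) / eps. *)
Definition reward_deficit (eps z : R) : R :=
  c * smoothstep (clamp01 ((b - z) / eps)).

Lemma barrier_reward_bnd z : 0 <= barrier_reward z <= c.
Proof. by rewrite /barrier_reward; case: ifP => _; rewrite lexx ?ltW. Qed.

Lemma measurable_barrier_reward : measurable_fun setT barrier_reward.
Proof.
by apply: measurable_fun_if => //; apply: measurable_fun_ltr.
Qed.

Variable eps : R.
Hypothesis eps_gt0 : 0 < eps.

Local Ltac eps_lra := move: (c_gt0) (eps_gt0); lra.

Lemma smooth_reward_bnd z : 0 <= smooth_reward eps z <= c.
Proof.
rewrite /smooth_reward h_smoothstep.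
have /andP[s0 s1] := smoothstep01 (clamp01_bnd ((1 + (z - b + eps) / eps) / 2)).
by rewrite mulr_ge0 ?(ltW c_gt0)//= ger_pMr.
Qed.

Lemma smooth_rewardE z :
  smooth_reward eps z = c - c * smoothstep (clamp01 ((b - z) / (2 * eps))).
Proof.
rewrite /smooth_reward h_smoothstep.
have -> : (1 + (z - b + eps) / eps) / 2 = 1 - (b - z) / (2 * eps).
  by field; rewrite gt_eqF.
by rewrite clamp01_onem smoothstep_onem mulrBr mulr1.
Qed.

Lemma smooth_reward_low z : z <= b - 2 * eps -> smooth_reward eps z = 0.
Proof.
move=> zb; rewrite smooth_rewardE clamp01_ge1 ?smoothstep1 ?mulr1 ?subrr//.
by rewrite ler_pdivlMr; eps_lra.
Qed.

Lemma smooth_reward_top z : b <= z -> smooth_reward eps z = c.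
Proof.
move=> zb; rewrite smooth_rewardE clamp01_le0 ?smoothstep0 ?mulr0 ?subr0//.
by rewrite ler_pdivrMr; eps_lra.
Qed.

Lemma smooth_reward_deficit z : z <= b ->
  c - smooth_reward eps z <= reward_deficit eps z.
Proof.
move=> zb; rewrite smooth_rewardE opprB addrC subrK ler_wpM2l ?(ltW c_gt0)//.
apply/smoothstep_ndecr/clamp01_ndecr; rewrite ler_wpM2l ?subr_ge0//.
by rewrite lef_pV2 ?posrE; eps_lra.
Qed.

Lemma smoothstep_continuous : continuous (@smoothstep R).
Proof. exact: is_derive_continuous is_derive_smoothstep. Qed.

Lemma reward_deficit_ge0 z : 0 <= reward_deficit eps z.
Proof.
have /andP[s0 s1] := smoothstep01 (clamp01_bnd ((b - z) / eps)).
by rewrite mulr_ge0 ?(ltW c_gt0).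
Qed.

Lemma reward_deficit_continuous e : continuous (reward_deficit e).
Proof.
move=> z; apply: cvgM; first exact: cvg_cst.
apply: continuous_cvg; first exact: smoothstep_continuous.
apply: continuous_cvg; first exact: clamp01_continuous.
apply: cvgM; last exact: cvg_cst.
by apply: cvgB; [exact: cvg_cst|exact: cvg_id].
Qed.

Lemma measurable_smooth_reward : measurable_fun setT (smooth_reward eps).
Proof.
rewrite (_ : smooth_reward eps = fun z => c - reward_deficit (2 * eps) z).
  apply: measurable_funB => //; apply: continuous_measurable_fun.
  exact: reward_deficit_continuous.
by apply/funext => z; rewrite smooth_rewardE.
Qed.

(** On [b - eps, b] the drift equals the deficit; on [-eps, b - eps] it is at least
    c - rho * eps >= c / 2, whereas the deficit never exceeds c. *)
Lemma reward_deficit_le rho z : 0 < rho -> eps < b / 2 -> 2 * rho * eps <= c ->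
  - eps <= z <= b -> reward_deficit eps z <= 2 * g1_eps c rho b eps z.
Proof.
move=> rho_gt0 eb rc /andP[z1 z2].
have b_gt0 : 0 < b by eps_lra.
have ea : eps < c / rho by rewrite ltr_pdivlMr//; have := mulr_gt0 rho_gt0 eps_gt0; eps_lra.
have [zb|zb] := leP (b - eps) z.
  have bz : 0 <= (b - z) / eps <= 1.
    by rewrite divr_ge0 ?ler_pdivrMr ?mul1r; eps_lra.
  rewrite g1_eps_barrier ?zb// /reward_deficit clamp01_id//.
  have /andP[s0 s1] := smoothstep01 bz.
  have := mulr_ge0 (ltW c_gt0) s0; eps_lra.
have : reward_deficit eps z <= c.
  have /andP[s0 s1] := smoothstep01 (clamp01_bnd ((b - z) / eps)).
  by rewrite /reward_deficit ger_pMr.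
have : c - rho * eps <= g1_eps c rho b eps z.
  by apply: g1_eps_ge => //; rewrite z1 ltW.
eps_lra.
Qed.

End running_rewards.

(** * Distance between the two flows *)

Section flow_comparison.
Context {R : realType} (c rho b eps : R) (phi psi : R -> R -> R).
Hypotheses (c_gt0 : 0 < c) (rho_gt0 : 0 < rho) (b_gt0 : 0 < b).
Hypotheses (eps_gt0 : 0 < eps) (eps_b : eps < b / 2) (eps_a : 2 * rho * eps <= c).
Hypothesis phi_flow : is_flow (g1 c rho) phi.
Hypothesis psi_flow : is_flow (g1_eps c rho b eps) psi.
Let a : R := - (c / rho).
Let alpha : R := 2 * rho * eps / c.

Local Ltac param_lra :=
  move: (c_gt0) (rho_gt0) (b_gt0) (eps_gt0) (eps_b) (eps_a); lra.

Let reps : 0 < rho * eps. Proof. exact: mulr_gt0. Qed.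

Let eps_ruin : eps < c / rho.
Proof. by rewrite ltr_pdivlMr//; move: (reps); param_lra. Qed.

Let g1B := g1_bnd c_gt0 rho_gt0.
Let gD := @g1_one_sided R c rho rho_gt0.
Let geB := g1_eps_bnd c_gt0 rho_gt0 b_gt0 eps_gt0 eps_b eps_ruin.

Lemma smoothed_flow_le z t : 0 <= t -> psi z t <= phi z t.
Proof.
move=> t0; apply: (flow_le gD phi_flow psi_flow) => // x.
exact: g1_eps_le.
Qed.

(** The smoothed drift vanishes above b. *)
Lemma smoothed_flow_below z t : z <= b -> 0 <= t -> psi z t <= b.
Proof.
move=> zb t0; rewrite -subr_le0.
have fdf u : is_derive u (1 : R) (fun s => psi z s - b) (g1_eps c rho b eps (psi z u)).
  have := flow_is_derive psi_flow z u => ?.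
  by apply: is_derive_eq; rewrite subr0.
apply: (is_derive_barrier (L := 0) fdf t0).
  by rewrite (flow0 psi_flow) subr_le0.
move=> u _; rewrite subr_gt0 => bu.
by rewrite g1_eps_top ?mul0r// ltW.
Qed.

Let alpha0 : 0 <= alpha.
Proof. by rewrite /alpha divr_ge0 ?ltW// mulr_gt0// mulr_gt0. Qed.

Let alphac : alpha * c = 2 * rho * eps.
Proof. by rewrite /alpha divfK// gt_eqF. Qed.

Let alpha1 : alpha <= 1.
Proof. by rewrite /alpha ler_pdivrMr// mul1r. Qed.

(** The barrier argument for the excess of the lag over alpha times the distance
    covered, alpha = 2 * rho * eps / c. In the loan regime the lag grows at rate
    rho, and the term in alpha compensates because z > a. On [-eps, b - eps] the
    speeds are at most c and at least c - rho * eps, and this alpha, which is at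
    most 1, gives (1 + alpha) * (c - rho * eps) >= c. *)
Lemma smoothed_flow_lag z t : a < z -> 0 <= t -> psi z t <= b - eps ->
  phi z t - psi z t <= alpha * (psi z t - z).
Proof.
move=> az t0 psib; rewrite -subr_le0.
pose f t := phi z t - psi z t - alpha * (psi z t - z).
pose df t := g1 c rho (phi z t) - (1 + alpha) * g1_eps c rho b eps (psi z t).
have fdf u : is_derive u (1 : R) f (df u).
  have := flow_is_derive phi_flow z u; have := flow_is_derive psi_flow z u => ? ?.
  rewrite /f /df; apply: is_derive_eq.
  by rewrite ?scaler0 ?scaler1 /GRing.scale/=; ring.
apply: (is_derive_barrier (L := rho) fdf t0).
  by rewrite /f (flow0 phi_flow) (flow0 psi_flow) !subrr mulr0 subr0.
move=> u /andP[u0 ut] fu.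
have pb : psi z u <= b - eps := le_trans (flow_ndecr geB psi_flow z ut) psib.
have zp : z <= psi z u := flow_ge geB psi_flow z u0.
have pp := smoothed_flow_le z u0.
have rhoa : rho * a = - c by rewrite /a; field; rewrite gt_eqF.
have [pe|pe] := leP (psi z u) (- eps).
  have -> : df u = g1 c rho (phi z u) - (1 + alpha) * (c + rho * psi z u).
    by rewrite /df g1_eps_loan// (ltW (lt_le_trans az zp)) pe.
  have := g1_le rho_gt0 (lt_le_trans az (le_trans zp pp)).
  have : alpha * (rho * a) <= alpha * (rho * z).
    by rewrite ler_wpM2l// ler_wpM2l ?(ltW az) ?(ltW rho_gt0).
  rewrite rhoa /f; lra.
apply: (@le_trans _ _ 0); last by rewrite mulr_ge0// ltW.
have ge : c - rho * eps <= g1_eps c rho b eps (psi z u).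
  by apply: g1_eps_ge => //; rewrite (ltW pe).
have /andP[_ gc] := g1B (phi z u).
rewrite /df.
have : (1 + alpha) * (c - rho * eps) <= (1 + alpha) * g1_eps c rho b eps (psi z u).
  by rewrite ler_wpM2l//; move: (alpha0); lra.
have : alpha * (rho * eps) <= 1 * (rho * eps) by rewrite ler_wpM2r// ltW.
move: (alphac); lra.
Qed.

(** The distance covered is at most b - a; the summand 1 is for the times when the
    smoothed flow is within eps of b. *)
Definition lag_constant : R := 1 + 2 * rho * (b - a) / c.

Lemma lag_constant_ge0 : 0 <= lag_constant.
Proof.
have ab : 0 <= b - a by rewrite subr_ge0 (ltW (barrier_gt_ruin _ _ _)).
by rewrite addr_ge0// divr_ge0 ?(ltW c_gt0)// mulr_ge0// mulr_ge0// ltW.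
Qed.

Lemma stopped_flow_lag z t :
  0 <= stopped_flow a b phi z t - stopped_flow a b psi z t <= lag_constant * eps.
Proof.
have lag0 : 0 <= lag_constant * eps by rewrite mulr_ge0 ?lag_constant_ge0 ?ltW.
rewrite /stopped_flow; have [_|az] := leP z a; first by rewrite subrr lexx.
set s := Num.max t 0; have s0 : 0 <= s by rewrite le_max lexx orbT.
have pp := smoothed_flow_le z s0.
rewrite subr_ge0 le_min2 ?lexx ?pp//=.
have [pb|pb] := leP (psi z s) (b - eps).
  rewrite (min_idPl (_ : psi z s <= b)); last by param_lra.
  have := smoothed_flow_lag az s0 pb.
  have mp : Num.min (phi z s) b <= phi z s by rewrite ge_min lexx.
  have : alpha * (psi z s - z) <= alpha * (b - a).
    by rewrite ler_wpM2l//; move: az; param_lra.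
  have -> : lag_constant * eps = eps + alpha * (b - a).
    by rewrite /lag_constant /alpha; field; rewrite gt_eqF.
  by move: mp; param_lra.
apply: (@le_trans _ _ (eps + 0)); last first.
  have -> : lag_constant * eps = eps + alpha * (b - a).
    by rewrite /lag_constant /alpha; field; rewrite gt_eqF.
  rewrite lerD2l mulr_ge0// subr_ge0; exact: ltW (barrier_gt_ruin _ _ _).
have m1 : Num.min (phi z s) b <= b by rewrite ge_min lexx orbT.
have m2 : b - eps <= Num.min (psi z s) b by rewrite le_min (ltW pb)/=; param_lra.
lra.
Qed.

End flow_comparison.

(** * Distance between the two accumulated rewards *)

Section reward_comparison.
Context {R : realType} (c rho b eps : R) (phi psi : R -> R -> R).
Hypotheses (c_gt0 : 0 < c) (rho_gt0 : 0 < rho) (b_gt0 : 0 < b).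
Hypotheses (eps_gt0 : 0 < eps) (eps_b : eps < b / 2) (eps_a : 2 * rho * eps <= c).
Hypothesis phi_flow : is_flow (g1 c rho) phi.
Hypothesis psi_flow : is_flow (g1_eps c rho b eps) psi.
Let a : R := - (c / rho).

Local Ltac param_lra :=
  move: (c_gt0) (rho_gt0) (b_gt0) (eps_gt0) (eps_b) (eps_a); lra.

Let eps_ruin : eps < c / rho.
Proof.
by rewrite ltr_pdivlMr//; move: (mulr_gt0 rho_gt0 eps_gt0); param_lra.
Qed.

Let g1B := g1_bnd c_gt0 rho_gt0.
Let geB := g1_eps_bnd c_gt0 rho_gt0 b_gt0 eps_gt0 eps_b eps_ruin.

Lemma flow_hits z t v : 0 <= t -> z <= v -> v <= phi z t ->
  exists2 s, 0 <= s <= t & phi z s = v.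
Proof.
move=> t0 zv vp.
have cp : {within `[0, t], continuous (phi z)}.
  by apply: continuous_subspaceT; exact: flow_continuous phi_flow z.
have := @IVT _ (phi z) 0 t v t0 cp.
rewrite (flow0 phi_flow) (min_idPl (le_trans zv vp)) (max_idPr (le_trans zv vp)).
by rewrite zv vp => /(_ isT)[s /[!in_itv]/= s0t <-]; exists s.
Qed.

Lemma flow_premium z s t : s <= t -> 0 < phi z s -> phi z t - phi z s = c * (t - s).
Proof.
move=> st ps.
have [st'|ts|->] := ltgtP s t; [|by move: st; rewrite leNgt ts|by rewrite !subrr mulr0].
have cp : {within `[s, t], continuous (phi z)}.
  by apply: continuous_subspaceT; exact: flow_continuous phi_flow z.
have [u /[!in_itv]/= /andP[su ut] ->] :=
  MVT st' (fun u _ => flow_is_derive phi_flow z u) cp.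
by rewrite /g1 (lt_le_trans ps)// (flow_ndecr g1B phi_flow)// ltW.
Qed.

(** Three phases of the original flow: up to t1 it is below b - 2 * eps, where neither
    process earns anything; from t1 to t0 it covers at most 2 * eps at speed c; if
    t0 < t, it reaches b at time t0. *)
Lemma flow_phases z t : z < b -> 0 <= t -> exists t1 t0, [/\ 0 <= t1 <= t0, t0 <= t,
    c * (t0 - t1) <= 2 * eps, forall s, 0 <= s < t1 -> phi z s <= b - 2 * eps &
    t0 = t \/ phi z t0 = b].
Proof.
move=> zb t0.
have [t' [/andP[t'0 t't] pt' t'E]] : exists t', [/\ 0 <= t' <= t, phi z t' <= b &
    t' = t \/ phi z t' = b].
  have [pb|pb] := leP (phi z t) b; first by exists t; rewrite lexx t0; split=> //; left.
  have [s st sb] := flow_hits t0 (ltW zb) (ltW pb).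
  by exists s; split => //; [rewrite sb|right].
suff [t1 [t1t' low fast]] : exists t1, [/\ 0 <= t1 <= t',
    forall s, 0 <= s < t1 -> phi z s <= b - 2 * eps & c * (t' - t1) <= 2 * eps].
  by exists t1, t'.
have [pb|pb] := leP (phi z t') (b - 2 * eps).
  exists t'; rewrite t'0 lexx subrr mulr0; split => //; last by param_lra.
  by move=> s /andP[_ /ltW st]; exact: le_trans (flow_ndecr g1B phi_flow z st) pb.
have fast s : s <= t' -> b - 2 * eps <= phi z s -> c * (t' - s) <= 2 * eps.
  move=> st' ps; have ps0 : 0 < phi z s by move: ps; param_lra.
  rewrite -(flow_premium st' ps0); lra.
have [zl|zl] := leP z (b - 2 * eps); last first.
  exists 0; rewrite lexx t'0; split => //.
    by move=> s /andP[s0 /(le_lt_trans s0)]; rewrite ltxx.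
  by apply: fast => //; rewrite (flow0 phi_flow) ltW.
have [s /andP[s0 st'] sb] := flow_hits t'0 zl (ltW pb).
exists s; rewrite s0 st'; split => //; last by rewrite fast// sb.
move=> u /andP[_ /ltW us]; rewrite -sb; exact: flow_ndecr g1B phi_flow z u s us.
Qed.

(** The summand 2 accounts for the crossing of [b - 2 * eps, b], the other one for twice
    the lag at the time when the original flow reaches b. *)
Definition reward_gap_constant : R := 2 + 2 * lag_constant c rho b.

(** The majorant w is c during the crossing of [b - 2 * eps, b] by the original flow
    and the reward deficit of the smoothed flow after it; the integral of the latter
    is at most twice the distance then left to b. The bound does not depend on t. *)
Lemma reward_gap z t : 0 <= t -> exists w : R -> R,
  [/\ measurable_fun setT w, forall s, 0 <= w s,
      forall s, 0 <= s <= t ->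
        `|smooth_reward c b eps (stopped_flow a b psi z s)
          - barrier_reward c b (stopped_flow a b phi z s)| <= w s &
      (\int[lebesgue_measure]_(s in `[0%R, t]) (w s)%:E
         <= (reward_gap_constant * eps)%:E)%E].
Proof.
move=> t0.
have ab : a < b by exact: barrier_gt_ruin.
have lag0 : 0 <= lag_constant c rho b by exact: lag_constant_ge0.
have gap0 : 0 <= reward_gap_constant * eps.
  by rewrite mulr_ge0 ?ltW// /reward_gap_constant; lra.
have zero_gap : (forall s, 0 <= s <= t ->
    smooth_reward c b eps (stopped_flow a b psi z s)
    = barrier_reward c b (stopped_flow a b phi z s)) -> exists w : R -> R,
  [/\ measurable_fun setT w, forall s, 0 <= w s,
      forall s, 0 <= s <= t ->
        `|smooth_reward c b eps (stopped_flow a b psi z s)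
          - barrier_reward c b (stopped_flow a b phi z s)| <= w s &
      (\int[lebesgue_measure]_(s in `[0%R, t]) (w s)%:E
         <= (reward_gap_constant * eps)%:E)%E].
  move=> eq0; exists (cst 0); split => //.
    by move=> s st; rewrite eq0// subrr normr0.
  by rewrite integral0 lee_fin.
have [za|az] := leP z a.
  apply: zero_gap => s _; rewrite !stopped_flow_dead//.
  rewrite /barrier_reward (le_lt_trans za ab) smooth_reward_low//.
  by apply: (le_trans za); rewrite /a; move: (divr_gt0 c_gt0 rho_gt0); param_lra.
have [bz|zb] := leP b z.
  have top g f u : (forall y, 0 <= g y <= c) -> is_flow g f -> 0 <= u ->
      stopped_flow a b f z u = b.
    move=> gB fl u0; rewrite /stopped_flow (lt_geF az); apply/min_idPr.
    by apply: (le_trans bz); apply: (flow_ge gB fl); rewrite le_max lexx orbT.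
  apply: zero_gap => s /andP[s0 _].
  rewrite (top _ _ _ geB psi_flow s0) (top _ _ _ g1B phi_flow s0).
  by rewrite smooth_reward_top// /barrier_reward ltxx.
have [t1 [t' [/andP[t10 t1t'] t't fast low hit]]] := flow_phases zb t0.
pose w1 : R -> R := fun s => c * \1_(`[t1, t']%classic) s.
pose w2 : R -> R := (fun s => reward_deficit c b eps (psi z s)) \_ `[t', t].
have mdef : continuous (fun s => reward_deficit c b eps (psi z s)).
  move=> s; apply: continuous_cvg; first exact: reward_deficit_continuous.
  exact: flow_continuous psi_flow z s.
have mw1 : measurable_fun setT w1 by apply: measurable_funM.
have mw2 : measurable_fun setT w2.
  apply/(measurable_restrictT _ _).1 => //; apply: measurable_funTS.
  exact: continuous_measurable_fun.
have w10 s : 0 <= w1 s by rewrite mulr_ge0 ?(ltW c_gt0) ?indicE ?ler0n.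
have w20 s : 0 <= w2 s.
  by apply: restrict_ge0 => u _; exact: reward_deficit_ge0.
exists (w1 \+ w2); split.
- exact: measurable_funD.
- by move=> s; rewrite addr_ge0.
- move=> s /andP[s0 st].
  have mpsi : stopped_flow a b psi z s = psi z s.
    rewrite /stopped_flow (lt_geF az) (max_idPl s0); apply/min_idPl.
    apply: (@smoothed_flow_below R c rho b eps psi) => //; exact: ltW.
  have mphi : stopped_flow a b phi z s = Num.min (phi z s) b.
    by rewrite /stopped_flow (lt_geF az) (max_idPl s0).
  have pp : psi z s <= phi z s.
    by apply: (@smoothed_flow_le R c rho b eps phi psi).
  have psib : psi z s <= b.
    by apply: (@smoothed_flow_below R c rho b eps psi) => //; exact: ltW.
  have [st1|t1s] := ltP s t1.
    have ls := low s (_ : 0 <= s < t1); rewrite s0 st1 in ls; have {}ls := ls isT.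
    rewrite mpsi smooth_reward_low//; last exact: le_trans ls.
    rewrite mphi /barrier_reward ifT ?subrr ?normr0 ?addr_ge0//.
    by rewrite gt_min; apply/orP; left; move: ls; param_lra.
  have [st'|t's] := leP s t'.
    apply: (@le_trans _ _ (w1 s)); last by rewrite lerDl.
    rewrite /w1 indicE mem_set/= ?mulr1; last by rewrite in_itv/= t1s.
    have := smooth_reward_bnd b c_gt0 eps (stopped_flow a b psi z s).
    have := barrier_reward_bnd b c_gt0 (stopped_flow a b phi z s).
    by rewrite ler_norml; lra.
  have {}hit : phi z t' = b by case: hit => // t'E; move: t's; rewrite t'E ltNge st.
  have bp : b <= phi z s by rewrite -hit (flow_ndecr g1B phi_flow)// ltW.
  rewrite mphi (min_idPr bp) /barrier_reward ltxx mpsi.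
  apply: (@le_trans _ _ (w2 s)); last by rewrite lerDr.
  rewrite /w2 patchE mem_set/=; last by rewrite in_itv/= (ltW t's).
  rewrite ler0_norm ?opprB ?smooth_reward_deficit//.
  by rewrite subr_le0; have /andP[] := smooth_reward_bnd b c_gt0 eps (psi z s).
- under eq_integral do rewrite EFinD.
  rewrite ge0_integralD//; last 4 first.
  + by move=> s _; rewrite lee_fin.
  + by apply/measurable_EFinP; exact: measurable_funTS.
  + by move=> s _; rewrite lee_fin.
  + by apply/measurable_EFinP; exact: measurable_funTS.
  have -> : reward_gap_constant * eps = 2 * eps + 2 * (lag_constant c rho b * eps).
    by rewrite /reward_gap_constant; ring.
  rewrite EFinD; apply: leeD.
    under eq_integral do rewrite EFinM.
    rewrite ge0_integralZl_EFin ?(ltW c_gt0)//; last first.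
      by apply/measurable_EFinP; exact: measurable_funTS.
    rewrite integral_indic//.
    apply: (@le_trans _ _ (c%:E * lebesgue_measure `[t1, t']%classic)%E).
      by rewrite lee_pmul2l ?lte_fin// le_measure ?inE//; exact: measurableI.
    rewrite lebesgue_measure_itv/= lte_fin; case: ifPn => [_|_].
      by rewrite -EFinB -EFinM lee_fin.
    by rewrite mule0 lee_fin mulr_ge0 ?(ltW eps_gt0).
  have -> : (\int[lebesgue_measure]_(s in `[0%R, t]) (w2 s)%:E
    = \int[lebesgue_measure]_(s in `[t', t]) (reward_deficit c b eps (psi z s))%:E)%E.
    rewrite (_ : (fun s => (w2 s)%:E)
      = (EFin \o (fun s => reward_deficit c b eps (psi z s))) \_ `[t', t]); last first.
      by rewrite restrict_EFin.
    rewrite -integral_mkcondr; congr (integral _ _ _).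
    apply/seteqP; split => s /=; rewrite !in_itv/=; first by case.
    by move=> /andP[t's ->]; rewrite t's (le_trans _ t's)// (le_trans t10).
  case: hit => [t'E|hit].
    by rewrite t'E set_itv1 integral_set1 lee_fin !mulr_ge0// ltW.
  have psiD u := flow_is_derive psi_flow z u.
  have psi2 u : is_derive u (1 : R) (fun s => 2 * psi z s)
      (2 * g1_eps c rho b eps (psi z u)).
    by have := psiD u => ?; apply: is_derive_eq; rewrite ?scaler0 ?addr0 ?add0r.
  have t'0 : 0 <= t' := le_trans t10 t1t'.
  apply: (@le_trans _ _ (2 * psi z t - 2 * psi z t')%:E).
    apply: (integral_le_increment mdef psi2) => // u /andP[t'u ut].
    rewrite reward_deficit_ge0//= reward_deficit_le//.
    have u0 := le_trans t'0 t'u.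
    rewrite (@smoothed_flow_below R c rho b eps psi) ?(ltW zb)// andbT.
    rewrite leNgt; apply/negP => pe.
    have pb : b <= phi z u by rewrite -hit (flow_ndecr g1B phi_flow).
    have peb : psi z u <= b - eps by move: pe; param_lra.
    (* a smoothed flow still below -eps would put the original one below eps < b *)
    have lag := @smoothed_flow_lag R c rho b eps phi psi c_gt0 rho_gt0 b_gt0
      eps_gt0 eps_b eps_a phi_flow psi_flow z u az u0 peb.
    have : 2 * rho * eps / c * (psi z u - z) <= 2 * rho * eps / c * (- a).
      rewrite ler_wpM2l ?divr_ge0 ?mulr_ge0 ?(ltW c_gt0) ?(ltW rho_gt0) ?(ltW eps_gt0)//.
      by move: az pe; param_lra.
    have -> : 2 * rho * eps / c * (- a) = 2 * eps.
      by rewrite /a; field; rewrite !gt_eqF.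
    by move: lag pe pb; param_lra.
  rewrite lee_fin.
  have := stopped_flow_lag c_gt0 rho_gt0 b_gt0 eps_gt0 eps_b eps_a phi_flow psi_flow z t'.
  rewrite -/a /stopped_flow (lt_geF az) (max_idPl t'0) hit minxx => /andP[_].
  have psib s : 0 <= s -> psi z s <= b.
    by move=> s0; apply: (@smoothed_flow_below R c rho b eps psi) => //; exact: ltW.
  rewrite (min_idPl (psib _ t'0)); have := psib _ t0; lra.
Qed.
End reward_comparison.

(** * Laws with a density *)

Local Open Scope ereal_scope.

Section density.
Context {R : realType}.
Notation mu := (@lebesgue_measure R).
Variable g : R -> R.
Hypotheses (mg : measurable_fun setT g) (g0 : forall x, (0 <= g x)%R).

Import HBNNSimple.

(** True for simple functions by linearity, then by monotone convergence. *)
Lemma ge0_integral_density (m : {measure set R -> \bar R}) :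
    (forall A, measurable A -> m A = \int[mu]_(x in A) (g x)%:E) ->
  forall h : R -> \bar R, measurable_fun setT h -> (forall x, 0 <= h x) ->
  \int[m]_x h x = \int[mu]_x (h x * (g x)%:E).
Proof.
move=> mE h mh h0.
have mgE : measurable_fun setT (EFin \o g) by exact/measurable_EFinP.
have int_indic (A : set R) : measurable A -> 
    \int[m]_x (\1_A x)%:E = \int[mu]_x ((\1_A x)%:E * (g x)%:E).
  move=> mA; rewrite integral_indic// setIT mE// integral_mkcond.
  by apply: eq_integral => x _; rewrite epatch_indic muleC.
pose f_ := nnsfun_approx measurableT mh.
have sfunE (f : {nnsfun R >-> R}) :
    \int[m]_x (f x)%:E = \int[mu]_x ((f x)%:E * (g x)%:E).
  have mterm r : measurable_fun [set: R] (fun x => (r * \1_(f @^-1` [set r]) x)%:E).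
    by apply/measurable_EFinP/measurable_funM => //; apply: measurable_indic.
  under eq_integral do rewrite fimfunE -fsumEFin//.
  rewrite ge0_integral_fsum//; last by move=> y x _; rewrite nnfun_muleindic_ge0.
  transitivity (\sum_(k \in range f)
      \int[mu]_x ((k * \1_(f @^-1` [set k]) x)%:E * (g x)%:E)).
    apply: eq_fsbigr => r; rewrite inE => -[y Ty fyr].
    have r0 : (0 <= r)%R by rewrite -fyr.
    have mr : measurable_fun [set: R] (fun x => (\1_(f @^-1` [set r]) x)%:E : \bar R).
      by apply/measurable_EFinP; apply: measurable_indic.
    have r_ge0 (x : R) : [set: R] x -> 0 <= ((\1_(f @^-1` [set r]) : R -> R) x)%:E.
      by move=> _; rewrite lee_fin indicE ler0n.
    under eq_integral do rewrite EFinM.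
    rewrite (ge0_integralZl_EFin _ _ r_ge0 mr)// int_indic//.
    under [RHS]eq_integral do rewrite EFinM -muleA.
    rewrite ge0_integralZl_EFin//.
      by move=> x Tx; rewrite mule_ge0 ?lee_fin//; exact: r_ge0.
    exact: emeasurable_funM.
  rewrite -ge0_integral_fsum//.
  - apply: eq_integral => x _; rewrite [in RHS]fimfunE -fsumEFin// ge0_mule_fsuml//.
    by move=> r; rewrite nnfun_muleindic_ge0.
  - move=> r; apply: emeasurable_funM => //.
    exact: mterm.
  - by move=> r x _; rewrite mule_ge0 ?lee_fin// -lee_fin nnfun_muleindic_ge0.
have mf n : measurable_fun [set: R] (fun x => (f_ n x)%:E).
  by apply/measurable_EFinP; exact: measurable_funP.
have ndf x k n : (k <= n)%N -> (f_ k x <= f_ n x)%R.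
  by move=> kn; exact/lefP/nd_nnsfun_approx.
transitivity (limn (fun n => \int[m]_x (f_ n x)%:E)).
  rewrite -monotone_convergence//.
  - apply: eq_integral => x _; apply/esym/cvg_lim => //.
    by apply: cvg_nnsfun_approx=> // *; exact: h0.
  - by move=> n x _; rewrite lee_fin.
  - by move=> x _ k n kn; rewrite lee_fin; exact/lefP/nd_nnsfun_approx.
under eq_fun do rewrite sfunE.
rewrite -monotone_convergence//.
- apply: eq_integral => x _; apply/cvg_lim => //.
  apply: cvgeMr => //.
  by apply: cvg_nnsfun_approx=> // *; exact: h0.
- by move=> n; apply: emeasurable_funM => //; exact: mf.
- by move=> n x _; rewrite mule_ge0 ?lee_fin.
- by move=> x _ k n kn; rewrite lee_pmul ?lee_fin//; exact: ndf.
Qed.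
End density.

Local Close Scope ereal_scope.

Local Open Scope ereal_scope.

Section lebesgue_reflection.
Context {R : realType}.
Notation mu := (@lebesgue_measure R).

Definition reflection (p x : R) : R := (p - x)%R.

Lemma measurable_reflection (p : R) : measurable_fun [set: R] (reflection p).
Proof. exact: measurable_funB. Qed.

HB.instance Definition _ (p : R) :=
  isMeasurableFun.Build _ _ _ _ (reflection p) (measurable_reflection p).

Lemma lebesgue_measure_reflection (p : R) (A : set R) : measurable A ->
  pushforward mu (reflection p : measurableTypeR R -> measurableTypeR R) A = mu A.
Proof.
move=> mA; apply/esym; move: A mA; apply: lebesgue_measure_unique => [|mp X [[a b] _ <-]].
  exact: measurable_reflection.
transitivity (mu `[(p - b)%R, (p - a)%R[%classic); last first.
  congr (mu _); apply/seteqP; split=> x /=; rewrite !in_itv/= /reflection.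
    by move=> /andP[? ?]; apply/andP; split; lra.
  by move=> /andP[? ?]; apply/andP; split; lra.
rewrite !lebesgue_measure_itv/= !lte_fin.
rewrite (_ : (p - b < p - a) = (a < b))%R; last by rewrite ltrD2l ltrN2.
by case: ifP => // _; rewrite -!EFinB; congr EFin; ring.
Qed.

Lemma ge0_integral_reflection (p : R) (h : R -> \bar R) :
    measurable_fun setT h -> (forall x, 0 <= h x) ->
  \int[mu]_x h (p - x)%R = \int[mu]_x h x.
Proof.
move=> mh h0.
transitivity (\int[pushforward mu
    (reflection p : measurableTypeR R -> measurableTypeR R)]_x h x).
  by rewrite ge0_integral_pushforward//; exact: measurable_reflection.
apply: eq_measure_integral => [|mp A mA _]; first exact: measurable_reflection.
exact: lebesgue_measure_reflection.
Qed.

Lemma ge0_integral_shift (p : R) (h : R -> \bar R) :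
    measurable_fun setT h -> (forall x, 0 <= h x) ->
  \int[mu]_x h (x - p)%R = \int[mu]_x h x.
Proof.
move=> mh h0; rewrite -[RHS](ge0_integral_reflection (- p))//.
rewrite -[RHS](ge0_integral_reflection 0)//.
- by apply: eq_integral => x _; congr (h _); ring.
- by apply: measurableT_comp => //; exact: measurable_reflection.
Qed.

End lebesgue_reflection.

Section law_of_density.
Context {R : realType}.
Notation mu := (@lebesgue_measure R).

(** The two hypotheses on g are arguments so that the measure structure can be found
    from the term. *)
Definition with_density (g : R -> R) (mg : measurable_fun setT g)
    (g0 : forall x, (0 <= g x)%R) (A : set R) : \bar R :=
  \int[mu]_(x in A) (g x)%:E.

Section with_density_measure.
Variables (g : R -> R) (mg : measurable_fun setT g) (g0 : forall x, (0 <= g x)%R).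
Let nu := with_density mg g0.

Let nu0 : nu set0 = 0.
Proof. by rewrite /nu /with_density integral_set0. Qed.

Let nu_ge0 A : 0 <= nu A.
Proof. by apply: integral_ge0 => x _; rewrite lee_fin. Qed.

Let nu_sigma_additive : semi_sigma_additive nu.
Proof.
move=> /= F mF tF mUF; rewrite /nu /with_density; apply: cvg_toP.
  apply: ereal_nondecreasing_is_cvgn => m n mn.
  by apply: lee_sum_nneg_natr => // k _ _; exact: nu_ge0.
rewrite ge0_integral_bigcup//=.
- by apply/measurable_funTS/measurable_EFinP.
- by move=> x _; rewrite lee_fin.
Qed.

HB.instance Definition _ := isMeasure.Build _ _ _ (with_density mg g0)
  nu0 nu_ge0 nu_sigma_additive.
End with_density_measure.

(** Half-open intervals form a pi-system generating the Borel sets, and their measure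
    is a difference of two values of the distribution function. *)
Lemma measure_eq_cdf (m1 m2 : {measure set R -> \bar R}) :
    (forall y : R, m1 `]-oo, y]%classic < +oo) ->
    (forall y : R, m1 `]-oo, y]%classic = m2 `]-oo, y]%classic) ->
  forall A, measurable A -> m1 A = m2 A.
Proof.
move=> m1y m12 A mA.
have ocE (m : {measure set R -> \bar R}) (a b : R) : (a <= b)%R ->
    m `]-oo, b]%classic < +oo ->
    m `]a, b]%classic = m `]-oo, b]%classic - m `]-oo, a]%classic.
  move=> ab mb.
  have -> : `]a, b]%classic = `]-oo, b]%classic `\` `]-oo, a]%classic.
    apply/seteqP; split => x /=; rewrite !in_itv/=.
      by move=> /andP[ax ->]; split => //; apply/negP; rewrite -ltNge.
    by move=> [-> /negP]; rewrite -ltNge => ->.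
  rewrite measureD// setIidr//.
  by apply: subset_itvl; rewrite bnd_simp.
apply: (@measure_unique _ R R (@ocitv R) (fun n => `](- n%:R)%R, n%:R%R]%classic)) => //.
- exact: ocitvI.
- by move=> n; exists (- n%:R, n%:R)%R.
- apply/seteqP; split => // x _.
  have := archi_boundP (normr_ge0 x); set n := Num.bound _.
  rewrite ltr_norml => /andP[nx xn].
  by exists n => //=; rewrite in_itv/= nx ltW.
- move=> _ [[a b] _ <-]/=; have [ab|ba] := leP a b; last first.
    by rewrite set_itv_ge ?measure0// bnd_simp -leNgt ltW.
  by rewrite !ocE// -?m12.
- move=> n; apply: le_lt_trans (m1y n%:R%R); rewrite le_measure ?inE//.
  by apply: subset_itvr; rewrite bnd_simp.
Qed.

End law_of_density.

Local Close Scope ereal_scope.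

(** * Smoothing by the claim law *)

Section half_line_derivative.
Context {R : realType} (f f1 : R -> R).
Hypothesis ff1 : has_derivative_Rplus f f1.

Lemma has_derivative_Rplus_near (x e : R) : 0 <= x -> 0 < e ->
  exists2 d, 0 < d & forall y, 0 <= y -> `|y - x| < d ->
    `|f y - f x - f1 x * (y - x)| <= e * `|y - x|.
Proof.
move=> x0 e0; have /cvgrPdist_le/(_ e e0) := ff1 x0.
rewrite near_withinE near_nbhs => -[d /= d0 fd]; exists d => // y y0 yd.
have [->|yx] := eqVneq y x; first by rewrite !subrr mulr0 subr0 normr0 mulr0.
have := fd y; rewrite /ball/= distrC => /(_ yd (conj y0 yx)).
have yx0 : y - x != 0 by rewrite subr_eq0.
rewrite -(ler_pM2r (_ : 0 < `|y - x|)) ?normr_gt0// -normrM.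
by rewrite mulrBl divfK// distrC.
Qed.

Lemma has_derivative_Rplus_is_derive (x : R) : 0 < x -> is_derive x (1 : R) f (f1 x).
Proof.
move=> x0.
suff H : (fun h => h^-1 *: (f (h *: (1 : R) + x) - f x)) @ 0^' --> f1 x.
  by apply: DeriveDef; [apply/cvg_ex; exists (f1 x)|exact/cvg_lim].
apply/cvgrPdist_le => e e0.
have [d d0 fd] := has_derivative_Rplus_near (ltW x0) e0.
have m0 : 0 < Num.min d x by rewrite lt_min d0.
near=> h.
have h0 : h != 0 by near: h; exact: nbhs_dnbhs_neq.
have hm : `|h| < Num.min d x by near: h; exact: dnbhs0_lt.
have /andP[hd hx] : (`|h| < d) && (`|h| < x) by rewrite -lt_min.
have := fd (h + x); rewrite addrK => /(_ _ hd); rewrite !scaler1.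
have -> : 0 <= h + x by move: hx; rewrite ltr_norml; lra.
move=> /(_ isT) fh; rewrite -(ler_pM2r (_ : 0 < `|h|)) ?normr_gt0// -normrM.
rewrite (le_trans _ fh)// distrC mulrBl [_ *: _]mulrC divfK//.
Unshelve. all: by end_near. Qed.

(** The mean value inequality between two points of the open half-line, extended to 0
    by approximation. *)
Lemma has_derivative_Rplus_lipschitz (M : R) : (forall x, 0 <= x -> `|f1 x| <= M) ->
  forall x y, 0 <= x -> 0 <= y -> `|f x - f y| <= M * `|x - y|.
Proof.
move=> f1M.
have M0 : 0 <= M by exact: le_trans (f1M 0 (lexx _)).
have pos (x y : R) : 0 < x -> x < y -> `|f y - f x| <= M * (y - x).
  move=> x0 xy.
  have fD z : z \in `]x, y[%R -> is_derive z (1 : R) f (f1 z).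
    rewrite in_itv/= => /andP[xz _].
    exact: has_derivative_Rplus_is_derive (lt_trans x0 xz).
  have cf : {within `[x, y], continuous f}.
    apply: derivable_within_continuous => z; rewrite in_itv/= => /andP[xz _].
    by have [] := has_derivative_Rplus_is_derive (lt_le_trans x0 xz).
  have [z /[!in_itv]/= /andP[xz _] ->] := MVT xy fD cf.
  have yx0 : 0 <= y - x by rewrite subr_ge0 ltW.
  by rewrite normrM (ger0_norm yx0) ler_wpM2r// f1M// (le_trans (ltW x0))// ltW.
(* only a one-sided derivative is known at 0: from 0, first go to a small t > 0 on
   which the linear approximation is accurate, at a total cost of at most K * t *)
have zero (y : R) : 0 < y -> `|f y - f 0| <= M * y.
  move=> y0; apply/ler_addgt0Pr => e e0.
  have [d d0 fd] := has_derivative_Rplus_near (lexx (0 : R)) (ltr01 : 0 < 1 :> R).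
  pose K := M + M + 1; have K0 : 0 < K by rewrite /K; lra.
  pose t := Num.min (d / 2) (Num.min (y / 2) (e / K)).
  have t0 : 0 < t by rewrite !lt_min !divr_gt0.
  have td : t <= d / 2 by rewrite /t ge_min lexx.
  have ty : t <= y / 2 by rewrite /t !ge_min lexx !orbT.
  have te : t <= e / K by rewrite /t !ge_min lexx !orbT.
  have := fd t (ltW t0); rewrite subr0 gtr0_norm// mul1r => /(_ _) ft.
  have {}ft : `|f t - f 0 - f1 0 * t| <= t by apply: ft; lra.
  have ty' : t < y by lra.
  have fyt := pos _ _ t0 ty'.
  have f10 : `|f1 0 * t| <= M * t by rewrite normrM (gtr0_norm t0) ler_wpM2r ?f1M// ltW.
  have -> : f y - f 0 = (f y - f t) + ((f t - f 0 - f1 0 * t) + f1 0 * t) by ring.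
  apply: (le_trans (ler_normD _ _)).
  have h2 := ler_normD (f t - f 0 - f1 0 * t) (f1 0 * t).
  have : K * t <= e by rewrite mulrC -ler_pdivlMr.
  have : 0 <= M * t by rewrite mulr_ge0// ltW.
  rewrite /K; lra.
have main (x y : R) : 0 <= x -> x < y -> `|f y - f x| <= M * (y - x).
  rewrite le_eqVlt => /predU1P[<- y0|]; last exact: pos.
  by rewrite subr0; exact: zero.
move=> x y x0 y0; have [xy|yx|->] := ltgtP x y.
- by rewrite distrC (distrC x) (ger0_norm (_ : 0 <= y - x)) ?subr_ge0 ?(ltW xy)// main.
- by rewrite (ger0_norm (_ : 0 <= x - y)) ?subr_ge0 ?(ltW yx)// main.
- by rewrite !subrr normr0 mulr0.
Qed.

End half_line_derivative.

Lemma C20_bounded_lipschitz {R : realType} (f : R -> R) : C20 f ->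
  exists M0 M1, [/\ 0 <= M0, 0 <= M1, forall x, 0 <= x -> `|f x| <= M0 &
    forall x y, 0 <= x -> 0 <= y -> `|f x - f y| <= M1 * `|x - y|].
Proof.
move=> [f1 [f2 [ff1 _ _ [[[M0 fM0] _] [[M1 f1M1] _] _]]]].
exists M0, M1; split => //.
- exact: le_trans (normr_ge0 _) (fM0 0 (lexx _)).
- exact: le_trans (normr_ge0 _) (f1M1 0 (lexx _)).
- by move=> x y; exact: (has_derivative_Rplus_lipschitz ff1 f1M1).
Qed.

(** A density of the claim law on the whole line, f being constrained on the half-line
    only. It has a jump at 0 unless f 0 = 0. *)
Definition half_line_pdf {R : realType} (f : R -> R) (x : R) : R :=
  if 0 <= x then f x else 0.

Section claim_law.
Context {R : realType} (F f : R -> R) (M0 M1 : R).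
Hypothesis F_density : has_density F f.
Hypotheses (M0_ge0 : 0 <= M0) (M1_ge0 : 0 <= M1).
Hypothesis f_bnd : forall x : R, 0 <= x -> `|f x| <= M0.
Hypothesis f_lip : forall x y : R, 0 <= x -> 0 <= y -> `|f x - f y| <= M1 * `|x - y|.
Notation mu := (@lebesgue_measure R).
Let g := half_line_pdf f.

Lemma claim_pdf_ge0 x : 0 <= g x.
Proof.
by rewrite /g /half_line_pdf; case: ifPn => // x0; case: F_density => + _ _; apply.
Qed.

Lemma measurable_claim_pdf : measurable_fun setT g.
Proof.
have -> : g = fun x => if 0 <= x then f (Num.max x 0) else 0.
  by apply/funext => x; rewrite /g /half_line_pdf; case: leP => // /max_idPl ->.
apply: measurable_fun_if => //.
  by apply: measurable_fun_ler => //; exact: measurable_cst.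
apply: measurable_funTS; apply: continuous_measurable_fun => x.
apply/cvgrPdist_le => e e0.
have M1' : 0 < M1 + 1 by move: M1_ge0; lra.
near=> y.
apply: (le_trans (f_lip _ _)); rewrite ?le_max ?lexx ?orbT//.
have maxB : `|Num.max x 0 - Num.max y 0| <= `|x - y|.
  by case: (leP x 0) => ?; case: (leP y 0) => ?; rewrite !ler_norml;
    have := ler_norm (x - y); have := ler_norm (y - x); rewrite (distrC y); lra.
have : `|x - y| <= e / (M1 + 1).
  near: y; apply: cvgr_dist_le; [exact: cvg_id|by rewrite divr_gt0].
rewrite ler_pdivlMr// => xye.
have := ler_wpM2l M1_ge0 maxB; have := normr_ge0 (x - y); move: xye; lra.
Unshelve. all: by end_near. Qed.

(** The claim law is only known through its distribution function. *)
Lemma claim_law_density (m : {measure set R -> \bar R}) :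
    (forall y : R, m `]-oo, y]%classic = (F y)%:E) ->
  forall A, measurable A -> (m A = \int[mu]_(x in A) (g x)%:E)%E.
Proof.
move=> mF A mA; rewrite -[RHS]/(with_density measurable_claim_pdf claim_pdf_ge0 A).
apply: measure_eq_cdf => // y; rewrite mF ?ltry//.
have [_ -> _] := F_density.
rewrite /with_density; apply/esym.
transitivity (\int[mu]_(x in `]-oo, y]%classic) ((EFin \o f) \_ `[0%R, +oo[) x)%E.
  apply: eq_integral => x _; rewrite patchE /g /half_line_pdf.
  case: ifPn => x0; first by rewrite mem_set//= in_itv/= x0.
  by rewrite memNset//= in_itv/= andbT; exact/negP.
rewrite -integral_mkcondr; congr (integral _ _ _).
by apply/seteqP; split => x /=; rewrite !in_itv/= andbT; [move=> [-> ->]|move=> /andP[]].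
Qed.

Lemma measurable_claim_pdf_reflection (p : R) :
  measurable_fun [set: R] (fun x => (g (p - x))%:E).
Proof.
apply/measurable_EFinP.
exact: (measurableT_comp measurable_claim_pdf (measurable_reflection p)).
Qed.

Lemma ge0_integral_claim (m : {measure set R -> \bar R}) :
    (forall y : R, m `]-oo, y]%classic = (F y)%:E) ->
  forall (u : R -> \bar R) (p : R), measurable_fun setT u -> (forall x, 0 <= u x)%E ->
  (\int[m]_y u (p - y)%R = \int[mu]_x (u x * (g (p - x))%:E))%E.
Proof.
move=> mF u p m_u u0.
have mup : measurable_fun [set: R] (fun y => u (p - y)).
  exact: (measurableT_comp m_u (measurable_reflection p)).
rewrite (ge0_integral_density measurable_claim_pdf claim_pdf_ge0 (claim_law_density mF))//.
rewrite -[RHS](ge0_integral_reflection p).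
- by apply: eq_integral => y _; rewrite (_ : p - (p - y) = y)//; ring.
- by apply: emeasurable_funM => //; exact: measurable_claim_pdf_reflection.
- by move=> x; rewrite mule_ge0// lee_fin claim_pdf_ge0.
Qed.

(** The last term pays for the jump of the density at 0: it concerns the x for which
    p - x >= 0 > p' - x. *)
Lemma claim_pdf_increment (x p p' : R) :
  g (p - x) <= g (p' - x) + M1 * `|p - p'| + M0 * \1_(`[p', p]%classic) x.
Proof.
have M1p : 0 <= M1 * `|p - p'| by rewrite mulr_ge0.
have M0i : 0 <= M0 * \1_(`[p', p]%classic) x by rewrite mulr_ge0// indicE ler0n.
have [xp|px] := leP x p; last first.
  rewrite {1}/g /half_line_pdf (lt_geF (_ : p - x < 0)) ?subr_lt0//.
  by rewrite !addr_ge0// claim_pdf_ge0.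
have [xp'|p'x] := leP x p'.
  have xp0 : 0 <= p - x by rewrite subr_ge0.
  have xp'0 : 0 <= p' - x by rewrite subr_ge0.
  have := f_lip xp0 xp'0; rewrite opprB addrA subrK => fl.
  have := ler_norm (f (p - x) - f (p' - x)).
  by rewrite /g /half_line_pdf xp0 xp'0; lra.
rewrite indicE mem_set/=; last by rewrite in_itv/= xp ltW.
have gp' := claim_pdf_ge0 (p' - x).
have : g (p - x) <= M0.
  rewrite /g /half_line_pdf; case: ifPn => // xp0.
  exact: le_trans (ler_norm _) (f_bnd xp0).
rewrite mulr1; move: M1p gp'; lra.
Qed.

(** Written as an integral of u x * g (p - x), the expectation depends on p through the
    density g alone, and [claim_pdf_increment] applies. For p <= b the integrand
    vanishes off ]a, b], because u vanishes below a and claims are nonnegative: the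
    Lipschitz term of the density is thus integrated over a bounded interval. *)
Lemma claim_smoothing (m : {measure set R -> \bar R}) (a b M : R) (u : R -> \bar R) :
    (forall y : R, m `]-oo, y]%classic = (F y)%:E) -> a <= b -> 0 <= M ->
    measurable_fun setT u -> (forall x, 0 <= u x <= M%:E)%E ->
    (forall x, x <= a -> u x = 0%E) ->
  forall p p', p <= b ->
  (\int[m]_y u (p - y)%R <= \int[m]_y u (p' - y)%R
    + (M * (M1 * (b - a) + M0) * `|p - p'|)%:E)%E.
Proof.
move=> mF ab M_ge0 m_u uM ua p p' pb.
have u0 x : (0 <= u x)%E by have /andP[] := uM x.
rewrite !(ge0_integral_claim mF)//.
pose v (x : R) : R := M * (M1 * `|p - p'|) * \1_(`]a, b]%classic) x
  + M * M0 * \1_(`[p', p]%classic) x.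
have v0 x : 0 <= v x by rewrite addr_ge0// !mulr_ge0// indicE ler0n.
have mind (k : R) (i : interval R) :
    measurable_fun [set: R] (fun x => (k * \1_([set` i]) x)%:E).
  apply/measurable_EFinP; exact: measurable_funM.
have mv : measurable_fun [set: R] (fun x => (v x)%:E).
  by apply/measurable_EFinP; apply: measurable_funD; apply/measurable_EFinP; exact: mind.
have mug q : measurable_fun setT (fun x : R => u x * (g (q - x))%:E)%E.
  by apply: emeasurable_funM => //; exact: measurable_claim_pdf_reflection.
have ug0 q x : (0 <= u x * (g (q - x))%:E)%E.
  by rewrite mule_ge0// lee_fin claim_pdf_ge0.
apply: (@le_trans _ _ (\int[mu]_x (u x * (g (p' - x))%:E + (v x)%:E))%E).
  apply: ge0_le_integral => //.
  - exact: mug.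
  - by apply: emeasurable_funD; [exact: mug|exact: mv].
  move=> x _; have [xa|ax] := leP x a.
    by rewrite ua// !mul0e add0e lee_fin.
  have [xb|bx] := leP x b; last first.
    rewrite {1}/g /half_line_pdf (lt_geF (_ : p - x < 0)) ?mule0.
      by rewrite adde_ge0// lee_fin.
    by rewrite subr_lt0 (le_lt_trans pb).
  move: (uM x); case: (u x) => [r| |] /andP[]//.
  rewrite -!EFinM -EFinD !lee_fin => r0 rM.
  rewrite /v [\1_(`]a, b]%classic) x]indicE mem_set/= ?mulr1; last by rewrite in_itv/= ax.
  have := ler_wpM2l r0 (claim_pdf_increment x p p').
  have : r * (M1 * `|p - p'|) <= M * (M1 * `|p - p'|) by rewrite ler_wpM2r// mulr_ge0.
  have : r * (M0 * \1_(`[p', p]%classic) x) <= M * (M0 * \1_(`[p', p]%classic) x).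
    by rewrite ler_wpM2r// mulr_ge0// indicE ler0n.
  lra.
rewrite ge0_integralD//; last 2 first.
- exact: mug.
- by move=> x _; rewrite lee_fin.
rewrite leeD2l// /v.
under eq_integral do rewrite EFinD.
rewrite ge0_integralD//; last 4 first.
- by move=> x _; rewrite lee_fin !mulr_ge0// indicE ler0n.
- exact: mind.
- by move=> x _; rewrite lee_fin !mulr_ge0// indicE ler0n.
- exact: mind.
have int_const (k : R) (d : R) (i : interval R) : 0 <= k ->
    (lebesgue_measure [set` i] <= d%:E)%E ->
    (\int[mu]_x (k * \1_([set` i]) x)%:E <= (k * d)%:E)%E.
  move=> k0 id; under eq_integral do rewrite EFinM.
  rewrite ge0_integralZl_EFin//; last first.
    by apply/measurable_EFinP; apply: measurable_indic.
  by rewrite integral_indic// setIT EFinM lee_wpmul2l.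
apply: (le_trans (leeD (int_const _ (b - a) _ _ _) (int_const _ `|p - p'| _ _ _))).
- by rewrite !mulr_ge0.
- by rewrite lebesgue_measure_itv/= lte_fin; case: ifP => _; rewrite ?lee_fin ?subr_ge0.
- by rewrite !mulr_ge0.
- rewrite lebesgue_measure_itv/= lte_fin; case: ifP => _; rewrite ?lee_fin//.
  exact: ler_norm.
by rewrite -EFinD lee_fin le_eqVlt; apply/orP; left; apply/eqP; ring.
Qed.

End claim_law.

(** * Adjoining a variable to an independent one *)

Local Open Scope ereal_scope.

(** Rectangles form a pi-system that generates the product sigma-algebra. *)
Lemma measure_eq_rectangles {d1 d2 : measure_display} {T1 : measurableType d1}
    {T2 : measurableType d2} {R : realType} (m1 m2 : {measure set (T1 * T2) -> \bar R}) :
    m1 setT < +oo ->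
    (forall A B, measurable A -> measurable B -> m1 (A `*` B) = m2 (A `*` B)) ->
  forall X, measurable X -> m1 X = m2 X.
Proof.
move=> m1oo m12 X mX.
pose G : set (set (T1 * T2)) :=
  [set C | exists A B, [/\ measurable A, measurable B & C = A `*` B]].
apply: (measure_unique G (fun=> setT)) => //.
- rewrite measurable_prod_measurableType //; congr (<<s _ >>).
  rewrite predeqE; split => [[A mA [B mB <-]]|[A [B [mA mB ->]]]].
    by exists A, B.
  by exists A => //; exists B.
- move=> _ _ [A1 [B1 [mA1 mB1 ->]]] [A2 [B2 [mA2 mB2 ->]]].
  by exists (A1 `&` A2), (B1 `&` B2); rewrite -setXI; split => //; exact: measurableI.
- by move=> _; exists setT, setT; rewrite setXTT.
- by rewrite bigcup_const//; exists 0%N.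
- by move=> _ [A [B [mA mB ->]]]; exact: m12.
Qed.

Section independence_of_a_family.
Context {R : realType} {d : measure_display} {Omega : measurableType d}.
Variables (P : probability Omega R) (I : eqType) (X : I -> {RV P >-> R}).

Definition family_event (J : seq I) (A : I -> set R) : set Omega :=
  \bigcap_(i in [set` J]) (X i @^-1` A i).

Lemma family_event_nil A : family_event [::] A = setT.
Proof. by apply/seteqP; split. Qed.

Lemma family_event_cons i J A :
  family_event (i :: J) A = X i @^-1` A i `&` family_event J A.
Proof.
apply/seteqP; split => w /=.
  move=> wA; split; first by apply: wA; rewrite /= mem_head.
  by move=> j /= jJ; apply: wA; rewrite /= in_cons jJ orbT.
by move=> [wi wJ] j; rewrite /= in_cons => /predU1P[->//|]; exact: wJ.
Qed.

Lemma measurable_family_event J A : (forall i, measurable (A i)) ->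
  measurable (family_event J A).
Proof.
move=> mA; elim: J => [|i J IH]; first by rewrite family_event_nil.
rewrite family_event_cons; apply: measurableI => //.
by rewrite -[_ @^-1` _]setTI; exact: measurable_funP.
Qed.

(** V is independent of the family of the X j with D j, whose members are themselves
    independent. Stating both in one product formula makes the notion stable under
    adjoining one of the X j to V. *)
Definition independent_of {d' : measure_display} {U : measurableType d'}
    (D : pred I) (V : {mfun Omega >-> U}) : Prop :=
  forall B J A, measurable B -> uniq J -> all D J -> (forall i, measurable (A i)) ->
  P (V @^-1` B `&` family_event J A)
  = P (V @^-1` B) * \prod_(i <- J) P (X i @^-1` A i).

Lemma independent_of_cst {d' : measure_display} {U : measurableType d'} (u : U) :
  mutually_independent X -> independent_of xpredT (cst u : {mfun Omega >-> U}).
Proof.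
move=> indX B J A mB uJ _ mA; rewrite preimage_cst; case: ifPn => _.
  by rewrite setTI probability_setT mul1e; exact: indX.
by rewrite set0I measure0 mul0e.
Qed.

Lemma independent_of_comp {d1 d2 : measure_display} {U : measurableType d1}
    {W : measurableType d2} (D : pred I) (V : {mfun Omega >-> U}) (phi : {mfun U >-> W}) :
  independent_of D V -> independent_of D (phi \o V : {mfun Omega >-> W}).
Proof.
move=> indV B J A mB; rewrite comp_preimage; apply: indV.
by rewrite -[_ @^-1` _]setTI; exact: measurable_funP.
Qed.

Section adjunction.
Context {d' : measure_display} {U : measurableType d'}.
Variables (D : pred I) (V : {mfun Omega >-> U}) (i : I).
Hypotheses (indV : independent_of D V) (Di : D i).

Let VX w := (V w, X i w).

Let measurable_VX : measurable_fun setT VX.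
Proof. exact: measurable_fun_pair. Qed.

HB.instance Definition _ := isMeasurableFun.Build _ _ _ _ VX measurable_VX.

Definition adjoin : {mfun Omega >-> (U * R)%type} := VX.

(** Both sides are finite measures in B, and they agree on rectangles B1 x B2: there,
    X i \in B2 is one more event of the family from which V is independent. *)
Lemma adjoin_law_event B J A : measurable B -> uniq J ->
    all [predD1 D & i] J -> (forall j, measurable (A j)) ->
  P (adjoin @^-1` B `&` family_event J A)
  = (distribution P V \x distribution P (X i)) B * \prod_(j <- J) P (X j @^-1` A j).
Proof.
move=> mB uJ DJ mA.
have mH := measurable_family_event J mA.
set k := \prod_(j <- J) _.
have k_fin : k \is a fin_num.
  apply: (big_ind (fun x : \bar R => x \is a fin_num)) => // [x y|j _].
    exact: fin_numM.
  by apply: fin_num_measure; rewrite -[_ @^-1` _]setTI; exact: measurable_funP.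
have k0 : (0 <= fine k)%R.
  by rewrite fine_ge0//; apply: (big_ind (fun x : \bar R => 0 <= x)) => // x y; exact: mule_ge0.
pose kn := NngNum k0.
pose nu := mscale kn (distribution P V \x distribution P (X i)).
suff : pushforward (mrestr P mH) adjoin B = nu B.
  rewrite /pushforward /mrestr => ->.
  by rewrite /nu /mscale/= fineK// muleC.
apply: measure_eq_rectangles mB.
  change (P (adjoin @^-1` setT `&` family_event J A) < +oo).
  by rewrite preimage_setT setTI ltey_eq fin_num_measure.
move=> B1 B2 mB1 mB2.
pose A' j := if j == i then B2 else A j.
have mA' j : measurable (A' j) by rewrite /A'; case: ifP.
have iJ : i \notin J by apply/negP => /(allP DJ) /=; rewrite eqxx.
have A'J j : j \in J -> A' j = A j.
  by rewrite /A'; case: eqP => // ->; rewrite (negbTE iJ).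
transitivity (P (V @^-1` B1 `&` family_event (i :: J) A')).
  rewrite /pushforward /mrestr family_event_cons setIA; congr (P (_ `&` _)).
    by apply/seteqP; split => w /=; rewrite /A' eqxx.
  by apply: eq_bigcapr => j /= /A'J ->.
transitivity (k * (P (V @^-1` B1) * P (X i @^-1` B2))); last first.
  by rewrite /= /mscale/= fineK// product_measure1E.
rewrite indV//.
- rewrite big_cons; have -> : \prod_(j <- J) P (X j @^-1` A' j) = k.
    by rewrite /k !big_seq; apply: eq_bigr => j /A'J ->.
  by rewrite /A' eqxx muleA muleC.
- by rewrite /= iJ uJ.
- by rewrite /= Di; apply/allP => j /(allP DJ) /= /andP[].
Qed.

Lemma adjoin_law B : measurable B ->
  P (adjoin @^-1` B) = (distribution P V \x distribution P (X i)) B.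
Proof.
move=> mB; have := @adjoin_law_event B [::] (fun=> setT) mB isT isT (fun=> measurableT).
by rewrite family_event_nil setIT big_nil mule1.
Qed.

(** Once X i has been adjoined, the pair is independent of the remaining variables. *)
Lemma independent_of_adjoin : independent_of [predD1 D & i] adjoin.
Proof. by move=> B J A mB uJ DJ mA; rewrite adjoin_law_event// adjoin_law. Qed.

Lemma ge0_integral_adjoin (f : U * R -> \bar R) :
    measurable_fun setT f -> (forall z, 0 <= f z) ->
  \int[P]_w f (V w, X i w) = \int[P]_w \int[distribution P (X i)]_x f (V w, x).
Proof.
move=> mf f0.
transitivity (\int[distribution P adjoin]_z f z).
  by rewrite ge0_integral_distribution.
transitivity (\int[distribution P V \x distribution P (X i)]_z f z).
  by apply: eq_measure_integral => B mB _; exact: adjoin_law.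
rewrite fubini_tonelli1// ge0_integral_distribution//.
  exact: measurable_fun_fubini_tonelli_F.
by move=> u; exact: integral_ge0.
Qed.

End adjunction.
End independence_of_a_family.

Local Close Scope ereal_scope.

(** * The one-step operator *)

Local Open Scope ereal_scope.

Section one_step_operator.
Context {R : realType}.
Variables (a c delta : R) (m : R -> R -> R) (l : R -> R).
Variables (lawT lawY : probability R R).
Hypothesis mm : measurable_fun [set: R * R] (fun p => m p.1 p.2).
Hypothesis ml : measurable_fun [set: R] l.
Hypothesis l_bnd : forall z, (0 <= l z <= c)%R.
Notation mu := (@lebesgue_measure R).

Definition discount (t : R) : R := expR (- (delta * t)).

Lemma discount_ge0 t : (0 <= discount t)%R. Proof. exact: expR_ge0. Qed.

Lemma measurable_discount : measurable_fun setT discount.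
Proof.
apply: measurableT_comp; first exact: measurable_expR.
by apply: measurableT_comp => //; exact: mulrl_measurable.
Qed.

(** Discounted reward earned before the next claim. Rewards are extended reals, so
    that Tonelli's theorem applies to them without any integrability condition. *)
Definition flow_reward (z t : R) : \bar R :=
  \int[mu]_(s in `[0%R, t[) (discount s * l (m z s))%:E.

Lemma flow_reward_ge0 z t : 0 <= flow_reward z t.
Proof.
apply: integral_ge0 => s _; rewrite lee_fin mulr_ge0 ?discount_ge0//.
by have /andP[] := l_bnd (m z s).
Qed.

Lemma measurable_reward_rate z : measurable_fun setT (fun s => discount s * l (m z s))%R.
Proof.
apply: measurable_funM; first exact: measurable_discount.
apply: (measurableT_comp ml).
by apply: (measurableT_comp mm (g := fun s => (z, s))); exact: measurable_pair1.
Qed.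

(** The integral over [0, t[ is a section integral of a function of (z, t, s) on the
    whole space. *)
Lemma measurable_flow_reward :
  measurable_fun [set: R * R] (fun p => flow_reward p.1 p.2).
Proof.
pose F (q : (R * R) * R) : \bar R :=
  (if (0 <= q.2)%R && (q.2 < q.1.2)%R then (discount q.2 * l (m q.1.1 q.2))%R else 0%R)%:E.
have mF : measurable_fun setT F.
  apply/measurable_EFinP; apply: measurable_fun_if => //.
  - apply: measurable_and.
      by apply: measurable_fun_ler => //; exact: measurable_snd.
    apply: measurable_fun_ltr; first exact: measurable_snd.
    by apply: measurableT_comp; [exact: measurable_snd|exact: measurable_fst].
  - apply: measurable_funTS; apply: measurable_funM.
      by apply: measurableT_comp; [exact: measurable_discount|exact: measurable_snd].
    apply: (measurableT_comp ml).
    apply: (measurableT_comp mm (g := fun q : (R * R) * R => (q.1.1, q.2))).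
    apply: measurable_fun_pair; last exact: measurable_snd.
    by apply: measurableT_comp; exact: measurable_fst.
have F0 q : 0 <= F q.
  rewrite /F lee_fin; case: ifP => // _; rewrite mulr_ge0 ?discount_ge0//.
  by have /andP[] := l_bnd (m q.1.1 q.2).
have := measurable_fun_fubini_tonelli_F (m2 := mu) F mF F0.
congr (measurable_fun _ _); apply/funext => -[z t].
rewrite /fubini_F /flow_reward [RHS]integral_mkcond.
apply: eq_integral => s _; rewrite patchE /F/=.
have -> : (s \in `[0%R, t[%classic) = (0 <= s)%R && (s < t)%R.
  by apply/idP/idP; rewrite inE/= in_itv.
by case: ifP.
Qed.

Definition after_claim (z t y : R) : R := if (z <= a)%R then z else (m z t - y)%R.

Lemma measurable_after_claim :
  measurable_fun [set: (R * R) * R] (fun q => after_claim q.1.1 q.1.2 q.2).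
Proof.
have m11 : measurable_fun [set: (R * R) * R] (fun q => q.1.1).
  by apply: measurableT_comp; exact: measurable_fst.
apply: measurable_fun_if => //.
- exact: measurable_fun_ler.
- exact: measurable_funTS.
- apply: measurable_funTS; apply: measurable_funB; last exact: measurable_snd.
  by apply: (measurableT_comp mm); exact: measurable_fst.
Qed.

Definition step_payoff (f : R -> \bar R) (z t y : R) : \bar R :=
  flow_reward z t + (discount t)%:E * f (after_claim z t y).

(** The operator of the renewal equation: the value function is its fixed point. *)
Definition one_step (f : R -> \bar R) (z : R) : \bar R :=
  \int[lawT]_t \int[lawY]_y step_payoff f z t y.

Section step.
Variable f : R -> \bar R.
Hypotheses (mf : measurable_fun setT f) (f0 : forall z, 0 <= f z).

Lemma step_payoff_ge0 z t y : 0 <= step_payoff f z t y.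
Proof. by rewrite adde_ge0 ?flow_reward_ge0// mule_ge0// lee_fin discount_ge0. Qed.

Lemma measurable_step_payoff :
  measurable_fun [set: (R * R) * R] (fun q => step_payoff f q.1.1 q.1.2 q.2).
Proof.
apply: emeasurable_funD.
  by apply: (measurableT_comp measurable_flow_reward); exact: measurable_fst.
apply: emeasurable_funM; last exact: (measurableT_comp mf measurable_after_claim).
apply/measurable_EFinP; apply: (measurableT_comp measurable_discount).
by apply: measurableT_comp; [exact: measurable_snd|exact: measurable_fst].
Qed.

Lemma measurable_step_claim :
  measurable_fun [set: R * R] (fun p => \int[lawY]_y step_payoff f p.1 p.2 y).
Proof.
exact: (measurable_fun_fubini_tonelli_F (m2 := lawY) _ measurable_step_payoff
  (fun q => step_payoff_ge0 _ _ _)).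
Qed.

Lemma step_claim_ge0 z t : 0 <= \int[lawY]_y step_payoff f z t y.
Proof. by apply: integral_ge0 => y _; exact: step_payoff_ge0. Qed.

Lemma measurable_one_step : measurable_fun setT (one_step f).
Proof.
exact: (measurable_fun_fubini_tonelli_F (m2 := lawT) _ measurable_step_claim
  (fun p => step_claim_ge0 _ _)).
Qed.

Lemma one_step_ge0 z : 0 <= one_step f z.
Proof. by apply: integral_ge0 => t _; exact: step_claim_ge0. Qed.

End step.

Lemma iter_one_step_measurable f n : measurable_fun setT f -> (forall z, 0 <= f z) ->
  measurable_fun setT (iter n one_step f) /\ (forall z, 0 <= iter n one_step f z).
Proof.
move=> mf f0; elim: n => [|n [mn n0]]; first by split.
by split; [exact: measurable_one_step|exact: one_step_ge0].
Qed.

End one_step_operator.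

Local Close Scope ereal_scope.

(** * The embedded chain of a renewal process *)

Local Open Scope ereal_scope.

Section embedded_chain.
Context {R : realType} {d : measure_display} {Omega : measurableType d}.
Variables (P : probability Omega R) (T Y : nat -> {RV P >-> R}).
Variables (a c delta : R) (m : R -> R -> R) (l : R -> R).
Variables (lawT lawY : probability R R) (x : R).
Hypothesis mm : measurable_fun [set: R * R] (fun p => m p.1 p.2).
Hypothesis ml : measurable_fun [set: R] l.
Hypothesis l_bnd : forall z, (0 <= l z <= c)%R.
Let noise (i : nat + nat) : {RV P >-> R} :=
  match i with inl n => T n | inr n => Y n end.
Hypothesis noise_indep : mutually_independent noise.
Hypothesis T_law : forall n A, measurable A -> distribution P (T n) A = lawT A.
Hypothesis Y_law : forall n A, measurable A -> distribution P (Y n) A = lawY A.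

Let step (q : (R * R) * R * R) : R * R :=
  (q.1.1.1 + q.1.2, after_claim a m q.1.1.2 q.1.2 q.2)%R.

Let measurable_step : measurable_fun setT step.
Proof.
have m1 : measurable_fun [set: (R * R) * R * R] (fun q => q.1.1).
  by apply: measurableT_comp; exact: measurable_fst.
have m2 : measurable_fun [set: (R * R) * R * R] (fun q => q.1.2).
  by apply: measurableT_comp; [exact: measurable_snd|exact: measurable_fst].
apply: measurable_fun_pair.
  by apply: measurable_funD => //; apply: measurableT_comp => //; exact: measurable_fst.
apply: (measurableT_comp (measurable_after_claim a mm)
  (g := fun q : (R * R) * R * R => ((q.1.1.2, q.1.2), q.2))).
apply: measurable_fun_pair; last exact: measurable_snd.
apply: measurable_fun_pair => //.
by apply: measurableT_comp => //; exact: measurable_snd.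
Qed.

HB.instance Definition _ := isMeasurableFun.Build _ _ _ _ step measurable_step.

(** Time of the n-th claim and position just after it. The chain is built by adjoining
    the n-th inter-arrival time, then the n-th claim size, so that its independence
    of the later noise follows from that of the noise. *)
Fixpoint clock_position (n : nat) : {mfun Omega >-> (R * R)%type} :=
  if n is k.+1 then
    step \o adjoin noise (adjoin noise (clock_position k) (inl k)) (inr k)
  else cst (0%R, x).

Let later (n : nat) : pred (nat + nat) :=
  fun i => match i with inl k | inr k => (n <= k)%N end.

Lemma independent_of_sub {d' : measure_display} {U : measurableType d'}
  (D D' : pred (nat + nat)) (V : {mfun Omega >-> U}) :
  subpred D' D -> independent_of noise D V -> independent_of noise D' V.
Proof.
move=> D'D indV B J A mB uJ D'J; apply: indV => //.
by apply/allP => i /(allP D'J); exact: D'D.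
Qed.

Lemma clock_position_independent n : independent_of noise (later n) (clock_position n).
Proof.
elim: n => [|n IH].
  apply: (independent_of_sub (D := xpredT)) => //.
  exact: (independent_of_cst (X := noise)).
have hT : later n (inl n) by rewrite /later.
have indT := independent_of_adjoin IH hT.
have hY : [predD1 later n & inl n] (inr n) by exact: leqnn.
have indY := independent_of_adjoin indT hY.
apply: (independent_of_sub _ (independent_of_comp step indY)) => -[k|k] /=.
  move=> nk; rewrite !inE; apply/andP; split; last exact: ltnW.
  by apply: contraTneq nk => -[->]; rewrite ltnn.
move=> nk; rewrite !inE; apply/andP; split; last exact: ltnW.
by apply: contraTneq nk => -[->]; rewrite ltnn.
Qed.

Let clock n w := (clock_position n w).1.
Let position n w := (clock_position n w).2.

Definition chain_reward (n : nat) (w : Omega) : \bar R :=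
  \sum_(k < n) (discount delta (clock k w))%:E * flow_reward delta m l (position k w) (T k w).

(** The n-th inter-arrival time and claim size are independent of the chain at time n,
    and can be integrated out with their own laws. *)
Lemma one_step_expectation (f : R -> \bar R) n : measurable_fun setT f -> (forall z, 0 <= f z) ->
  \int[P]_w ((discount delta (clock n w))%:E *
      flow_reward delta m l (position n w) (T n w)
    + (discount delta (clock n.+1 w))%:E * f (position n.+1 w))
  = \int[P]_w ((discount delta (clock n w))%:E *
      one_step a delta m l lawT lawY f (position n w)).
Proof.
move=> mf f0.
pose V := clock_position n.
pose g (q : (R * R) * R * R) : \bar R := (discount delta q.1.1.1)%:E
  * step_payoff a delta m l f q.1.1.2 q.1.2 q.2.
have g0 q : 0 <= g q.
  by rewrite mule_ge0 ?lee_fin ?discount_ge0//; exact: step_payoff_ge0.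
have m1 : measurable_fun [set: (R * R) * R * R] (fun q => q.1.1).
  by apply: measurableT_comp; exact: measurable_fst.
have m2 : measurable_fun [set: (R * R) * R * R] (fun q => q.1.2).
  by apply: measurableT_comp; [exact: measurable_snd|exact: measurable_fst].
have mg : measurable_fun setT g.
  apply: emeasurable_funM.
    apply/measurable_EFinP; apply: (measurableT_comp (measurable_discount delta)).
    by apply: measurableT_comp => //; exact: measurable_fst.
  have marg : measurable_fun setT (fun q : (R * R) * R * R => ((q.1.1.2, q.1.2), q.2)).
    apply: measurable_fun_pair; last exact: measurable_snd.
    apply: measurable_fun_pair => //.
    by apply: measurableT_comp => //; exact: measurable_snd.
  exact: (measurableT_comp (measurable_step_payoff a delta mm ml l_bnd mf) marg).
have hT : later n (inl n) by rewrite /later.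
have indT := independent_of_adjoin (@clock_position_independent n) hT.
have hY : [predD1 later n & inl n] (inr n) by exact: leqnn.
transitivity (\int[P]_w g ((V w, T n w), Y n w)).
  apply: eq_integral => w _; rewrite /g /step_payoff [RHS]ge0_muleDr; last 2 first.
  - exact: (flow_reward_ge0 delta m l_bnd).
  - by rewrite mule_ge0// lee_fin discount_ge0.
  congr (_ + _); rewrite muleA -EFinM; congr (_%:E * _).
  by rewrite /discount -expRD -opprD -mulrDr.
transitivity (\int[P]_w \int[lawY]_y g ((V w, T n w), y)).
  rewrite (ge0_integral_adjoin indT hY mg g0).
  by apply: eq_integral => w _; apply: eq_measure_integral => A mA _; exact: Y_law.
pose g' (q : (R * R) * R) : \bar R := \int[lawY]_y g (q, y).
have g'0 q : 0 <= g' q by exact: integral_ge0.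
have mg' : measurable_fun setT g' by exact: (measurable_fun_fubini_tonelli_F (m2 := lawY) g).
rewrite (ge0_integral_adjoin (@clock_position_independent n) hT mg' g'0).
apply: eq_integral => w _.
have eK : (0 <= discount delta (clock n w))%R := discount_ge0 _ _.
rewrite /one_step -ge0_integralZl_EFin//; last 2 first.
- by move=> t _; exact: (step_claim_ge0 a delta m lawY l_bnd f0).
- have mpair := @measurable_pair1 _ _ R R (position n w).
  exact: (measurableT_comp (measurable_step_claim a delta lawY mm ml l_bnd mf f0) mpair).
transitivity (\int[lawT]_t g' (V w, t)).
  by apply: eq_measure_integral => A mA _; exact: T_law.
apply: eq_integral => t _; rewrite /g' /g/= ge0_integralZl_EFin//.
- by move=> y _; exact: step_payoff_ge0.
- have mpair := @measurable_pair1 _ _ (R * R)%type R (position n w, t).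
  exact: (measurableT_comp (measurable_step_payoff a delta mm ml l_bnd mf) mpair).
Qed.

Let measurable_position k : measurable_fun setT (position k).
Proof. by apply: measurableT_comp; [exact: measurable_snd|exact: measurable_funP]. Qed.

Let measurable_clock_discount k :
  measurable_fun setT (fun w => (discount delta (clock k w))%:E).
Proof.
apply/measurable_EFinP; apply: (measurableT_comp (measurable_discount delta)).
by apply: measurableT_comp; [exact: measurable_fst|exact: measurable_funP].
Qed.

Let clock_discount_ge0 k w : 0 <= (discount delta (clock k w))%:E.
Proof. by rewrite lee_fin discount_ge0. Qed.

Lemma chain_reward_ge0 n w : 0 <= chain_reward n w.
Proof.
by apply: sume_ge0 => k _; rewrite mule_ge0//; exact: (flow_reward_ge0 delta m l_bnd).
Qed.

Lemma measurable_chain_reward n : measurable_fun setT (chain_reward n).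
Proof.
apply: emeasurable_sum => k; apply: emeasurable_funM => //.
have mpair : measurable_fun setT (fun w => (position k w, T k w)).
  exact: measurable_fun_pair.
exact: (measurableT_comp (measurable_flow_reward delta mm ml l_bnd) mpair).
Qed.

Lemma measurable_chain_payoff n (f : R -> \bar R) : measurable_fun setT f ->
  measurable_fun setT
    (fun w => chain_reward n w + (discount delta (clock n w))%:E * f (position n w)).
Proof.
move=> mf; apply: emeasurable_funD; first exact: measurable_chain_reward.
by apply: emeasurable_funM => //; exact: measurableT_comp.
Qed.

(** The reward up to the n-th claim plus a terminal reward f at the n-th claim. The law
    of the noise enters the right-hand side through lawT and lawY only, hence the
    comparison of processes defined on different probability spaces. *)
Lemma chain_expectation n (f : R -> \bar R) : measurable_fun setT f -> (forall z, 0 <= f z) ->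
  \int[P]_w (chain_reward n w + (discount delta (clock n w))%:E * f (position n w))
  = iter n (one_step a delta m l lawT lawY) f x.
Proof.
elim: n f => [|n IH] f mf f0.
  under eq_integral do rewrite /chain_reward big_ord0 add0e /clock /position
    /discount/= mulr0 oppr0 expR0 mul1e.
  by rewrite integral_cst//= probability_setT mule1.
have mreward := measurable_chain_reward n.
have reward0 w := chain_reward_ge0 n w.
have term0 : forall w, 0 <= (discount delta (clock n w))%:E
    * flow_reward delta m l (position n w) (T n w).
  by move=> w; rewrite mule_ge0//; exact: (flow_reward_ge0 delta m l_bnd).
rewrite iterSr -IH; [|exact: measurable_one_step|exact: (one_step_ge0 a delta m lawT lawY l_bnd)].
rewrite [RHS]ge0_integralD//; last 2 first.
- by move=> w _; rewrite mule_ge0//; exact: (one_step_ge0 a delta m lawT lawY l_bnd).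
- apply: emeasurable_funM => //; apply: measurableT_comp => //.
  exact: (measurable_one_step a delta lawT lawY mm ml l_bnd).
rewrite -one_step_expectation// -ge0_integralD//; last 2 first.
- by move=> w _; rewrite adde_ge0// mule_ge0.
- apply: emeasurable_funD; last by apply: emeasurable_funM => //; exact: measurableT_comp.
  apply: emeasurable_funM => //.
  have mpair : measurable_fun setT (fun w => (position n w, T n w)).
    exact: measurable_fun_pair.
  exact: (measurableT_comp (measurable_flow_reward delta mm ml l_bnd) mpair).
by apply: eq_integral => w _; rewrite /chain_reward big_ord_recr/= addeA.
Qed.

End embedded_chain.

Local Close Scope ereal_scope.

(** * Rewards along a sample path *)

(** The integral of a nonnegative function is the supremum of those of the simple
    functions below it, hence monotone even for functions that are not measurable.
    Thus the reward of a path can be enclosed between measurable functions without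
    discussing its own measurability. *)
Lemma ge0_le_integralT {d : measure_display} {T : measurableType d} {R : realType}
    (mu : {measure set T -> \bar R}) (f g : T -> \bar R) :
  (forall x, 0 <= f x <= g x)%E -> (\int[mu]_x f x <= \int[mu]_x g x)%E.
Proof.
move=> fg; have f0 x : (0 <= f x)%E by have /andP[] := fg x.
have g0 x : (0 <= g x)%E by have /andP[] := fg x; exact: le_trans.
rewrite !ge0_integralTE//; apply: le_ereal_sup => _ [k kf <-]; exists k => // x.
by have /andP[_] := fg x; apply: le_trans; exact: kf.
Qed.

Section sample_path.
Context {R : realType} (c rho b delta : R) (phi : R -> R -> R).
Variables (lx : nat * R -> R) (l : R -> R).
Hypotheses (c_gt0 : 0 < c) (rho_gt0 : 0 < rho) (b_gt0 : 0 < b) (delta_gt0 : 0 < delta).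
Let a : R := - (c / rho).
Let m := stopped_flow a b phi.
Hypothesis phi0 : forall y, phi y 0 = y.
Hypothesis phi_nd : forall y s t, s <= t -> phi y s <= phi y t.
Hypothesis phi_cont : forall y, continuous (phi y).
Hypothesis lx_alive : forall y, a < y -> y < b -> lx (1%N, y) = l y.
Hypothesis lx_barrier : lx (4%N, b) = l b.
Hypothesis lx_dead : forall k y, (k == 2%N) || (k == 3%N) -> lx (k, y) = 0.
Hypothesis l_dead : forall y, y <= a -> l y = 0.
Hypothesis lx_bnd : forall x, 0 <= lx x <= c.

Let ab : a < b.
Proof. by rewrite (@lt_trans _ _ 0)// oppr_lt0 divr_gt0. Qed.

(** The state space together with (1, b), to which a claim of size 0 leads from (4, b):
    claims are positive only almost surely, and admitting the size 0 makes the set of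
    exceptional paths a countable union of events of the form X < 0. *)
Definition regular (x : nat * R) : Prop :=
  match x.1 with
  | 1 => a < x.2 <= b
  | 2 => x.2 < a
  | 3 => x.2 = a
  | 4 => x.2 = b
  | _ => False
  end.

Lemma state_space_regular x : state_space c rho b x -> regular x.
Proof.
case: x => k y [j /= /andP[j1 j4] [/= -> {k}]]; rewrite /regular/=.
by case: j j1 j4 => [|[|[|[|[|//]]]]]//= _ _; rewrite in_itv/= => /andP[-> /ltW].
Qed.

(** A flow that starts at or below b is at or above b if and only if it takes the value b at
    some time, by the intermediate value theorem; so the label reached is determined
    by the capped position. *)
Lemma motion_regular x t : regular x -> 0 <= t ->
  [/\ regular (motion b phi x t), (motion b phi x t).2 = m x.2 t,
      lx (motion b phi x t) = l (m x.2 t)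
    & (x.2 <= a) = ((motion b phi x t).1 == 2%N) || ((motion b phi x t).1 == 3%N)].
Proof.
case: x => k y; rewrite /regular /motion /m /stopped_flow/=.
case: k => [|[|[|[|[|//]]]]]//=.
- move=> /andP[ay yb] t0; rewrite (lt_geF ay) (max_idPl t0).
  case: asboolP => [[s /andP[s0 st] sb]|nohit] /=.
    by rewrite (min_idPr (_ : b <= phi y t)) ?lx_barrier// -sb phi_nd.
  have ytb : phi y t < b.
    rewrite ltNge; apply/negP => bt; apply: nohit.
    have cp : {within `[0, t], continuous (phi y)} by exact: continuous_subspaceT.
    have ybt : y <= phi y t by rewrite -{1}(phi0 y) phi_nd.
    have := @IVT _ (phi y) 0 t b t0 cp.
    rewrite phi0 (min_idPl ybt) (max_idPr ybt) yb bt => /(_ isT)[s].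
    by rewrite in_itv/= => s0t sb; exists s.
  rewrite (min_idPl (ltW ytb)) (ltW ytb) lx_alive//.
    by rewrite (lt_le_trans ay)// -{1}(phi0 y) phi_nd.
  by rewrite (lt_le_trans ay)// -{1}(phi0 y) phi_nd.
- by move=> ya _; rewrite (ltW ya) lx_dead// l_dead// ltW.
- by move=> -> _; rewrite lexx lx_dead// l_dead.
- move=> -> t0; rewrite (lt_geF ab) (min_idPr _) ?lx_barrier//.
  by rewrite (max_idPl t0) -{1}(phi0 b) phi_nd.
Qed.

Lemma stopped_flow_dead_iff z t : (m z t <= a) = (z <= a).
Proof.
have [za|az] := leP z a; first by rewrite /m stopped_flow_dead.
apply/negbTE; rewrite -ltNge /m /stopped_flow (lt_geF az) lt_min ab andbT.
by apply: (lt_le_trans az); rewrite -{1}(phi0 z) phi_nd// le_max lexx orbT.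
Qed.

Lemma jump_regular x y : regular x -> 0 <= y ->
  regular (jump c rho x y) /\
  (jump c rho x y).2 = if x.2 <= a then x.2 else x.2 - y.
Proof.
have place_regular z : z <= b -> regular (place c rho z) /\ (place c rho z).2 = z.
  rewrite /place /regular -/a => zb; case: (ltP a z) => [az|za]; first by rewrite az.
  by case: ltgtP za => //.
case: x => k z; rewrite {1}/regular /jump/=.
case: k => [|[|[|[|[|//]]]]]//=.
- move=> /andP[az zb] y0; rewrite (lt_geF az).
  by apply: place_regular; rewrite lerBlDr (le_trans zb)// lerDl.
- by move=> za _; rewrite (ltW za).
- by move=> -> _; rewrite lexx.
- move=> -> y0; rewrite (lt_geF ab).
  by apply: place_regular; rewrite lerBlDr lerDl.
Qed.

Variables (T Y : nat -> R) (x : nat * R).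
Hypotheses (T_ge0 : forall n, 0 <= T n) (Y_ge0 : forall n, 0 <= Y n).
Hypothesis x_regular : regular x.

Fixpoint path_position (n : nat) : R :=
  if n is k.+1 then after_claim a m (path_position k) (T k) (Y k) else x.2.

Let S := jump_time T.
Let X := post_jump c rho b phi T Y x.

Lemma post_jump_regular n : regular (X n) /\ (X n).2 = path_position n.
Proof.
elim: n => [|n [Xn XnE]] //; rewrite /X/= -/(X n).
have [Mr ME _ Mdead] := motion_regular Xn (T_ge0 n).
have [Jr ->] := jump_regular Mr (Y_ge0 n); split => //.
rewrite /after_claim -XnE ME.
rewrite stopped_flow_dead_iff.
case: ifPn => // dead.
by rewrite /m stopped_flow_dead.
Qed.

Lemma path_position_dead j k : (j <= k)%N -> path_position j <= a -> path_position k <= a.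
Proof.
elim: k => [|k IH]; first by rewrite leqn0 => /eqP ->.
rewrite leq_eqVlt => /predU1P[->//|]; rewrite ltnS => /IH{}IH /IH /= pk.
by rewrite /after_claim pk.
Qed.

Lemma jump_timeS n : S n.+1 = S n + T n.
Proof. by rewrite /S /jump_time big_ord_recr. Qed.

Lemma jump_time_le j k : (j <= k)%N -> S j <= S k.
Proof.
elim: k => [|k IH]; first by rewrite leqn0 => /eqP ->.
rewrite leq_eqVlt => /predU1P[->//|]; rewrite ltnS => /IH /le_trans; apply.
by rewrite jump_timeS lerDl.
Qed.

Lemma jump_time0 : S 0 = 0.
Proof. by rewrite /S /jump_time big_ord0. Qed.

Lemma jump_time_ge0 n : 0 <= S n.
Proof. by rewrite -jump_time0 jump_time_le. Qed.

Lemma njumpsE k s : S k <= s < S k.+1 -> njumps T s = k.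
Proof.
move=> /andP[ks sk]; rewrite /njumps; apply: xget_unique.
  split=> // j jk; apply: le_trans ks; exact: jump_time_le.
move=> n [sn nlt]; have [nk|kn|//] := ltngtP n k.
  by have := jump_time_le nk; rewrite leNgt (le_lt_trans ks sn).
by have := nlt _ kn; rewrite leNgt sk.
Qed.

Lemma jump_interval n s : 0 <= s < S n -> exists2 k, (k < n)%N & S k <= s < S k.+1.
Proof.
elim: n => [|n IH]; first by rewrite jump_time0 => /andP[s0 /(le_lt_trans s0)]; rewrite ltxx.
move=> /andP[s0 sn]; have [sn'|ns] := ltP s (S n).
  by have [|k kn ks] := IH; [rewrite s0|exists k => //; exact: ltnW].
by exists n; rewrite ?ltnSn ?ns.
Qed.

Let process' := process c rho b phi T Y x.

Lemma process_reward k s : S k <= s < S k.+1 ->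
  lx (process' s) = l (m (path_position k) (s - S k)) /\
  (cemetery c rho b (process' s) -> path_position k <= a).
Proof.
move=> ksk; have /andP[ks _] := ksk.
rewrite /process' /process (njumpsE ksk) -/(X k) -/(S k).
have [Xr XE] := post_jump_regular k.
have sk0 : 0 <= s - S k by rewrite subr_ge0.
have [_ _ -> Mdead] := motion_regular Xr sk0; rewrite -XE; split => //.
rewrite Mdead; move=> [] [] /= -> _; by rewrite ?orbT.
Qed.

Hypothesis mm : measurable_fun [set: R * R] (fun p => m p.1 p.2).
Hypothesis ml : measurable_fun [set: R] l.
Hypothesis l_bnd : forall z, 0 <= l z <= c.
Notation mu := (@lebesgue_measure R).

Definition interjump_reward (k : nat) (s : R) : R :=
  if (S k <= s) && (s < S k.+1)
  then discount delta s * l (m (path_position k) (s - S k)) else 0.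

Lemma interjump_reward_ge0 k s : 0 <= interjump_reward k s.
Proof.
rewrite /interjump_reward; case: ifP => // _; rewrite mulr_ge0 ?discount_ge0//.
by have /andP[] := l_bnd (m (path_position k) (s - S k)).
Qed.

Lemma interjump_reward_shift k s : interjump_reward k s = discount delta (S k) *
  ((fun u => discount delta u * l (m (path_position k) u)) \_ `[0, T k[) (s - S k).
Proof.
rewrite patchE mem_setE/= in_itv/= subr_ge0 ltrBlDl -jump_timeS /interjump_reward.
case: ifP => _; last by rewrite mulr0.
by rewrite mulrA /discount -expRD; congr (expR _ * _); ring.
Qed.

Lemma measurable_flow_rate k : measurable_fun [set: R]
  ((fun u => discount delta u * l (m (path_position k) u)) \_ `[0, T k[).
Proof.
apply/(measurable_restrictT _ _).1 => //; apply: measurable_funTS.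
exact: (measurable_reward_rate delta mm ml).
Qed.

(** Shifting time by the k-th claim time costs the discount factor of that time. *)
Lemma integral_interjump_reward k :
  (\int[mu]_s (interjump_reward k s)%:E
   = (discount delta (S k))%:E * flow_reward delta m l (path_position k) (T k))%E.
Proof.
under eq_integral do rewrite interjump_reward_shift EFinM.
have rate0 u : (0 <= (((fun u => discount delta u * l (m (path_position k) u))
    \_ `[0, T k[) u)%:E)%E.
  rewrite lee_fin; apply: restrict_ge0 => {}u _; rewrite mulr_ge0 ?discount_ge0//.
  by have /andP[] := l_bnd (m (path_position k) u).
have mrate := measurable_flow_rate k.
have mrateE : measurable_fun [set: R] (fun u => (((fun u => discount delta u *
    l (m (path_position k) u)) \_ `[0, T k[) u)%:E) by exact/measurable_EFinP.
have mshift : measurable_fun [set: R] (fun s => s - S k) by exact: measurable_funB.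
rewrite ge0_integralZl_EFin ?discount_ge0//; last exact: (measurableT_comp mrateE mshift).
congr (_ * _)%E; rewrite (ge0_integral_shift (S k) mrateE rate0).
rewrite /flow_reward [RHS]integral_mkcond; apply: eq_integral => u _.
by rewrite !patchE; case: ifP.
Qed.

Lemma measurable_interjump_reward k :
  measurable_fun [set: R] (fun s => (interjump_reward k s)%:E).
Proof.
apply/measurable_EFinP; rewrite (funext (interjump_reward_shift k)).
apply: measurable_funM => //.
have mshift : measurable_fun [set: R] (fun s => s - S k) by exact: measurable_funB.
exact: (measurableT_comp (measurable_flow_rate k) mshift).
Qed.

Definition path_reward (n : nat) : \bar R :=
  (\sum_(k < n) (discount delta (S k))%:E
    * flow_reward delta m l (path_position k) (T k))%E.

Lemma path_reward_integral n :
  (path_reward n = \int[mu]_s (\sum_(k < n) interjump_reward k s)%:E)%E.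
Proof.
under eq_integral do rewrite -sumEFin.
rewrite ge0_integral_sum//; last 2 first.
- by move=> k; exact: measurable_interjump_reward.
- by move=> k s _; rewrite lee_fin interjump_reward_ge0.
by apply: eq_bigr => k _; rewrite integral_interjump_reward.
Qed.

(** Up to a factor, the tail of the discount function is a shifted exponential
    density, whose integral is 1. *)
Lemma discount_tail_pdf (s0 s : R) :
  ((fun s => c * discount delta s) \_ `[s0, +oo[) s
  = c / delta * discount delta s0 * exponential_pdf delta (s - s0).
Proof.
rewrite patchE mem_setE/= in_itv/= andbT; case: ifPn => [s0s|].
  rewrite exponential_pdfE ?subr_ge0// /discount.
  have -> : - (delta * s) = - (delta * s0) + - delta * (s - s0) by ring.
  by rewrite expRD; field; rewrite gt_eqF.
by rewrite -ltNge => ss0; rewrite lt0_exponential_pdf ?mulr0// subr_lt0.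
Qed.

Lemma measurable_discount_tail (s0 : R) : measurable_fun [set: R]
  (fun s => (((fun s => c * discount delta s) \_ `[s0, +oo[) s)%:E).
Proof.
apply/measurable_EFinP/(measurable_restrictT _ _).1 => //.
by apply: measurable_funTS; apply: measurable_funM => //; exact: measurable_discount.
Qed.

Lemma integral_discount_tail (s0 : R) :
  (\int[mu]_s (((fun s => c * discount delta s) \_ `[s0, +oo[) s)%:E
   = (c / delta * discount delta s0)%:E)%E.
Proof.
under eq_integral do rewrite discount_tail_pdf EFinM.
have pdf0 (s : R) : (0 <= (exponential_pdf delta s)%:E)%E.
  by rewrite lee_fin exponential_pdf_ge0// ltW.
have mpdf : measurable_fun [set: R] (fun s => (exponential_pdf delta s)%:E).
  by apply/measurable_EFinP; exact: measurable_exponential_pdf.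
have mshift : measurable_fun [set: R] (fun s => s - s0) by exact: measurable_funB.
rewrite ge0_integralZl_EFin//; last 2 first.
- exact: (measurableT_comp mpdf mshift).
- by rewrite mulr_ge0 ?discount_ge0// divr_ge0 ?ltW.
by rewrite (ge0_integral_shift s0 mpdf pdf0) integral_exponential_pdf// mule1.
Qed.

Let ruin := ruin_time c rho b phi T Y x.
Let payoff := (fun s => discount delta s * lx (process' s))
  \_ [set s | 0 <= s /\ (s%:E <= ruin)%E].

Lemma interjump_sum k n s : (k < n)%N -> S k <= s < S k.+1 ->
  \sum_(j < n) interjump_reward j s = discount delta s * l (m (path_position k) (s - S k)).
Proof.
move=> kn ksk; rewrite (bigD1 (Ordinal kn))//= big1 ?addr0.
  by rewrite /interjump_reward ksk.
move=> j jk; rewrite /interjump_reward; case: ifP => // jsj.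
by move: jk; rewrite -val_eqE/= -(njumpsE ksk) -(njumpsE jsj) eqxx.
Qed.

Lemma interjump_sum0 n s : s < 0 \/ S n <= s -> \sum_(j < n) interjump_reward j s = 0.
Proof.
move=> sn; rewrite big1// => j _; rewrite /interjump_reward; case: ifP => // /andP[js sj].
case: sn => sn; first by move: (le_lt_trans js sn); rewrite ltNge jump_time_ge0.
by move: (le_lt_trans sn sj); rewrite ltNge jump_time_le.
Qed.

Lemma payoff_ge0 s : 0 <= payoff s.
Proof.
apply: restrict_ge0 => u _; rewrite mulr_ge0 ?discount_ge0//.
by have /andP[] := lx_bnd (process' u).
Qed.

(** After the ruin time, where the payoff vanishes, the chain already sits at a ruined
    position, at which the rate vanishes as well. *)
Lemma path_payoff_lower n s : \sum_(k < n) interjump_reward k s <= payoff s.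
Proof.
have [s0|s0] := ltP s 0; first by rewrite interjump_sum0 ?payoff_ge0//; left.
have [ns|sn] := leP (S n) s; first by rewrite interjump_sum0 ?payoff_ge0//; right.
have [|k kn ksk] := jump_interval (n := n) (s := s); first by rewrite s0.
rewrite (interjump_sum kn ksk) /payoff patchE.
have [lE _] := process_reward ksk.
case: ifPn => [_|]; first by rewrite lE.
move=> /negP sD; rewrite l_dead ?mulr0//.
have : (ruin < s%:E)%E.
  by rewrite ltNge; apply/negP => sr; apply: sD; rewrite inE.
move=> /ereal_inf_lt[_ [s' [s'0 s'dead] <-]]; rewrite lte_fin => s's.
have [|j jk jsj] := jump_interval (n := k.+1) (s := s').
  by rewrite s'0/=; case/andP: ksk => _; exact: lt_trans.
have [_ /(_ s'dead) jdead] := process_reward jsj.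
by rewrite stopped_flow_dead_iff (path_position_dead _ jdead).
Qed.

Lemma path_payoff_upper n s : payoff s <= \sum_(k < n) interjump_reward k s
  + (fun s => c * discount delta s) \_ `[S n, +oo[ s.
Proof.
have sum0 : 0 <= \sum_(k < n) interjump_reward k s.
  by apply: sumr_ge0 => k _; exact: interjump_reward_ge0.
have tail0 : 0 <= ((fun s => c * discount delta s) \_ `[S n, +oo[) s.
  by apply: restrict_ge0 => u _; rewrite mulr_ge0 ?discount_ge0// ltW.
rewrite {1}/payoff patchE; case: ifPn => [|_]; last by rewrite addr_ge0.
rewrite inE/= => -[s0 _].
have [ns|sn] := leP (S n) s.
  apply: (@le_trans _ _ (((fun s => c * discount delta s) \_ `[S n, +oo[) s)).
    rewrite patchE mem_set/= ?in_itv/= ?ns// mulrC ler_wpM2r ?discount_ge0//.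
    by have /andP[] := lx_bnd (process' s).
  by rewrite lerDr.
have [|k kn ksk] := jump_interval (n := n) (s := s); first by rewrite s0.
rewrite (interjump_sum kn ksk).
by have [-> _] := process_reward ksk; rewrite lerDl.
Qed.

(** The path follows the chain up to the n-th claim, and its rate is at most c
    afterwards. *)
Lemma discounted_reward_bounds n :
  (path_reward n <= (discounted_reward c rho b delta phi lx T Y x)%:E)%E /\
  ((discounted_reward c rho b delta phi lx T Y x)%:E
     <= path_reward n + (c / delta * discount delta (S n))%:E)%E.
Proof.
pose tail n := (fun s => c * discount delta s) \_ `[S n, +oo[.
have tail0 k s : 0 <= tail k s.
  by apply: restrict_ge0 => u _; rewrite mulr_ge0 ?discount_ge0// ltW.
have upper k : (\int[mu]_s (payoff s)%:E
    <= path_reward k + (c / delta * discount delta (S k))%:E)%E.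
  rewrite -integral_discount_tail path_reward_integral -ge0_integralD//; last 4 first.
  - by move=> s _; rewrite lee_fin; apply: sumr_ge0 => j _; exact: interjump_reward_ge0.
  - under eq_fun do rewrite -sumEFin.
    by apply: emeasurable_sum => j; exact: measurable_interjump_reward.
  - by move=> s _; rewrite lee_fin; exact: tail0.
  - exact: measurable_discount_tail.
  by apply: ge0_le_integralT => s; rewrite -EFinD !lee_fin payoff_ge0 path_payoff_upper.
have lower k : (path_reward k <= \int[mu]_s (payoff s)%:E)%E.
  rewrite path_reward_integral; apply: ge0_le_integralT => s.
  rewrite !lee_fin path_payoff_lower andbT.
  by apply: sumr_ge0 => j _; exact: interjump_reward_ge0.
have payoffE : (discounted_reward c rho b delta phi lx T Y x)%:E
    = (\int[mu]_s (payoff s)%:E)%E.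
  rewrite /discounted_reward /Rintegral.
  have -> : (\int[mu]_(s in [set s | (0 <= s)%R /\ (s%:E <= ruin)])
      (expR (- (delta * s)) * lx (process' s))%:E = \int[mu]_s (payoff s)%:E)%E.
    rewrite integral_mkcond; apply: eq_integral => s _.
    by rewrite /payoff !patchE; case: ifP.
  apply: fineK; rewrite ge0_fin_numE.
    apply: (le_lt_trans (upper 0%N)).
    by rewrite /path_reward big_ord0 add0e ltry.
  by apply: integral_ge0 => s _; rewrite lee_fin payoff_ge0.
by rewrite payoffE.
Qed.

End sample_path.

(** * Estimates for one step *)

Local Open Scope ereal_scope.

Section exponential_law.
Context {R : realType} (lambda delta : R) (lawT : probability R R).
Hypotheses (lambda_gt0 : (0 < lambda)%R) (delta_gt0 : (0 < delta)%R).
Hypothesis lawTE : forall A, measurable A -> lawT A = exponential_prob lambda A.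
Notation mu := (@lebesgue_measure R).

Lemma ge0_integral_exponential (h : R -> \bar R) : measurable_fun setT h ->
  (forall t, 0 <= h t) -> \int[lawT]_t h t = \int[mu]_t (h t * (exponential_pdf lambda t)%:E).
Proof.
move=> mh h0; apply: ge0_integral_density => //.
  exact: measurable_exponential_pdf.
by move=> t; rewrite exponential_pdf_ge0// ltW.
Qed.

(** The exponential law does not charge negative times. *)
Lemma exponential_integral_le (h1 h2 : R -> \bar R) :
    measurable_fun setT h1 -> measurable_fun setT h2 ->
    (forall t, 0 <= h1 t) -> (forall t, 0 <= h2 t) ->
    (forall t, (0 <= t)%R -> h1 t <= h2 t) ->
  \int[lawT]_t h1 t <= \int[lawT]_t h2 t.
Proof.
move=> mh1 mh2 h10 h20 h12; rewrite !ge0_integral_exponential//.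
apply: ge0_le_integralT => t.
have pdf0 : (0 <= exponential_pdf lambda t)%R by rewrite exponential_pdf_ge0// ltW.
rewrite mule_ge0//=; have [t0|t0] := leP 0%R t; last first.
  by rewrite lt0_exponential_pdf// !mule0.
by rewrite lee_wpmul2r ?lee_fin// h12.
Qed.

(** The discounted exponential density is a multiple of the exponential density of
    parameter lambda + delta. *)
Lemma integral_discount_exponential :
  \int[lawT]_t (discount delta t)%:E = (lambda / (lambda + delta))%:E.
Proof.
have ld : (0 < lambda + delta)%R by rewrite addr_gt0.
rewrite ge0_integral_exponential//; last 2 first.
- by apply/measurable_EFinP; exact: measurable_discount.
- by move=> t; rewrite lee_fin discount_ge0.
transitivity (\int[mu]_t ((lambda / (lambda + delta))%:E
    * (exponential_pdf (lambda + delta) t)%:E)).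
  apply: eq_integral => t _; rewrite -!EFinM; congr EFin.
  have [t0|t0] := leP 0%R t; last by rewrite !lt0_exponential_pdf// !mulr0.
  rewrite !exponential_pdfE// /discount mulrCA -expRD.
  have -> : (- (delta * t) + - lambda * t)%R = (- (lambda + delta) * t)%R by ring.
  by field; rewrite gt_eqF.
rewrite ge0_integralZl_EFin//.
- by rewrite integral_exponential_pdf// mule1.
- by move=> t _; rewrite lee_fin exponential_pdf_ge0// ltW.
- by apply/measurable_EFinP; exact: measurable_exponential_pdf.
- by rewrite divr_ge0 ?ltW.
Qed.

End exponential_law.

Section one_step_estimates.
Context {R : realType} (a c lambda delta : R) (lawT lawY : probability R R).
Hypotheses (c_gt0 : (0 < c)%R) (lambda_gt0 : (0 < lambda)%R) (delta_gt0 : (0 < delta)%R).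
Hypothesis lawTE : forall A, measurable A -> lawT A = exponential_prob lambda A.
Notation mu := (@lebesgue_measure R).

Lemma integral_cst_probability (Q : probability R R) (k : \bar R) : 0 <= k ->
  \int[Q]_t k = k.
Proof. by move=> k0; rewrite integral_cst//= probability_setT mule1. Qed.

Section one_model.
Variables (m : R -> R -> R) (l : R -> R).
Hypothesis mm : measurable_fun [set: R * R] (fun p => m p.1 p.2).
Hypothesis ml : measurable_fun [set: R] l.
Hypothesis l_bnd : forall z, (0 <= l z <= c)%R.
Notation step f := (one_step a delta m l lawT lawY f).

(** A reward at the full rate c for ever is worth c / delta; this compares it with the
    rate l before time t and c afterwards. *)
Lemma flow_reward_bound z t : (0 <= t)%R ->
  flow_reward delta m l z t + (discount delta t * (c / delta))%:E <= (c / delta)%:E.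
Proof.
move=> t0; pose rate s := (discount delta s * l (m z s))%R.
pose tail s0 := ((fun s => c * discount delta s)%R \_ `[s0, +oo[)%R.
have disc0 s : (0 <= c * discount delta s)%R by rewrite mulr_ge0 ?discount_ge0// ltW.
have rate0 s : (0 <= rate s <= c * discount delta s)%R.
  have /andP[l0 lc] := l_bnd (m z s).
  by rewrite /rate mulr_ge0 ?discount_ge0//= (mulrC c) ler_wpM2l// discount_ge0.
have mrate : measurable_fun [set: R] (fun s => ((rate \_ `[0%R, t[) s)%:E).
  apply/measurable_EFinP/(measurable_restrictT _ _).1 => //; apply: measurable_funTS.
  exact: (measurable_reward_rate delta mm ml).
have -> : flow_reward delta m l z t = \int[mu]_s ((rate \_ `[0%R, t[) s)%:E.
  by rewrite /flow_reward integral_mkcond; apply: eq_integral => s _; rewrite !patchE; case: ifP.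
have -> : (c / delta)%:E = (c / delta * discount delta 0)%:E.
  by rewrite /discount mulr0 oppr0 expR0 mulr1.
rewrite mulrC -(integral_discount_tail c_gt0 delta_gt0 t)
  -(integral_discount_tail c_gt0 delta_gt0 0) -ge0_integralD//; last 3 first.
- by move=> s _; rewrite lee_fin; apply: restrict_ge0 => u _; have /andP[] := rate0 u.
- by move=> s _; rewrite lee_fin; apply: restrict_ge0.
- exact: measurable_discount_tail.
apply: ge0_le_integralT => s; rewrite -EFinD !lee_fin.
have /andP[r0 rc] := rate0 s.
rewrite !patchE !mem_setE/= !in_itv/= !andbT.
have [s0|s0] := leP 0%R s; have [st|ts] := leP t s => /=.
- by rewrite add0r disc0 lexx.
- by rewrite addr0 r0.
- by move: (le_lt_trans st s0); rewrite ltNge t0.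
- by rewrite addr0 lexx.
Qed.

Lemma measurable_after_claim_fun (f : R -> \bar R) (z t : R) :
  measurable_fun setT f -> measurable_fun [set: R] (fun y => f (after_claim a m z t y)).
Proof.
move=> mf; have mpair := @measurable_pair1 _ _ (R * R)%type R (z, t).
exact: (measurableT_comp mf (measurableT_comp (measurable_after_claim a mm) mpair)).
Qed.

Lemma measurable_step_claim_at (f : R -> \bar R) z :
    measurable_fun setT f -> (forall z, 0 <= f z) ->
  measurable_fun [set: R] (fun t => \int[lawY]_y step_payoff a delta m l f z t y).
Proof.
move=> mf f0; have mpair := @measurable_pair1 _ _ R R z.
exact: (measurableT_comp (measurable_step_claim a delta lawY mm ml l_bnd mf f0) mpair).
Qed.

Lemma integral_step_payoff (f : R -> \bar R) z t :
    measurable_fun setT f -> (forall z, 0 <= f z) ->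
  \int[lawY]_y step_payoff a delta m l f z t y = flow_reward delta m l z t
    + (discount delta t)%:E * \int[lawY]_y f (after_claim a m z t y).
Proof.
move=> mf f0; have fr0 := flow_reward_ge0 delta m l_bnd z t.
have mfy := measurable_after_claim_fun z t mf.
rewrite /step_payoff ge0_integralD//; last 2 first.
- by move=> y _; rewrite mule_ge0// lee_fin discount_ge0.
- exact: emeasurable_funM.
by rewrite integral_cst_probability// ge0_integralZl_EFin// discount_ge0.
Qed.

Lemma one_step_bound (f : R -> \bar R) : measurable_fun setT f ->
    (forall z, 0 <= f z <= (c / delta)%:E) ->
  forall z, 0 <= step f z <= (c / delta)%:E.
Proof.
move=> mf fB z; have f0 u : 0 <= f u by have /andP[] := fB u.
rewrite (one_step_ge0 a delta m lawT lawY l_bnd f0)/=.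
have cd0 : (0 <= c / delta)%R by rewrite divr_ge0 ?ltW.
rewrite -[leRHS](@integral_cst_probability lawT) ?lee_fin//.
apply: (exponential_integral_le lambda_gt0 lawTE) => //.
- exact: measurable_step_claim_at.
- by move=> t; exact: (step_claim_ge0 a delta m lawY l_bnd f0).
move=> t t0; rewrite integral_step_payoff//.
apply: le_trans (flow_reward_bound z t0).
rewrite leeD2l// EFinM lee_wpmul2l ?lee_fin ?discount_ge0//.
rewrite -[leRHS](@integral_cst_probability lawY) ?lee_fin//.
by apply: ge0_le_integralT => y; exact: fB.
Qed.

Lemma one_step_dead (f : R -> \bar R) : (forall z t, (z <= a)%R -> m z t = z) ->
    (forall z, (z <= a)%R -> l z = 0%R) -> (forall z, (z <= a)%R -> f z = 0) ->
  forall z, (z <= a)%R -> step f z = 0.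
Proof.
move=> m_dead l_dead f_dead z za; rewrite /one_step integral0_eq// => t _.
rewrite integral0_eq// => y _; rewrite /step_payoff /after_claim za f_dead// mule0 adde0.
by rewrite /flow_reward integral0_eq// => s _; rewrite m_dead// l_dead// mulr0.
Qed.

End one_model.

Section two_models.
Variables (m1 m2 : R -> R -> R) (l1 l2 : R -> R) (kappa eta : R).
Hypothesis mm1 : measurable_fun [set: R * R] (fun p => m1 p.1 p.2).
Hypothesis mm2 : measurable_fun [set: R * R] (fun p => m2 p.1 p.2).
Hypothesis ml1 : measurable_fun [set: R] l1.
Hypothesis ml2 : measurable_fun [set: R] l2.
Hypothesis l1_bnd : forall z, (0 <= l1 z <= c)%R.
Hypothesis l2_bnd : forall z, (0 <= l2 z <= c)%R.
Hypotheses (kappa_ge0 : (0 <= kappa)%R) (eta_ge0 : (0 <= eta)%R).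

(** The error eta made after the claim is discounted by exp (- delta * t), whose mean
    is lambda / (lambda + delta). *)
Lemma one_step_compare (f1 f2 : R -> \bar R) :
    measurable_fun setT f1 -> measurable_fun setT f2 ->
    (forall z, 0 <= f1 z) -> (forall z, 0 <= f2 z) ->
    (forall z t, (0 <= t)%R ->
      flow_reward delta m1 l1 z t <= flow_reward delta m2 l2 z t + kappa%:E) ->
    (forall z t, (0 <= t)%R -> \int[lawY]_y f1 (after_claim a m1 z t y)
      <= \int[lawY]_y f2 (after_claim a m2 z t y) + eta%:E) ->
  forall z, one_step a delta m1 l1 lawT lawY f1 z
    <= one_step a delta m2 l2 lawT lawY f2 z + (kappa + lambda / (lambda + delta) * eta)%:E.
Proof.
move=> mf1 mf2 f10 f20 rewards claims z.
pose rest t := (kappa + discount delta t * eta)%:E.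
have rest0 t : 0 <= rest t by rewrite lee_fin addr_ge0// mulr_ge0// discount_ge0.
have mdisc : measurable_fun [set: R] (fun t => (discount delta t)%:E).
  by apply/measurable_EFinP; exact: measurable_discount.
have mrest : measurable_fun [set: R] rest.
  apply/measurable_EFinP; apply: measurable_funD => //.
  by apply: measurable_funM => //; exact: measurable_discount.
have disc0 t : 0 <= (discount delta t)%:E by rewrite lee_fin discount_ge0.
have -> : (kappa + lambda / (lambda + delta) * eta)%:E = \int[lawT]_t rest t.
  rewrite EFinD EFinM -(integral_discount_exponential lambda_gt0 delta_gt0 lawTE).
  rewrite -ge0_integralZr// /rest.
  under [RHS]eq_integral do rewrite EFinD EFinM.
  rewrite ge0_integralD//; last 2 first.
  - by move=> t _; rewrite mule_ge0.
  - exact: emeasurable_funM.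
  by rewrite integral_cst_probability.
have sc1 := step_claim_ge0 a delta m1 lawY l1_bnd f10 z.
have sc2 := step_claim_ge0 a delta m2 lawY l2_bnd f20 z.
have msc1 := measurable_step_claim_at mm1 ml1 l1_bnd z mf1 f10.
have msc2 := measurable_step_claim_at mm2 ml2 l2_bnd z mf2 f20.
rewrite /one_step -ge0_integralD//.
apply: (exponential_integral_le lambda_gt0 lawTE) => //.
- exact: emeasurable_funD.
- by move=> t; rewrite adde_ge0.
move=> t t0; rewrite (integral_step_payoff mm1 l1_bnd)// (integral_step_payoff mm2 l2_bnd)// /rest.
apply: (le_trans (leeD (rewards z t t0) (lee_wpmul2l (disc0 t) (claims z t t0)))).
rewrite ge0_muleDr ?lee_fin//; last by apply: integral_ge0 => y _; exact: f20.
by rewrite EFinD EFinM addeACA.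
Qed.

End two_models.

End one_step_estimates.

Local Close Scope ereal_scope.

(** * Estimates for all steps *)

Local Open Scope ereal_scope.

Section integral_off_null_set.
Context {d : measure_display} {T : measurableType d} {R : realType}.
Variables (mu : {measure set T -> \bar R}) (N : set T).
Hypotheses (mN : measurable N) (N0 : mu N = 0).

(** In these two versions of monotonicity up to a null set, only one of the functions
    is measurable: f can be restricted to the complement of N, or g be raised to +oo
    on N, without a change of its integral. *)
Lemma ge0_le_integral_off_null_lower (f g : T -> \bar R) :
    measurable_fun setT f -> (forall x, 0 <= f x) -> (forall x, 0 <= g x) ->
    (forall x, ~ N x -> f x <= g x) ->
  \int[mu]_x f x <= \int[mu]_x g x.
Proof.
move=> mf f0 g0 fg.
have -> : \int[mu]_x f x = \int[mu]_(x in ~` N) f x.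
  rewrite -[X in \int[_]_(x in X) _](setUv N) ge0_integral_setU//; last 3 first.
  - exact: measurableC.
  - by rewrite setUv.
  - exact/disj_setPCl.
  rewrite [X in X + _](_ : _ = 0) ?add0e//.
  by apply: null_set_integral => //; exact: measurable_funTS.
rewrite integral_mkcond; apply: ge0_le_integralT => x.
by rewrite patchE; case: ifPn => [|_]; rewrite ?inE ?lexx ?f0 ?g0//= => /fg ->.
Qed.

Lemma ge0_le_integral_off_null_upper (f g : T -> \bar R) :
    measurable_fun setT g -> (forall x, 0 <= f x) -> (forall x, 0 <= g x) ->
    (forall x, ~ N x -> f x <= g x) ->
  \int[mu]_x f x <= \int[mu]_x g x.
Proof.
move=> mg f0 g0 fg.
pose h := (fun=> +oo : \bar R) \_ N.
have h0 x : 0 <= h x by apply: erestrict_ge0.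
have mh : measurable_fun setT h by apply/(measurable_restrictT _ _).1.
have -> : \int[mu]_x g x = \int[mu]_x (g x + h x).
  by rewrite ge0_integralD// -integral_mkcond integral_cst// N0 mule0 adde0.
apply: ge0_le_integralT => x; rewrite f0/=.
have [Nx|Nx] := pselect (N x).
  by rewrite /h patchE mem_set// addey ?leey// gt_eqF// (lt_le_trans _ (g0 x)).
by rewrite (le_trans (fg x Nx))// leeDl.
Qed.

End integral_off_null_set.

Section iterated_estimates.
Context {R : realType} (a c lambda delta : R) (lawT lawY : probability R R).
Hypotheses (c_gt0 : (0 < c)%R) (lambda_gt0 : (0 < lambda)%R) (delta_gt0 : (0 < delta)%R).
Hypothesis lawTE : forall A, measurable A -> lawT A = exponential_prob lambda A.
Let r : R := (lambda / (lambda + delta))%R.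

Lemma discount_factor_ge0 : (0 <= r)%R.
Proof. by rewrite divr_ge0 ?addr_ge0 ?ltW. Qed.

Lemma discount_factor_lt1 : (r < 1)%R.
Proof. by rewrite ltr_pdivrMr ?addr_gt0// mul1r ltrDl. Qed.

Lemma iter_one_step_cst (m : R -> R -> R) (l : R -> R) (k : R) n z : (0 <= k)%R ->
    measurable_fun [set: R * R] (fun p => m p.1 p.2) -> measurable_fun [set: R] l ->
    (forall z, (0 <= l z <= c)%R) ->
  iter n (one_step a delta m l lawT lawY) (fun=> k%:E) z
    <= iter n (one_step a delta m l lawT lawY) (fun=> 0) z + (r ^+ n * k)%:E.
Proof.
move=> k0 mm ml l_bnd; elim: n z => [|n IH] z.
  by rewrite /= expr0 mul1r add0e.
have k0E (u : R) : 0 <= k%:E by rewrite lee_fin.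
have [mf1 f10] := iter_one_step_measurable a delta lawT lawY mm ml l_bnd n
  (measurable_cst k%:E) k0E.
have [mf2 f20] := iter_one_step_measurable a delta lawT lawY mm ml l_bnd n
  (measurable_cst (0 : \bar R)) (fun=> lexx 0).
have e0 : (0 <= r ^+ n * k)%R by rewrite mulr_ge0// exprn_ge0// discount_factor_ge0.
rewrite !iterS.
have -> : (r ^+ n.+1 * k = 0 + r * (r ^+ n * k))%R by rewrite add0r mulrA exprS.
apply: (one_step_compare (c := c) lambda_gt0 delta_gt0 lawTE) => //.
  by move=> u t t0; rewrite adde0.
move=> u t t0.
rewrite -[X in _ + X](@integral_cst_probability _ lawY) ?lee_fin//.
rewrite -ge0_integralD//; last exact: measurable_after_claim_fun.
by apply: ge0_le_integralT => y; rewrite f10 IH.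
Qed.

Section perturbation.
Variables (b : R) (F f : R -> R) (M0 M1 : R) (m1 m2 : R -> R -> R) (l1 l2 : R -> R).
Variables (kappa zeta : R).
Hypotheses (ab : (a <= b)%R) (kappa_ge0 : (0 <= kappa)%R) (zeta_ge0 : (0 <= zeta)%R).
Hypothesis F_density : has_density F f.
Hypotheses (M0_ge0 : (0 <= M0)%R) (M1_ge0 : (0 <= M1)%R).
Hypothesis f_bnd : forall x : R, (0 <= x)%R -> (`|f x| <= M0)%R.
Hypothesis f_lip : forall x y : R, (0 <= x)%R -> (0 <= y)%R ->
  (`|f x - f y| <= M1 * `|x - y|)%R.
Hypothesis lawYE : forall y : R, lawY `]-oo, y]%classic = (F y)%:E.
Hypothesis mm1 : measurable_fun [set: R * R] (fun p => m1 p.1 p.2).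
Hypothesis mm2 : measurable_fun [set: R * R] (fun p => m2 p.1 p.2).
Hypothesis ml1 : measurable_fun [set: R] l1.
Hypothesis ml2 : measurable_fun [set: R] l2.
Hypothesis l1_bnd : forall z, (0 <= l1 z <= c)%R.
Hypothesis l2_bnd : forall z, (0 <= l2 z <= c)%R.
Hypothesis m2_dead : forall z t, (z <= a)%R -> m2 z t = z.
Hypothesis l2_dead : forall z, (z <= a)%R -> l2 z = 0%R.
Hypothesis m1_le : forall z t, (a < z)%R -> (m1 z t <= b)%R.
Hypothesis m_near : forall z t, (0 <= t)%R -> (`|m1 z t - m2 z t| <= zeta)%R.
Hypothesis l_near : forall z t, (0 <= t)%R ->
  flow_reward delta m1 l1 z t <= flow_reward delta m2 l2 z t + kappa%:E.

(** The Lipschitz constant of [claim_smoothing] for functions bounded by c / delta. *)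
Definition claim_modulus : R := (c / delta * (M1 * (b - a) + M0))%R.

(** The fixed point of B |-> kappa + r * (claim_modulus * zeta + B). *)
Definition perturbation_bound : R := ((kappa + r * (claim_modulus * zeta)) / (1 - r))%R.

Lemma claim_modulus_ge0 : (0 <= claim_modulus)%R.
Proof.
by rewrite mulr_ge0 ?divr_ge0 ?(ltW c_gt0) ?(ltW delta_gt0)// addr_ge0// mulr_ge0// subr_ge0.
Qed.

Lemma perturbation_bound_ge0 : (0 <= perturbation_bound)%R.
Proof.
rewrite divr_ge0 ?subr_ge0 ?(ltW discount_factor_lt1)//.
by rewrite addr_ge0// mulr_ge0 ?discount_factor_ge0// mulr_ge0// claim_modulus_ge0.
Qed.

(** From f1 at the first model's position to f2 at the second one's: the functions are
    exchanged first, at the cost of the previous error; then the position is moved,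
    which the claim law turns into an error proportional to zeta. *)
Lemma one_step_perturbation (f1 f2 : R -> \bar R) :
    measurable_fun setT f1 -> measurable_fun setT f2 -> (forall u, 0 <= f1 u) ->
    (forall u, 0 <= f2 u <= (c / delta)%:E) -> (forall u, (u <= a)%R -> f2 u = 0) ->
    (forall u, f1 u <= f2 u + perturbation_bound%:E) ->
  forall z, one_step a delta m1 l1 lawT lawY f1 z
    <= one_step a delta m2 l2 lawT lawY f2 z + perturbation_bound%:E.
Proof.
move=> mf1 mf2 f10 f2_bnd f2_dead f12 z.
have f20 u : 0 <= f2 u by have /andP[] := f2_bnd u.
have cd0 : (0 <= c / delta)%R by rewrite divr_ge0 ?ltW.
pose eta := (claim_modulus * zeta + perturbation_bound)%R.
have eta0 : (0 <= eta)%R.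
  by rewrite addr_ge0 ?perturbation_bound_ge0// mulr_ge0 ?claim_modulus_ge0.
have -> : perturbation_bound = (kappa + r * eta)%R.
  have r1 : (1 - r != 0)%R by rewrite subr_eq0 gt_eqF// discount_factor_lt1.
  by rewrite /eta /perturbation_bound; field.
apply: (one_step_compare (c := c) lambda_gt0 delta_gt0 lawTE) => // u t t0.
have shifted : \int[lawY]_y f1 (after_claim a m1 u t y)
    <= \int[lawY]_y f2 (after_claim a m1 u t y) + perturbation_bound%:E.
  rewrite -[X in _ + X](@integral_cst_probability _ lawY) ?lee_fin ?perturbation_bound_ge0//.
  rewrite -ge0_integralD//; last 2 first.
  - exact: measurable_after_claim_fun.
  - by move=> y _; rewrite lee_fin perturbation_bound_ge0.
  by apply: ge0_le_integralT => y; rewrite f10 f12.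
apply: (le_trans shifted); rewrite /eta EFinD addeA leeD2r//.
have [ua|au] := leP u a.
  by rewrite /after_claim ua leeDl// lee_fin mulr_ge0// claim_modulus_ge0.
rewrite /after_claim (lt_geF au).
apply: (le_trans (claim_smoothing F_density M0_ge0 M1_ge0 f_bnd f_lip lawYE ab cd0
  mf2 f2_bnd f2_dead (m2 u t) (m1_le t au))).
by rewrite leeD2l// lee_fin ler_wpM2l ?claim_modulus_ge0// m_near.
Qed.

Lemma iter_one_step_perturbation n z :
  iter n (one_step a delta m1 l1 lawT lawY) (fun=> 0) z
    <= iter n (one_step a delta m2 l2 lawT lawY) (fun=> 0) z + perturbation_bound%:E.
Proof.
elim: n z => [|n IH] z; first by rewrite /= add0e lee_fin perturbation_bound_ge0.
have [mf1 f10] := iter_one_step_measurable a delta lawT lawY mm1 ml1 l1_bnd n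
  (measurable_cst (0 : \bar R)) (fun=> lexx 0).
have [mf2 f20] := iter_one_step_measurable a delta lawT lawY mm2 ml2 l2_bnd n
  (measurable_cst (0 : \bar R)) (fun=> lexx 0).
have cd0 : (0 <= c / delta)%R by rewrite divr_ge0 ?ltW.
have f2_bnd u : 0 <= iter n (one_step a delta m2 l2 lawT lawY) (fun=> 0) u <= (c / delta)%:E.
  elim: n u {IH mf1 f10 mf2 f20} => [|k IHk] u; first by rewrite /= lexx lee_fin.
  have [mk _] := iter_one_step_measurable a delta lawT lawY mm2 ml2 l2_bnd k
    (measurable_cst (0 : \bar R)) (fun=> lexx 0).
  exact: (one_step_bound a lawY c_gt0 lambda_gt0 delta_gt0 lawTE mm2 ml2 l2_bnd mk IHk).
have f2_dead u : (u <= a)%R -> iter n (one_step a delta m2 l2 lawT lawY) (fun=> 0) u = 0.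
  elim: n u {IH mf1 f10 mf2 f20 f2_bnd} => [|k IHk] u // ua.
  exact: (one_step_dead delta lawT lawY m2_dead l2_dead IHk ua).
exact: (one_step_perturbation mf1 mf2 f10 f2_bnd f2_dead IH z).
Qed.

End perturbation.

End iterated_estimates.

Local Close Scope ereal_scope.

(** * Values as limits of iterates *)

(** What the two models have in common: a nondecreasing continuous motion, and a
    running reward lx that depends on the state only through a rate l of the
    position. *)
Record dividend_model {R : realType} (c rho b : R) (phi : R -> R -> R)
    (lx : nat * R -> R) (l : R -> R) : Prop := DividendModel {
  dm_start : forall y, phi y 0 = y;
  dm_ndecr : forall y s t, s <= t -> phi y s <= phi y t;
  dm_continuous : forall y, continuous (phi y);
  dm_measurable : measurable_fun [set: R * R]
    (fun p => stopped_flow (- (c / rho)) b phi p.1 p.2);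
  dm_alive : forall y, - (c / rho) < y -> y < b -> lx (1%N, y) = l y;
  dm_barrier : lx (4%N, b) = l b;
  dm_dead : forall k y, (k == 2%N) || (k == 3%N) -> lx (k, y) = 0;
  dm_bounded : forall x, 0 <= lx x <= c;
  dm_rate_dead : forall y, y <= - (c / rho) -> l y = 0;
  dm_rate_bounded : forall z, 0 <= l z <= c;
  dm_rate_measurable : measurable_fun [set: R] l
}.

Section value_iteration.
Context {R : realType} (c rho b lambda delta : R).
Variables (phi : R -> R -> R) (lx : nat * R -> R) (l : R -> R).
Hypotheses (c_gt0 : 0 < c) (rho_gt0 : 0 < rho) (b_gt0 : 0 < b).
Hypotheses (lambda_gt0 : 0 < lambda) (delta_gt0 : 0 < delta).
Hypothesis model : dividend_model c rho b phi lx l.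
Context {d : measure_display} {Omega : measurableType d}.
Variables (P : probability Omega R) (T Y : nat -> {RV P >-> R}) (F : R -> R).
Hypothesis noise : driving_noise lambda F T Y.
Variables (lawT lawY : probability R R).
Hypothesis lawTE : forall A, measurable A -> (lawT A = exponential_prob lambda A)%E.
Hypothesis lawYE : forall y : R, (lawY `]-oo, y]%classic = (F y)%:E)%E.
Let a : R := - (c / rho).
Let m := stopped_flow a b phi.

(** Off this null set, the estimates along a path apply. *)
Let negative_noise : set Omega :=
  \bigcup_n (T n @^-1` `]-oo, 0[%classic `|` Y n @^-1` `]-oo, 0[%classic).

Let measurable_negative (X : {RV P >-> R}) : measurable (X @^-1` `]-oo, 0[%classic).
Proof. by rewrite -[_ @^-1` _]setTI; exact: measurable_funP. Qed.

Let measurable_negative_noise : measurable negative_noise.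
Proof. by apply: bigcup_measurable => n _; apply: measurableU. Qed.

Let negative_noise_null : P negative_noise = 0%E.
Proof.
case: noise => _ TE _ YE.
apply/negligibleP => //; apply: negligible_bigcup => n.
apply: negligibleU; apply/negligibleP => //.
  change (distribution P (T n) `]-oo, 0[%classic = 0%E).
  rewrite TE// /exponential_prob integral0_eq// => t /=.
  by rewrite in_itv/= => t0; rewrite lt0_exponential_pdf.
apply/eqP; rewrite eq_le measure_ge0 andbT.
have m0 : measurable [set w | 0 < Y n w].
  rewrite (_ : [set w | 0 < Y n w] = Y n @^-1` `]0, +oo[%classic).
    by rewrite -[_ @^-1` _]setTI; exact: measurable_funP.
  by apply/seteqP; split => w /=; rewrite in_itv/= andbT.
have : (P (~` [set w | (0 < Y n w)%R]) = 0)%E.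
  by rewrite probability_setC// YE subee.
move=> <-; rewrite le_measure ?inE//; first exact: measurableC.
by move=> w /=; rewrite in_itv/= => yw; apply/negP; rewrite -leNgt ltW.
Qed.

Let nonnegative_noise w : ~ negative_noise w ->
  (forall n, 0 <= T n w) /\ (forall n, 0 <= Y n w).
Proof.
move=> Nw; split=> n; rewrite leNgt; apply/negP => neg; apply: Nw; exists n => //=.
  by left; rewrite in_itv.
by right; rewrite in_itv.
Qed.

Lemma clock_position_path (x : nat * R) n w :
  clock_position T Y a x.2 (dm_measurable model) n w
  = (jump_time (T^~ w) n, path_position c rho b phi (T^~ w) (Y^~ w) x n).
Proof.
elim: n => [|n IH]; first by rewrite /jump_time big_ord0.
rewrite /jump_time big_ord_recr/= -/(jump_time (T^~ w) n).
by move: IH => /= ->.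
Qed.

Lemma chain_reward_path (x : nat * R) n w :
  chain_reward T Y a delta l x.2 (dm_measurable model) n w
  = path_reward c rho b delta phi l (T^~ w) (Y^~ w) x n.
Proof. by apply: eq_bigr => k _; rewrite clock_position_path. Qed.

Lemma discounted_reward_ge0 x w :
  0 <= discounted_reward c rho b delta phi lx (T^~ w) (Y^~ w) x.
Proof.
apply/fine_ge0/integral_ge0 => s _; rewrite lee_fin mulr_ge0 ?expR_ge0//.
by have /andP[] := dm_bounded model (process c rho b phi (T^~ w) (Y^~ w) x s).
Qed.

(** The lower bound stops the process at the n-th claim. For the upper bound, the
    process is given the terminal reward c / delta there; the corresponding iterates
    exceed those that start from 0 by the n-th power of the discount factor. *)
Lemma value_iteration_bounds n x : regular c rho b x ->
  (iter n (one_step a delta m l lawT lawY) (fun=> 0) x.2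
     <= value T Y c rho b delta phi lx x)%E /\
  (value T Y c rho b delta phi lx x
     <= iter n (one_step a delta m l lawT lawY) (fun=> 0) x.2
        + ((lambda / (lambda + delta)) ^+ n * (c / delta))%:E)%E.
Proof.
move=> xr; case: (noise) => indep TE YE _.
have [phi0 nd cont mm alive barr dead lxb ldead lb ml] := model.
have cd0 : 0 <= c / delta by rewrite divr_ge0 ?ltW.
have T_law k A : measurable A -> distribution P (T k) A = lawT A.
  by move=> mA; rewrite TE// lawTE.
have Y_law k A : measurable A -> distribution P (Y k) A = lawY A.
  apply: measure_eq_cdf => y; last exact: (etrans (YE k y) (esym (lawYE y))).
  by rewrite [X in (X < _)%E](_ : _ = (F y)%:E) ?ltry//; exact: YE.
pose mmp := dm_measurable model.
have expect := @chain_expectation _ _ _ P T Y a c delta m l lawT lawY x.2 mmp ml lb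
  indep T_law Y_law n.
have mpay := @measurable_chain_payoff _ _ _ P T Y a c delta m l x.2 mmp ml lb n.
have disc0 w : (0 <= (discount delta (clock_position T Y a x.2 mmp n w).1)%:E)%E.
  by rewrite lee_fin discount_ge0.
have chain0 w : (0 <= chain_reward T Y a delta l x.2 mmp n w)%E.
  exact: chain_reward_ge0 lb _ _.
have bounds w (Nw : ~ negative_noise w) := discounted_reward_bounds c_gt0 rho_gt0 b_gt0 delta_gt0
  phi0 nd cont alive barr dead ldead lxb (nonnegative_noise Nw).1 (nonnegative_noise Nw).2
  xr mm ml lb n.
rewrite /value unlock; split.
  rewrite -(expect (fun=> 0%E))//.
  apply: (ge0_le_integral_off_null_lower measurable_negative_noise negative_noise_null).
  - exact: (mpay (fun=> 0%E) (measurable_cst _)).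
  - by move=> w; rewrite mule0 adde0.
  - by move=> w; rewrite lee_fin discounted_reward_ge0.
  move=> w /bounds[lo _]; rewrite mule0 adde0 chain_reward_path; exact: lo.
have iter_cst := @iter_one_step_cst R a c lambda delta lawT lawY lambda_gt0 delta_gt0
  lawTE m l (c / delta) n x.2 cd0 mm ml lb.
apply: (le_trans _ iter_cst).
rewrite -(expect (fun=> (c / delta)%:E))//.
apply: (ge0_le_integral_off_null_upper measurable_negative_noise negative_noise_null).
- exact: (mpay (fun=> (c / delta)%:E) (measurable_cst _)).
- by move=> w; rewrite lee_fin discounted_reward_ge0.
- by move=> w; rewrite adde_ge0// mule_ge0// lee_fin.
move=> w /bounds[_ up]; rewrite chain_reward_path clock_position_path/= -EFinM mulrC.
exact: up.
Qed.

End value_iteration.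

(** * Comparison of the values *)

Lemma flow_reward_le_gap {R : realType} (c delta kappa : R) (m1 m2 : R -> R -> R)
    (l1 l2 w : R -> R) (z t : R) : 0 < delta ->
    measurable_fun [set: R * R] (fun p => m1 p.1 p.2) ->
    measurable_fun [set: R * R] (fun p => m2 p.1 p.2) ->
    measurable_fun [set: R] l1 -> measurable_fun [set: R] l2 ->
    (forall u, 0 <= l1 u <= c) -> (forall u, 0 <= l2 u <= c) ->
    measurable_fun setT w -> (forall s, 0 <= w s) ->
    (forall s, 0 <= s <= t -> `|l1 (m1 z s) - l2 (m2 z s)| <= w s) ->
    (\int[lebesgue_measure]_(s in `[0%R, t]) (w s)%:E <= kappa%:E)%E ->
  (flow_reward delta m1 l1 z t <= flow_reward delta m2 l2 z t + kappa%:E)%E.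
Proof.
move=> delta_gt0 mm1 mm2 ml1 ml2 l1_bnd l2_bnd mw w0 gap wk.
have mwE (D : set R) : measurable_fun D (fun s => (w s)%:E).
  by apply/measurable_funTS/measurable_EFinP.
have mrate (m : R -> R -> R) (l : R -> R) (D : set R) :
    measurable_fun [set: R * R] (fun p => m p.1 p.2) -> measurable_fun [set: R] l ->
    measurable_fun D (fun s => (discount delta s * l (m z s))%:E).
  move=> mm ml; apply/measurable_funTS/measurable_EFinP.
  exact: (measurable_reward_rate delta mm ml).
have rate0 (m : R -> R -> R) (l : R -> R) s : (forall u, 0 <= l u <= c) ->
    (0 <= (discount delta s * l (m z s))%:E)%E.
  move=> lb; rewrite lee_fin mulr_ge0 ?discount_ge0//.
  by have /andP[] := lb (m z s).
apply: (@le_trans _ _ (flow_reward delta m2 l2 z t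
    + \int[lebesgue_measure]_(s in `[0%R, t[) (w s)%:E)%E); last first.
  rewrite leeD2l//; apply: le_trans wk.
  apply: ge0_subset_integral => //; first exact: mwE.
    by move=> s _; rewrite lee_fin.
  by move=> s /=; rewrite !in_itv/= => /andP[-> /ltW].
rewrite /flow_reward -ge0_integralD//; last 4 first.
- by move=> s _; exact: (rate0 m2 l2 s l2_bnd).
- exact: (mrate m2 l2 _ mm2 ml2).
- by move=> s _; rewrite lee_fin.
- exact: mwE.
apply: ge0_le_integral => //.
- by move=> s _; exact: (rate0 m1 l1 s l1_bnd).
- exact: (mrate m1 l1 _ mm1 ml1).
- by apply: emeasurable_funD; [exact: (mrate m2 l2 _ mm2 ml2)|exact: mwE].
move=> s /=; rewrite in_itv/= => /andP[s0 st]; rewrite -EFinD lee_fin.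
  have := gap s; rewrite s0 (ltW st) => /(_ isT); rewrite ler_norml => /andP[_ lw].
  have d0 := discount_ge0 delta s.
  have d1 : discount delta s <= 1 by rewrite -expR0 ler_expR oppr_le0 mulr_ge0// ltW.
  have := ler_wpM2r (w0 s) d1; have := ler_wpM2l d0 lw; lra.
Qed.

Section models.
Context {R : realType} (c rho b eps : R) (phi psi : R -> R -> R).
Hypotheses (c_gt0 : 0 < c) (rho_gt0 : 0 < rho) (b_gt0 : 0 < b).

Lemma original_model : is_flow (g1 c rho) phi ->
  dividend_model c rho b phi (ell c) (barrier_reward c b).
Proof.
move=> fl; have gB := g1_bnd c_gt0 rho_gt0.
split.
- exact: flow0 fl.
- exact: flow_ndecr gB fl.
- exact: flow_continuous fl.
- exact: (measurable_stopped_flow (- (c / rho)) b gB (g1_one_sided c rho_gt0) fl).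
- by move=> y _ yb; rewrite /ell /barrier_reward/= yb.
- by rewrite /ell /barrier_reward/= ltxx.
- by move=> [|[|[|[|k]]]] y.
- by move=> x; rewrite /ell; case: ifP => _; rewrite lexx ?ltW.
- by move=> y ya; rewrite /barrier_reward (le_lt_trans ya (barrier_gt_ruin c_gt0 rho_gt0 b_gt0)).
- exact: barrier_reward_bnd.
- exact: measurable_barrier_reward.
Qed.

Hypotheses (eps_gt0 : 0 < eps) (eps_b : eps < b / 2) (eps_a : eps < c / rho).

Lemma smoothed_model : is_flow (g1_eps c rho b eps) psi ->
  dividend_model c rho b psi (ell_eps c b eps) (smooth_reward c b eps).
Proof.
move=> fl; have gB := g1_eps_bnd c_gt0 rho_gt0 b_gt0 eps_gt0 eps_b eps_a.
split.
- exact: flow0 fl.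
- exact: flow_ndecr gB fl.
- exact: flow_continuous fl.
- exact: (measurable_stopped_flow (- (c / rho)) b gB
    (g1_eps_one_sided c_gt0 rho_gt0 b_gt0 eps_gt0 eps_b eps_a) fl).
- by [].
- by rewrite smooth_reward_top.
- by move=> [|[|[|[|k]]]] y.
- move=> [k y]; rewrite /ell_eps/=; case: ifP => _.
    exact: (smooth_reward_bnd b c_gt0 eps y).
  by rewrite /ell; case: ifP => _; rewrite lexx ?ltW.
- move=> y ya; rewrite smooth_reward_low// (le_trans ya)//.
  by rewrite lerNl (@le_trans _ _ 0)// ?divr_ge0 ?(ltW c_gt0) ?(ltW rho_gt0)//;
    move: eps_b; lra.
- exact: smooth_reward_bnd.
- exact: measurable_smooth_reward.
Qed.

End models.

Section value_comparison.
Context {R : realType} (c rho b lambda delta : R) (F f : R -> R) (M0 M1 : R).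
Hypotheses (c_gt0 : 0 < c) (rho_gt0 : 0 < rho) (b_gt0 : 0 < b).
Hypotheses (lambda_gt0 : 0 < lambda) (delta_gt0 : 0 < delta).
Hypothesis F_density : has_density F f.
Hypotheses (M0_ge0 : 0 <= M0) (M1_ge0 : 0 <= M1).
Hypothesis f_bnd : forall x : R, 0 <= x -> `|f x| <= M0.
Hypothesis f_lip : forall x y : R, 0 <= x -> 0 <= y -> `|f x - f y| <= M1 * `|x - y|.
Let a : R := - (c / rho).

(** The iterates of the two operators stay within a fixed distance, and they converge
    to the values. *)
Lemma value_compare (phi1 phi2 : R -> R -> R) (lx1 lx2 : nat * R -> R) (l1 l2 : R -> R)
    (kappa zeta : R)
    (d1 : measure_display) (Omega1 : measurableType d1) (P1 : probability Omega1 R)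
    (T1 Y1 : nat -> {RV P1 >-> R})
    (d2 : measure_display) (Omega2 : measurableType d2) (P2 : probability Omega2 R)
    (T2 Y2 : nat -> {RV P2 >-> R}) (x : nat * R) :
    0 <= kappa -> 0 <= zeta ->
    dividend_model c rho b phi1 lx1 l1 -> dividend_model c rho b phi2 lx2 l2 ->
    driving_noise lambda F T1 Y1 -> driving_noise lambda F T2 Y2 ->
    (forall z t, 0 <= t ->
      `|stopped_flow a b phi1 z t - stopped_flow a b phi2 z t| <= zeta) ->
    (forall z t, 0 <= t -> (flow_reward delta (stopped_flow a b phi1) l1 z t
      <= flow_reward delta (stopped_flow a b phi2) l2 z t + kappa%:E)%E) ->
    regular c rho b x ->
  (value T1 Y1 c rho b delta phi1 lx1 x <= value T2 Y2 c rho b delta phi2 lx2 x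
    + (perturbation_bound a c lambda delta b M0 M1 kappa zeta)%:E)%E.
Proof.
move=> kappa0 zeta0 model1 model2 noise1 noise2 m_near l_near xr.
pose lawT : probability R R := distribution P1 (T1 0%N).
pose lawY : probability R R := distribution P1 (Y1 0%N).
have lawTE A : measurable A -> (lawT A = exponential_prob lambda A)%E.
  by case: noise1 => _ TE _ _; exact: TE.
have lawYE (y : R) : (lawY `]-oo, y]%classic = (F y)%:E)%E.
  by case: noise1 => _ _ YE _; exact: YE.
set r := lambda / (lambda + delta).
set B := perturbation_bound _ _ _ _ _ _ _ _ _.
have ab : a <= b by apply/ltW/barrier_gt_ruin.
have bounds1 n := value_iteration_bounds c_gt0 rho_gt0 b_gt0 lambda_gt0 delta_gt0
  model1 noise1 lawTE lawYE n xr.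
have bounds2 n := value_iteration_bounds c_gt0 rho_gt0 b_gt0 lambda_gt0 delta_gt0
  model2 noise2 lawTE lawYE n xr.
case: (model1) => _ _ _ mm1 _ _ _ _ _ lb1 ml1.
case: (model2) => _ _ _ mm2 _ _ _ _ ldead2 lb2 ml2.
have m2_dead z t : z <= a -> stopped_flow a b phi2 z t = z by exact: stopped_flow_dead.
have m1_le z t : a < z -> stopped_flow a b phi1 z t <= b by exact: stopped_flow_le.
have iter n := iter_one_step_perturbation c_gt0 lambda_gt0 delta_gt0 lawTE ab kappa0 zeta0
  F_density M0_ge0 M1_ge0 f_bnd f_lip lawYE mm1 mm2 ml1 ml2 lb1 lb2 m2_dead ldead2
  m1_le m_near l_near n x.2.
have cd0 : 0 < c / delta by rewrite divr_gt0.
have rcvg : (fun n => r ^+ n) @ \oo --> (0 : R).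
  apply: cvg_expr; rewrite ger0_norm; first exact: discount_factor_lt1.
  exact: discount_factor_ge0.
apply/lee_addgt0Pr => e e0.
have ecd : 0 < e / (c / delta) by rewrite divr_gt0.
have [n _ /(_ n (leqnn n)) rn] := (@cvgr0_norm_lt _ _ _ _ _ _ rcvg _ ecd).
have rne : r ^+ n * (c / delta) <= e.
  by rewrite -ler_pdivlMr// (le_trans (ler_norm _))// ltW.
apply: (le_trans (bounds1 n).2).
apply: (le_trans (leeD2r _ (iter n))).
apply: leeD; last by rewrite lee_fin.
exact: (leeD2r _ (bounds2 n).1).
Qed.

End value_comparison.

(** The bound is linear in (kappa, zeta), so errors of order eps give a bound of order
    eps. *)
Lemma perturbation_bound_scale {R : realType} (a c lambda delta b M0 M1 kappa zeta e : R) :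
  perturbation_bound a c lambda delta b M0 M1 (kappa * e) (zeta * e)
  = perturbation_bound a c lambda delta b M0 M1 kappa zeta * e.
Proof. by rewrite /perturbation_bound; ring. Qed.

(* The constant C depends on the parameters and on the claim law only. The
   processes X and X^eps may be realized on different probability spaces. *)
Theorem theorem6p3 (R : realType) (c rho b lambdaN delta : R) (FY fY : R -> R)
    (c_gt0 : 0 < c) (rho_gt0 : 0 < rho) (b_gt0 : 0 < b)
    (lambdaN_gt0 : 0 < lambdaN) (delta_gt0 : 0 < delta)
    (FY_density : has_density FY fY) (fY_C20 : C20 fY) :
  exists C : R, 0 < C /\
    forall eps : R, 0 < eps -> eps < Num.min (b / 2) (c / rho) ->
    forall (phi phi_eps : R -> R -> R),
      is_flow (g1 c rho) phi -> is_flow (g1_eps c rho b eps) phi_eps ->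
    forall (d : measure_display) (Omega : measurableType d)
      (P : probability Omega R) (T Y : nat -> {RV P >-> R}),
      driving_noise lambdaN FY T Y ->
    forall (d' : measure_display) (Omega' : measurableType d')
      (P' : probability Omega' R) (T' Y' : nat -> {RV P' >-> R}),
      driving_noise lambdaN FY T' Y' ->
    let V := value T Y c rho b delta phi (ell c) in
    let V_eps := value T' Y' c rho b delta phi_eps (ell_eps c b eps) in
    (sup_norm (state_space c rho b) (fun x => V_eps x - V x) <= (C * eps)%:E)%E.
Proof.
have [M0 [M1 [M0_ge0 M1_ge0 f_bnd f_lip]]] := C20_bounded_lipschitz fY_C20.
pose K := lag_constant c rho b; pose L := reward_gap_constant c rho b.
pose B := perturbation_bound (- (c / rho)) c lambdaN delta b M0 M1 L K.
have K_ge0 : 0 <= K := lag_constant_ge0 c_gt0 rho_gt0 b_gt0.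
have L_ge0 : 0 <= L by rewrite /L /reward_gap_constant -/K; lra.
have ab : - (c / rho) <= b by apply/ltW/barrier_gt_ruin.
have B_ge0 : 0 <= B by exact: perturbation_bound_ge0.
have rd0 : 0 < 2 * rho / delta by rewrite divr_gt0// mulr_gt0.
exists (B + 2 * rho / delta); split; first by rewrite ltr_wpDl.
move=> eps eps_gt0; rewrite lt_min => /andP[eps_b eps_a] phi psi phi_flow psi_flow.
move=> d Omega P T Y noise d' Omega' P' T' Y' noise'.
cbv zeta; set V_eps := value T' Y' _ _ _ _ _ _; set V := value T Y _ _ _ _ _ _.
have model := original_model c_gt0 rho_gt0 b_gt0 phi_flow.
have model' := smoothed_model c_gt0 rho_gt0 b_gt0 eps_gt0 eps_b eps_a psi_flow.
have cd0 : 0 <= c / delta by rewrite divr_ge0 ?ltW.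
have lawTE n A : measurable A -> (distribution P (T n) A = exponential_prob lambdaN A)%E.
  by case: noise => _ TE _ _; exact: TE.
have lawYE n (y : R) : (distribution P (Y n) `]-oo, y]%classic = (FY y)%:E)%E.
  by case: noise => _ _ YE _; exact: YE.
apply: ub_ereal_sup => _ [x /state_space_regular xr <-].
have [V_ge0 V_le] := value_iteration_bounds c_gt0 rho_gt0 b_gt0 lambdaN_gt0 delta_gt0
  model noise (lawTE 0%N) (lawYE 0%N) 0 xr.
have [V_eps_ge0 V_eps_le] := value_iteration_bounds c_gt0 rho_gt0 b_gt0 lambdaN_gt0
  delta_gt0 model' noise' (lawTE 0%N) (lawYE 0%N) 0 xr.
rewrite /= add0e expr0 mul1r in V_ge0 V_le V_eps_ge0 V_eps_le.
have [v vE] : exists v, V x = v%:E.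
  exists (fine (V x)); rewrite fineK// ge0_fin_numE//.
  by apply: (le_lt_trans V_le); rewrite ltry.
have [u uE] : exists u, V_eps x = u%:E.
  exists (fine (V_eps x)); rewrite fineK// ge0_fin_numE//.
  by apply: (le_lt_trans V_eps_le); rewrite ltry.
have v_bnd : 0 <= v <= c / delta.
  by rewrite -!lee_fin -vE V_ge0 V_le.
have u_bnd : 0 <= u <= c / delta.
  by rewrite -!lee_fin -uE V_eps_ge0 V_eps_le.
rewrite vE uE -EFinB abse_EFin lee_fin mulrDl.
have Beps : 0 <= B * eps by rewrite mulr_ge0// ltW.
(* for large eps, c / delta <= (2 * rho / delta) * eps bounds the difference *)
have [eps_small|eps_large] := leP (2 * rho * eps) c; last first.
  have : c / delta <= 2 * rho / delta * eps.
    have -> : 2 * rho / delta * eps = 2 * rho * eps / delta by ring.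
    by rewrite ler_pM2r ?invr_gt0// ltW.
  by rewrite ler_norml; lra.
have lag z t : `|stopped_flow (- (c / rho)) b psi z t
    - stopped_flow (- (c / rho)) b phi z t| <= K * eps.
  have /andP[lag0 lagK] := stopped_flow_lag c_gt0 rho_gt0 b_gt0 eps_gt0 eps_b eps_small
    phi_flow psi_flow z t.
  by rewrite distrC ger0_norm.
have Keps : 0 <= K * eps by rewrite mulr_ge0// ltW.
have Leps : 0 <= L * eps by rewrite mulr_ge0// ltW.
have gap z t (t0 : 0 <= t) := reward_gap c_gt0 rho_gt0 b_gt0 eps_gt0 eps_b eps_small
  phi_flow psi_flow z t0.
case: (model) => _ _ _ mm _ _ _ _ _ lb ml.
case: (model') => _ _ _ mm' _ _ _ _ _ lb' ml'.
have le1 : (V_eps x <= V x + (B * eps)%:E)%E.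
  rewrite -perturbation_bound_scale.
  apply: (value_compare c_gt0 rho_gt0 b_gt0 lambdaN_gt0 delta_gt0 FY_density M0_ge0
    M1_ge0 f_bnd f_lip Leps Keps model' model noise' noise _ _ xr) => z t t0; first exact: lag.
  have [w [mw w0 wgap wint]] := gap z t t0.
  exact: (flow_reward_le_gap delta_gt0 mm' mm ml' ml lb' lb mw w0 wgap wint).
have le2 : (V x <= V_eps x + (B * eps)%:E)%E.
  rewrite -perturbation_bound_scale.
  apply: (value_compare c_gt0 rho_gt0 b_gt0 lambdaN_gt0 delta_gt0 FY_density M0_ge0
    M1_ge0 f_bnd f_lip Leps Keps model model' noise noise' _ _ xr) => z t t0.
    by rewrite distrC; exact: lag.
  have [w [mw w0 wgap wint]] := gap z t t0.
  apply: (flow_reward_le_gap delta_gt0 mm mm' ml ml' lb lb' mw w0 _ wint) => s st.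
  by rewrite distrC wgap.
rewrite vE uE -!EFinD !lee_fin in le1 le2.
have : 0 <= 2 * rho / delta * eps by rewrite mulr_ge0// ltW.
by rewrite ler_norml; move: le1 le2; lra.
Qed.
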